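(* Fix a proper embedding of the annulus in a solid torus of the H-decomposition of $S^1\times S^2$. The following assertion, obtained from the Tait-type theorem for simple diagrams (the same assertion with ''simple'' in place of ''quasi-simple'') by simply replacing ''simple'' with ''quasi-simple'', is false: ''Let $D\subset S^1\times[-1,1]$ be a link diagram of a $\mathbb{Z}_2$-homologically trivial link $L\subset S^1\times S^2$. If $D$ is alternating and quasi-simple, and $L$ is non H-split (e.g. a knot) and not contained in a 3-ball, then the number of crossings of $D$ is equal to the crossing number of $L$.'' In fact, there are two explicit alternating quasi-simple diagrams in $S^1\times[-1,1]$ with different numbers of crossings which, via the same fixed proper embedding of the annulus, represent the same $\mathbb{Z}_2$-homologically trivial knot, and this knot shows that the assertion fails.
   Context: H-decomposition: the decomposition $S^1\times S^2=V_1\cup V_2$ into two solid tori, unique up to isotopy. Diagrams: a solid torus $V$ of the H-decomposition is the thickening $V\cong A\times[-1,1]$ of a properly embedded annulus $A=S^1\times[-1,1]$; once such an embedding is fixed (it is not unique up to isotopy), every link in $S^1\times S^2$ is represented by a link diagram $D\subset S^1\times[-1,1]$, and each such diagram determines a link in $S^1\times S^2$. A diagram is alternating if the parametrization of each of its components meets overpasses and underpasses alternately. The crossing number of a link $L\subset S^1\times S^2$ is the minimal number of crossings that a diagram in $S^1\times[-1,1]$ must have to represent $L$ with some proper embedding of the annulus in a solid torus of the H-decomposition. A link $L$ is $\mathbb{Z}_2$-homologically trivial if $[L]=0\in H_1(S^1\times S^2;\mathbb{Z}_2)$. A link $L$ is H-split if it is the union of two non-empty sublinks $L_1,L_2$ such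 that either there is a 3-ball $B$ with $L_1\subset B$ and $L_2\subset (S^1\times S^2)\setminus B$, or there are two solid tori $V_1,V_2$ with disjoint interiors, $S^1\times S^2=V_1\cup V_2$, $\partial V_1=\partial V_2$, $L_1\subset V_1$ and $L_2\subset V_2$; otherwise it is non H-split. Crossings of type I: a crossing $c$ of $D$ is of type I if there is an embedded disk in the annulus whose boundary circle meets $D$ only at $c$, passing through $c$ from one of the four local corners to the opposite one. Crossings of type II: a crossing $c$ is of type II if it is adjacent to the two external regions (those touching the boundary of the annulus), i.e. there is a properly embedded arc in the annulus joining $S^1\times\{-1\}$ to $S^1\times\{1\}$ that meets $D$ only at $c$, passing through $c$ from one local corner to the opposite one. The diagram $D$ is simple if it has no crossings of type I or II; it is quasi-simple if it has no crossings of type I and at most one crossing of type II. *)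

(* Defs.v *)
(* MathComp-Analysis. Everything is stated in the topological, locally flat
   category. *)
From mathcomp Require Import all_boot all_order all_algebra.
From mathcomp Require Import all_classical all_reals all_analysis.

Set Implicit Arguments.
Unset Strict Implicit.
Unset Printing Implicit Defensive.

Import Order.TTheory GRing.Theory Num.Theory.
Import numFieldNormedType.Exports.

Local Open Scope classical_set_scope.
Local Open Scope ring_scope.

(** * Spaces *)

Section Spaces.
Variable R : realType.

Definition circle : set (R * R) := [set z | z.1 ^+ 2 + z.2 ^+ 2 = 1].
Definition disk : set (R * R) := [set z | z.1 ^+ 2 + z.2 ^+ 2 <= 1].
Definition sphere : set (R * R * R) :=
  [set z | z.1.1 ^+ 2 + z.1.2 ^+ 2 + z.2 ^+ 2 = 1].
Definition ball3 (r : R) : set (R * R * R) :=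
  [set z | z.1.1 ^+ 2 + z.1.2 ^+ 2 + z.2 ^+ 2 <= r ^+ 2].

Definition S1S2 : set ((R * R) * (R * R * R)) := circle `*` sphere.

Definition annulus : set (R * R * R) := circle `*` `[-1, 1].
Definition annulus_int : set (R * R * R) := circle `*` `]-1, 1[.
Definition thick_annulus : set (R * R * R * R) := annulus `*` `[-1, 1].

Definition circle_pt (t : R) : R * R := (cos (2 * pi * t), sin (2 * pi * t)).

End Spaces.

Arguments circle {R}.
Arguments disk {R}.
Arguments sphere {R}.
Arguments S1S2 {R}.
Arguments annulus {R}.
Arguments annulus_int {R}.
Arguments thick_annulus {R}.

(** The ambient types of the annulus and of S^1 x S^2. *)
Notation Apt R := (R * R * R)%type.
Notation Mpt R := ((R * R) * (R * R * R))%type.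

(** * Homeomorphisms and isotopies *)

Definition homeo_on (T U : topologicalType) (A : set T) (B : set U)
    (f : T -> U) : Prop :=
  exists g : U -> T,
    [/\ {within A, continuous f}, {within B, continuous g},
        (forall x, A x -> B (f x) /\ g (f x) = x)
      & (forall y, B y -> A (g y) /\ f (g y) = y)].

Definition embedding_on (T U : topologicalType) (A : set T) (B : set U)
    (f : T -> U) : Prop :=
  f @` A `<=` B /\ homeo_on A (f @` A) f.

Section Topology.
Variable R : realType.

Definition ambient_isotopy (H : R -> Mpt R -> Mpt R) : Prop :=
  [/\ {within (`[0, 1] : set R) `*` S1S2,
         continuous (fun x : R * Mpt R => H x.1 x.2)},
      (forall x, S1S2 x -> H 0 x = x)
    & (forall t, 0 <= t <= 1 -> homeo_on S1S2 S1S2 (H t))].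

Definition isotopic (X Y : set (Mpt R)) : Prop :=
  exists2 H, ambient_isotopy H & H 1 @` X = Y.

(** Tame 3-balls: the closed ball has a collar, which rules out wild
    embeddings. *)
Definition is_3ball (B : set (Mpt R)) : Prop :=
  exists2 h : R * R * R -> Mpt R,
    embedding_on (ball3 2) S1S2 h & B = h @` ball3 1.

Definition is_solid_torus (V : set (Mpt R)) : Prop :=
  V `<=` S1S2 /\
  exists f : (R * R) * (R * R) -> Mpt R, homeo_on (circle `*` disk) V f.

(** Interior and frontier relative to S^1 x S^2; for a solid torus they are the
    interior and the boundary of the manifold. *)
Definition interiorM (V : set (Mpt R)) : set (Mpt R) :=
  [set x | S1S2 x /\ exists O, [/\ open O, O x & O `&` S1S2 `<=` V]].
Definition boundaryM (V : set (Mpt R)) : set (Mpt R) := V `\` interiorM V.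

Definition solid_tori_decomposition (V1 V2 : set (Mpt R)) : Prop :=
  [/\ is_solid_torus V1 /\ is_solid_torus V2,
      interiorM V1 `&` interiorM V2 = set0,
      V1 `|` V2 = S1S2
    & boundaryM V1 = boundaryM V2].

(** Decompositions into two solid tori being unique up to isotopy, the
    H-decomposition is the isotopy class of the product of S^1 with the two
    hemispheres of S^2. *)
Definition north : set (Mpt R) := [set x | S1S2 x /\ 0 <= x.2.2].
Definition south : set (Mpt R) := [set x | S1S2 x /\ x.2.2 <= 0].

Definition H_decomposition (V1 V2 : set (Mpt R)) : Prop :=
  solid_tori_decomposition V1 V2 /\
  exists H, [/\ ambient_isotopy H, H 1 @` north = V1 & H 1 @` south = V2].

(** A proper embedding of the annulus in a solid torus V of the
    H-decomposition, together with the identification of V with its thickening;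
    the annulus itself is [e (_, 0)], and the last coordinate is the height. *)
Definition proper_annulus_embedding (e : Apt R * R -> Mpt R) : Prop :=
  exists V1 V2, H_decomposition V1 V2 /\
    (homeo_on thick_annulus V1 e \/ homeo_on thick_annulus V2 e).

End Topology.

(** * Links *)

(** Closed curves are 1-periodic maps on R. *)
Definition closed_curve (R : realType) (T : topologicalType) (X : set T)
    (f : R -> T) : Prop :=
  [/\ continuous f, (forall t, f (t + 1) = f t) & (forall t, X (f t))].

(** The points of a disjoint union of n circles R/Z. *)
Definition param (R : realType) (n : nat) : set ('I_n * R) :=
  [set p | 0 <= p.2 < 1].

Arguments param {R n}.

(** No tameness condition is imposed here: a link which is represented by a
    diagram is automatically locally flat. *)
Record link (R : realType) := Link {
  lcomp : nat;
  lcurve : 'I_lcomp -> R -> Mpt R;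
  lcomp_gt0 : (0 < lcomp)%N;
  lcurveP : forall i, closed_curve S1S2 (lcurve i);
  lcurve_inj : forall p q : 'I_lcomp * R, param p -> param q ->
    lcurve p.1 p.2 = lcurve q.1 q.2 -> p = q }.

Section Links.
Variable R : realType.
Implicit Type L : link R.

Definition sublink_set L (I : {set 'I_(lcomp L)}) : set (Mpt R) :=
  [set x | exists i t, i \in I /\ x = lcurve i t].

Definition link_set L : set (Mpt R) := @sublink_set L [set: 'I_(lcomp L)]%SET.

Definition is_knot L : Prop := lcomp L = 1%N.

Definition in_3ball L : Prop := exists2 B, is_3ball B & link_set L `<=` B.

Definition H_split L : Prop :=
  exists I : {set 'I_(lcomp L)},
    [/\ I != finset.set0, (~: I)%SET != finset.set0
      & (exists B, [/\ is_3ball B, sublink_set I `<=` B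
                     & sublink_set (~: I)%SET `<=` S1S2 `\` B])
        \/ (exists V1 V2, [/\ solid_tori_decomposition V1 V2,
                            sublink_set I `<=` V1
                          & sublink_set (~: I)%SET `<=` V2])].

(** ** The class in H_1(S^1 x S^2; Z_2), by singular chains *)

Definition simplex2 : set (R * R) :=
  [set z | [/\ 0 <= z.1, 0 <= z.2 & z.1 + z.2 <= 1]].

Definition faces (s : R * R -> Mpt R) : seq (R -> Mpt R) :=
  [:: (fun t => s (t, 0)); (fun t => s (0, t)); (fun t => s (1 - t, t))].

(** A mod 2 chain is a list of simplices up to parity of multiplicities; a
    singular 1-simplex is only relevant through its values on [0, 1]. *)
Definition multiplicity (c : seq (R -> Mpt R)) (g : R -> Mpt R) : nat :=
  count (fun f => `[< forall t, 0 <= t <= 1 -> f t = g t >]) c.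

Definition eq_chain2 (c d : seq (R -> Mpt R)) : Prop :=
  forall g, odd (multiplicity c g) = odd (multiplicity d g).

Definition link_cycle L : seq (R -> Mpt R) :=
  [seq @lcurve R L i | i <- enum 'I_(lcomp L)].

Definition Z2_trivial L : Prop :=
  exists n (s : 'I_n -> R * R -> Mpt R),
    (forall j, {within simplex2, continuous (s j)} /\ s j @` simplex2 `<=` S1S2)
    /\ eq_chain2 (link_cycle L) (flatten [seq faces (s j) | j <- enum 'I_n]).

End Links.

(** * Link diagrams in the annulus *)

Section Curves.
Variables (R : realType) (n : nat) (g : 'I_n -> R -> Apt R).

Definition curves_set : set (Apt R) := [set x | exists i t, x = g i t].

Definition square : set (R * R) := `]-1, 1[ `*` `]-1, 1[.
Definition axes : set (R * R) := square `&` [set z | z.1 = 0 \/ z.2 = 0].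

(** A chart of the annulus at [c] in which the curves are the two axes, each
    of them being run along by one passage through [c]. *)
Definition crossing_chart (c : Apt R) (k : R * R -> Apt R) : Prop :=
  [/\ homeo_on square (k @` square) k,
      (exists2 O, open O & k @` square = O `&` annulus_int),
      k (0, 0) = c,
      curves_set `&` k @` square = k @` axes
    & exists p q : 'I_n * R, exists eps : R,
      [/\ param p, param q, p != q, 0 < eps
        & forall s, -1 < s < 1 ->
            k (s, 0) = g p.1 (p.2 + eps * s) /\
            k (0, s) = g q.1 (q.2 + eps * s)]].

End Curves.

(** [dover i t] is only meaningful when [dcurve i t] is a crossing: it then
    tells whether this passage is an overpass. *)
Record diagram (R : realType) := Diagram {
  dcomp : nat;
  dcurve : 'I_dcomp -> R -> Apt R;
  dcross : seq (Apt R);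
  dover : 'I_dcomp -> R -> bool;
  dcomp_gt0 : (0 < dcomp)%N;
  dcurveP : forall i, closed_curve annulus_int (dcurve i);
  dcross_uniq : uniq dcross;
  dcrossP : forall c, c \in dcross <->
    exists p q : 'I_dcomp * R, [/\ param p, param q, p != q,
      dcurve p.1 p.2 = c & dcurve q.1 q.2 = c];
  dcross_double : forall p q r : 'I_dcomp * R,
    param p -> param q -> param r ->
    dcurve p.1 p.2 = dcurve q.1 q.2 -> dcurve p.1 p.2 = dcurve r.1 r.2 ->
    [\/ p = q, p = r | q = r];
  dcross_transverse : forall c, c \in dcross ->
    exists k, crossing_chart dcurve c k;
  dover_periodic : forall i t, dover i (t + 1) = dover i t;
  doverP : forall p q : 'I_dcomp * R, param p -> param q -> p != q ->
    dcurve p.1 p.2 = dcurve q.1 q.2 -> dover p.1 p.2 = ~~ dover q.1 q.2 }.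

Section Diagrams.
Variable R : realType.
Implicit Type D : diagram R.

Definition diagram_set D : set (Apt R) := curves_set (@dcurve R D).

Definition crossings D : nat := size (dcross D).

Definition represents (e : Apt R * R -> Mpt R) D (L : link R) : Prop :=
  exists h : 'I_(dcomp D) -> R -> R,
    [/\ (forall i, closed_curve (`]-1, 1[ : set R) (h i)),
        (forall p q : 'I_(dcomp D) * R, param p -> param q -> p != q ->
           dcurve p.1 p.2 = dcurve q.1 q.2 -> dover p.1 p.2 ->
           h q.1 q.2 < h p.1 p.2)
      & isotopic [set x | exists i t, x = e (dcurve i t, h i t)] (link_set L)].

Definition alternating_diagram D : Prop :=
  forall (i : 'I_(dcomp D)) (s t : R), s < t ->
    dcurve i s \in dcross D -> dcurve i t \in dcross D ->
    (forall u, s < u < t -> dcurve i u \notin dcross D) ->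
    dover i s = ~~ dover i t.

(** The corner of a crossing chart given by the quadrant of signs [a], [b]. *)
Definition corner (k : R * R -> Apt R) (a b : R) : set (Apt R) :=
  k @` (@square R `&` [set z | 0 < a * z.1 /\ 0 < b * z.2]).

(** The arc [alpha] passes at time [t0] through the crossing [c], from one of
    the four local corners to the opposite one. *)
Definition passes_to_opposite_corner D (c : Apt R) (alpha : R -> Apt R)
    (t0 : R) : Prop :=
  alpha t0 = c /\
  exists k (a b d : R),
    [/\ crossing_chart (@dcurve R D) c k, a = 1 \/ a = -1, b = 1 \/ b = -1, 0 < d
      & forall u, 0 < u < d ->
          corner k a b (alpha (t0 + u)) /\ corner k (- a) (- b) (alpha (t0 - u))].

Definition type_I D (c : Apt R) : Prop :=
  c \in dcross D /\
  exists delta : R * R -> Apt R,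
    [/\ embedding_on disk annulus delta,
        delta @` circle `&` diagram_set D = [set c]
      & exists t0, passes_to_opposite_corner D c (delta \o @circle_pt R) t0].

Definition type_II D (c : Apt R) : Prop :=
  c \in dcross D /\
  exists alpha : R -> Apt R,
    [/\ embedding_on (`[-1, 1] : set R) annulus alpha,
        (alpha (-1)).2 = -1 /\ (alpha 1).2 = 1,
        (forall t, -1 < t < 1 -> annulus_int (alpha t)),
        alpha @` `[-1, 1] `&` diagram_set D = [set c]
      & exists2 t0, -1 < t0 < 1 & passes_to_opposite_corner D c alpha t0].

Definition quasi_simple_diagram D : Prop :=
  (forall c, ~ type_I D c) /\
  (forall c c', type_II D c -> type_II D c' -> c = c').

Definition is_crossing_number (L : link R) (m : nat) : Prop :=
  (exists e D, [/\ proper_annulus_embedding e, represents e D L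
                 & crossings D = m]) /\
  (forall e D, proper_annulus_embedding e -> represents e D L ->
     (m <= crossings D)%N).

End Diagrams.

(* Main.v *)
Require Import Defs.
From mathcomp Require Import all_boot all_order all_algebra.
From mathcomp Require Import all_classical all_reals all_analysis.
From mathcomp Require Import ring lra zify.
From Stdlib Require Btauto.

(** The crossing number of a link is unique (crossing_number_uniq), so the assertion fails as
    soon as one knot satisfying its hypotheses has two alternating quasi-simple
    diagrams with different numbers of crossings. The knot winds twice around
    the circle, and has a diagram with three crossings and one with four.

    Over some arc of the circle there are only two strands. In the diagram with
    four crossings they make a half turn around each other there, which gives a
    crossing of type II; exchanging rows and heights reverses the sense of this
    half turn, which changes it by a full turn. The exchange is an isotopy
    (turning_isotopy, turning_strand): the sphere over each point of the circle is
    turned by the commutator of rotations about two axes, and around the circle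
    this makes two full turns, one about each axis, which cancel in the rotation
    group; while the second one is made, the knot runs along its axis and does
    not move. A strand which then lies above the others is slid across them,
    which leaves three crossings (shear_isotopy, shearing_strand).

    These isotopies are written in one standard embedding of the thickened
    annulus, and the embedding of the statement is arbitrary. By
    extend_embedding it is the standard one followed by a homeomorphism of the
    whole of S^1 x S^2: the solid torus is doubled, which is possible since a
    homeomorphism of the solid torus preserves its boundary
    (boundary_invariance). This in turn comes from a zero theorem on the cube
    (cube_zero), deduced from a Sperner lemma.

    Diagrams are closed polygons on a grid, given by lists of integers, and
    their combinatorial properties are decided by computation. That a crossing is not of type I or II
    is witnessed by a union of regions of the lifted diagram in the universal
    cover of the annulus, which contains both sides of one half of a branch
    through the crossing and neither side of its other half. A path through the
    crossing from one corner to the opposite one enters or leaves this union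
    (passage_sides), and the rest of the lifted boundary of a disk does not
    (not_type_I); nor do the two halves of an arc that joins the boundary circles
    if the union does not reach the outer regions, and they start outside
    (not_type_II).

    The knot is trivial modulo 2 because it winds an even number of times: one
    singular triangle has it as a face, and its two other faces coincide
    (knot_trivial). It is not in a ball because it winds a nonzero number of
    times (knot_not_in_ball), and a knot is not split. *)

Set Implicit Arguments.
Unset Strict Implicit.
Unset Printing Implicit Defensive.

Import Order.TTheory GRing.Theory Num.Theory.
Import numFieldNormedType.Exports.

Local Open Scope classical_set_scope.
Local Open Scope ring_scope.

(** * Continuity on a set *)

(** [{within A, continuous f}] with the convergence unfolded: values and limits
    are taken in the ambient spaces, which the lemmas below can then compose. *)
Definition cts (T U : topologicalType) (A : set T) (f : T -> U) : Prop :=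
  forall x, A x -> f @ within A (nbhs x) --> f x.

Section Continuity.
Variables (T : topologicalType) (A : set T).

Lemma ctsP (U : topologicalType) (f : T -> U) :
  cts A f <-> {within A, continuous f}.
Proof. by split=> /subspace_continuousP. Qed.

Lemma cts_near (U : topologicalType) (f : T -> U) : cts A f <->
  forall x, A x -> forall W, nbhs (f x) W -> \forall y \near x, A y -> W (f y).
Proof. by split. Qed.

Lemma cts_cont (U : topologicalType) (f : T -> U) : continuous f -> cts A f.
Proof. by move=> cf; apply/ctsP; exact: continuous_subspaceT. Qed.

Lemma cts_cst (U : topologicalType) (u : U) : cts A (fun=> u).
Proof. by apply: cts_cont => x; exact: cvg_cst. Qed.

Lemma cts_id : cts A id.
Proof. by apply: cts_cont => x; exact: cvg_id. Qed.

Lemma cts_eq (U : topologicalType) (f g : T -> U) :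
  (forall x, A x -> f x = g x) -> cts A f -> cts A g.
Proof.
move=> fg cf x Ax; rewrite -fg //; apply: cvg_trans (cf x Ax).
by apply: fmap_within_eq => y /set_mem Ay; rewrite fg.
Qed.

Lemma cts_subset (U : topologicalType) (B : set T) (f : T -> U) :
  A `<=` B -> cts B f -> cts A f.
Proof.
move=> AB /subspace_continuousP cf; apply/ctsP.
exact: continuous_subspaceW AB cf.
Qed.

End Continuity.

Section ContinuityOperations.
Variables (T : topologicalType) (A : set T).

Lemma cts_comp (U V : topologicalType) (B : set U) (g : U -> V) (f : T -> U) :
  cts B g -> cts A f -> (forall x, A x -> B (f x)) ->
  cts A (fun x => g (f x)).
Proof.
move=> cg cf AB x Ax W /(cg _ (AB _ Ax)) gW.
have fW : \forall y \near x, A y -> B (f y) -> W (g (f y)) := cf x Ax _ gW.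
by apply: filterS fW => y + Ay => /(_ Ay); apply; exact: AB.
Qed.

Lemma cts_comp_cont (U V : topologicalType) (g : U -> V) (f : T -> U) :
  continuous g -> cts A f -> cts A (fun x => g (f x)).
Proof. by move=> cg cf; apply: (@cts_comp _ _ setT) => //; exact: cts_cont. Qed.

Lemma cts_pair (U V : topologicalType) (f : T -> U) (g : T -> V) :
  cts A f -> cts A g -> cts A (fun x => (f x, g x)).
Proof.
by move=> cf cg x Ax; apply: cvg_pair; [exact: cf|exact: cg].
Qed.

Lemma cts_fst (U V : topologicalType) (f : T -> U * V) :
  cts A f -> cts A (fun x => (f x).1).
Proof. by apply: cts_comp_cont => x; exact: cvg_fst. Qed.

Lemma cts_snd (U V : topologicalType) (f : T -> U * V) :
  cts A f -> cts A (fun x => (f x).2).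
Proof. by apply: cts_comp_cont => x; exact: cvg_snd. Qed.

(** Pasting along closed sets. *)
Lemma cts_setU (U : topologicalType) (B C : set T) (f : T -> U) :
  closed B -> closed C -> (forall x, A x -> B x \/ C x) ->
  cts (A `&` B) f -> cts (A `&` C) f -> cts A f.
Proof.
move=> clB clC AU cB cC x Ax W Wfx.
have key (D : set T) : closed D -> cts (A `&` D) f ->
    \forall y \near x, (A `&` D) y -> W (f y).
  move=> clD cD; have [Dx|nDx] := pselect (D x); first by exact: (cD x (conj Ax Dx)).
  have : \forall y \near x, (~` D) y by apply: open_nbhs_nbhs; split=> //; exact: closed_openC.
  by apply: filterS => y nDy [].
suff : \forall y \near x, A y -> W (f y) by [].
apply: filterS2 (key B clB cB) (key C clC cC) => y hB hC Ay.
by case: (AU y Ay) => ?; [apply: hB|apply: hC].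
Qed.

Lemma cts_local (U : topologicalType) (f : T -> U) :
  (forall x, A x -> exists O, [/\ open O, O x & cts (A `&` O) f]) -> cts A f.
Proof.
move=> loc x Ax W Wfx; have [B [oO Ox cO]] := loc x Ax.
have nO := open_nbhs_nbhs (conj oO Ox).
have h : \forall y \near x, (A `&` B) y -> W (f y) := cO x (conj Ax Ox) W Wfx.
suff : \forall y \near x, A y -> W (f y) by [].
by apply: filterS2 nO h => y Oy + Ay; apply.
Qed.

Variable R : realType.
Implicit Types f g : T -> R.

Lemma cts_add f g : cts A f -> cts A g -> cts A (fun x => f x + g x).
Proof. by move=> cf cg x Ax; apply: cvgD; [exact: cf|exact: cg]. Qed.

Lemma cts_opp f : cts A f -> cts A (fun x => - f x).
Proof. by move=> cf x Ax; apply: cvgN; exact: cf. Qed.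

Lemma cts_mul f g : cts A f -> cts A g -> cts A (fun x => f x * g x).
Proof. by move=> cf cg x Ax; apply: cvgM; [exact: cf|exact: cg]. Qed.

Lemma cts_exp f n : cts A f -> cts A (fun x => f x ^+ n).
Proof.
move=> cf; elim: n => [|n IH]; first exact: cts_cst.
by under [X in cts A X]eq_fun do rewrite exprS; exact: cts_mul.
Qed.

Lemma cts_inv f : cts A f -> (forall x, A x -> f x != 0) ->
  cts A (fun x => (f x)^-1).
Proof. by move=> cf f0 x Ax; apply: cvgV; [exact: f0|exact: cf]. Qed.

Lemma cts_sqrt f : cts A f -> cts A (fun x => Num.sqrt (f x)).
Proof. by apply: cts_comp_cont; exact: sqrt_continuous. Qed.

Lemma cts_cos f : cts A f -> cts A (fun x => cos (f x)).
Proof. by apply: cts_comp_cont; exact: continuous_cos. Qed.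

Lemma cts_sin f : cts A f -> cts A (fun x => sin (f x)).
Proof. by apply: cts_comp_cont; exact: continuous_sin. Qed.

Lemma cts_atan f : cts A f -> cts A (fun x => atan (f x)).
Proof. by apply: cts_comp_cont => x; exact: continuous_atan. Qed.

Lemma cts_norm f : cts A f -> cts A (fun x => `|f x|).
Proof. by move=> cf x Ax; apply: cvg_norm; exact: cf. Qed.

Lemma cts_max f g : cts A f -> cts A g -> cts A (fun x => Num.max (f x) (g x)).
Proof.
move=> cf cg.
apply: (@cts_eq _ _ _ (fun x => (f x + g x + `|f x - g x|) * 2^-1)).
  by move=> x _; case: (leP (f x) (g x)) => h;
    [rewrite ler0_norm|rewrite gtr0_norm]; lra.
apply: cts_mul; last exact: cts_cst.
by apply: cts_add; [|apply: cts_norm]; apply: cts_add => //; exact: cts_opp.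
Qed.

Lemma cts_min f g : cts A f -> cts A g -> cts A (fun x => Num.min (f x) (g x)).
Proof.
move=> cf cg; apply: (@cts_eq _ _ _ (fun x => - Num.max (- f x) (- g x))).
  by move=> x _; rewrite oppr_max !opprK.
by apply: cts_opp; apply: cts_max; exact: cts_opp.
Qed.

End ContinuityOperations.

(** Decomposes a goal [cts A (fun x => e)] along the syntax of [e]; inverses
    leave the side condition that the denominator does not vanish. *)
Ltac cts_step :=
  match goal with
  | |- cts _ (fun x => ?c) => refine (@cts_cst _ _ _ c)
  | |- cts _ (fun x => x) => refine (@cts_id _ _)
  | |- cts _ (fun x => (_, _)) => refine (cts_pair _ _)
  | |- cts _ (fun x => (_ + _)%R) => refine (cts_add _ _)
  | |- cts _ (fun x => (- _)%R) => refine (cts_opp _)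
  | |- cts _ (fun x => (_ * _)%R) => refine (cts_mul _ _)
  | |- cts _ (fun x => (_ ^+ _)%R) => refine (cts_exp _)
  | |- cts _ (fun x => (_^-1)%R) => refine (cts_inv _ _)
  | |- cts _ (fun x => Num.sqrt _) => refine (cts_sqrt _)
  | |- cts _ (fun x => cos _) => refine (cts_cos _)
  | |- cts _ (fun x => sin _) => refine (cts_sin _)
  | |- cts _ (fun x => atan _) => refine (cts_atan _)
  | |- cts _ (fun x => `|_|%R) => refine (cts_norm _)
  | |- cts _ (fun x => Num.max _ _) => refine (cts_max _ _)
  | |- cts _ (fun x => Num.min _ _) => refine (cts_min _ _)
  | |- cts _ (fun x => fst _) => refine (cts_fst _)
  | |- cts _ (fun x => snd _) => refine (cts_snd _)
  | |- cts ?A (@GRing.mul ?S ?a) => change (cts A (fun x => @GRing.mul S a x))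
  | |- cts ?A (@GRing.add ?S ?a) => change (cts A (fun x => @GRing.add S a x))
  | |- cts ?A (@GRing.opp ?S) => change (cts A (fun x => @GRing.opp S x))
  | |- cts ?A (@fst ?S ?T) => change (cts A (fun x => @fst S T x))
  | |- cts ?A (@snd ?S ?T) => change (cts A (fun x => @snd S T x))
  end.
Ltac cts_tac := repeat cts_step.

Section Closedness.
Variables (T : topologicalType) (R : realType).

Lemma closed_le_fun (f g : T -> R) : continuous f -> continuous g ->
  closed [set x | f x <= g x].
Proof.
move=> cf cg.
have -> : [set x | f x <= g x] = (fun x => g x - f x) @^-1` [set y | 0 <= y].
  by apply/seteqP; split=> x /=; rewrite subr_ge0.
apply: (closed_comp _ (@closed_ge R 0)) => x _.
by apply: cvgB; [exact: cg|exact: cf].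
Qed.

Lemma open_lt_fun (f g : T -> R) : continuous f -> continuous g ->
  open [set x | f x < g x].
Proof.
move=> cf cg.
have -> : [set x | f x < g x] = ~` [set x | g x <= f x].
  by apply/seteqP; split=> x /=; rewrite ltNge => /negP.
by apply: closed_openC; exact: closed_le_fun.
Qed.

Lemma ctsT (U : topologicalType) (f : T -> U) : cts setT f -> continuous f.
Proof.
move=> /cts_near cf x W /(cf x I) h.
by apply: filterS h => y; exact.
Qed.

Lemma open_cts_lt (O : set T) (f g : T -> R) : open O -> cts O f -> cts O g ->
  open (O `&` [set x | f x < g x]).
Proof.
move=> oO cf cg; rewrite openE => x [Ox fgx].
have ch : cts O (fun y => g y - f y) by apply: cts_add => //; exact: cts_opp.
have pos : 0 < g x - f x by rewrite subr_gt0.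
have h : \forall y \near x, O y -> 0 < g y - f y.
  exact: ch x Ox _ (open_nbhs_nbhs (conj (@open_gt R 0) pos)).
have nO := open_nbhs_nbhs (conj oO Ox).
by apply: filterS2 nO h => y Oy + ; rewrite /= subr_gt0 => /(_ Oy).
Qed.

End Closedness.

(** * The covering of the circle *)

Section Circle.
Variable R : realType.
Implicit Types (c d : R * R) (t : R).

Definition dot c d : R := c.1 * d.1 + c.2 * d.2.
Definition det c d : R := c.1 * d.2 - c.2 * d.1.

(** The signed angle from [c] to [d], in turns, when it is less than a
    quarter of a turn. *)
Definition angle c d : R := atan (det c d / dot c d) / (2 * pi).

Lemma circle_pt_circle t : circle (circle_pt t).
Proof. by rewrite /circle /circle_pt /= cos2Dsin2. Qed.

Lemma circle_pt_continuous : continuous (@circle_pt R).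
Proof.
apply: ctsT; rewrite /circle_pt; cts_tac.
Qed.

Lemma circle_ptD1 t : circle_pt (t + 1) = circle_pt t.
Proof.
rewrite /circle_pt.
have -> : 2 * pi * (t + 1) = 2 * pi * t + pi *+ 2 :> R by rewrite mulr2n; ring.
by rewrite sinD2pi cosD2pi.
Qed.

Lemma circle_ptDn t (n : nat) : circle_pt (t + n%:R) = circle_pt t.
Proof.
elim: n => [|n IH]; first by rewrite addr0.
by rewrite -natr1 addrA circle_ptD1.
Qed.

Lemma circle_ptDz t (n : int) : circle_pt (t + n%:~R) = circle_pt t.
Proof.
case: n => n; first exact: circle_ptDn.
by rewrite -[LHS](circle_ptDn _ n.+1) NegzE mulrNz subrK.
Qed.

Lemma dot_circle_pt x y :
  dot (circle_pt x) (circle_pt y) = cos (2 * pi * (y - x)).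
Proof. by rewrite /dot /= mulrBr cosB; ring. Qed.

Lemma det_circle_pt x y :
  det (circle_pt x) (circle_pt y) = sin (2 * pi * (y - x)).
Proof. by rewrite /det /= mulrBr sinB; ring. Qed.

Lemma circle_pt_surj c : circle c -> exists x, circle_pt x = c.
Proof.
move=> Cc; have c1 : -1 <= c.1 <= 1.
  have : c.1 ^+ 2 <= 1 by rewrite -Cc lerDl sqr_ge0.
  by rewrite -real_normK ?num_real // expr_le1 // ler_norml.
have s0 : 2 * pi != 0 :> R by rewrite mulf_neq0 // gt_eqF // pi_gt0.
have sq : Num.sqrt (1 - c.1 ^+ 2) = `|c.2|.
  by rewrite -Cc addrC addKr sqrtr_sqr.
have [c2|c2] := leP 0 c.2.
  exists (acos c.1 / (2 * pi)); rewrite /circle_pt mulrC divfK // acosK ?inE //.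
  by rewrite sin_acos // sq ger0_norm //; case: (c).
exists (- acos c.1 / (2 * pi)); rewrite /circle_pt mulrC divfK //.
rewrite cosN sinN acosK ?inE // sin_acos // sq ltr0_norm // opprK.
by case: (c).
Qed.

Lemma circle_pt_eq (x y : R) : circle_pt x = circle_pt y ->
  exists n : int, y = x + n%:~R.
Proof.
move=> exy; exists (Num.floor (y - x + 2^-1)); set n := Num.floor _.
have := floor_itv (y - x + 2^-1); rewrite -/n => /andP[n1].
rewrite intrD => n2; set z := y - x - n%:~R.
have : cos (2 * pi * z) = 1.
  have -> : z = (y - n%:~R) - x by rewrite /z; ring.
  rewrite -dot_circle_pt -[circle_pt (y - _)](circle_ptDz _ n) subrK -exy.
  by rewrite /dot -!expr2 circle_pt_circle.
have p0 : 0 < pi :> R by exact: pi_gt0.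
have z1 : - 2^-1 <= z by rewrite /z; lra.
have z2 : z < 2^-1 by rewrite /z; lra.
have key (w : R) : 0 <= w <= 2^-1 -> cos (2 * pi * w) = 1 -> w = 0.
  move=> /andP[w0 w1] cw; have : 2 * pi * w = 0.
    apply: cos_inj; rewrite ?cos0 // in_itv /=; apply/andP; split=> //; nra.
  by move/eqP; rewrite !mulf_eq0 pnatr_eq0 (gt_eqF p0) /= => /eqP.
move=> cz; suff : z = 0 by rewrite /z => z0; lra.
have [z0|z0] := leP 0 z; first by apply: key => //; rewrite z0 ltW.
apply: oppr_inj; rewrite oppr0; apply: key; last by rewrite mulrN cosN.
by apply/andP; split; lra.
Qed.

Lemma angleE (x y : R) : `|y| < 4^-1 -> angle (circle_pt x) (circle_pt (x + y)) = y.
Proof.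
move=> yl; have p0 : 0 < pi :> R by exact: pi_gt0.
rewrite /angle dot_circle_pt det_circle_pt addrC addKr -/(tan _) tanK.
  by rewrite mulrC mulKf // mulf_neq0 // gt_eqF.
by rewrite in_itv /=; move: yl; rewrite ltr_norml => /andP[? ?];
  apply/andP; split; nra.
Qed.

(** A positive scalar product is a positive cosine. *)
Lemma dot_gt0_close (x : R) c : circle c -> 0 < dot (circle_pt x) c ->
  exists2 y, `|y| < 4^-1 & c = circle_pt (x + y).
Proof.
move=> /circle_pt_surj[y0 <-].
set n := Num.floor (y0 - x + 2^-1).
have := floor_itv (y0 - x + 2^-1); rewrite -/n => /andP[n1].
rewrite intrD => n2.
have -> : circle_pt y0 = circle_pt (x + (y0 - x - n%:~R)).
  by rewrite -[RHS](circle_ptDz _ n); congr circle_pt; ring.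
set z := y0 - x - n%:~R => pos; exists z => //.
rewrite dot_circle_pt addrC addKr in pos.
have p0 : 0 < pi :> R by exact: pi_gt0.
have {pos} pos : 0 < cos (2 * pi * `|z|).
  by have [z0|z0] := leP 0 z; [rewrite ger0_norm|rewrite ltr0_norm // mulrN cosN].
have zl : `|z| <= 2^-1 by rewrite ler_norml /z; apply/andP; split; lra.
rewrite ltNge; apply/negP => z4; move: pos; rewrite ltNge => /negP; apply.
have zn := normr_ge0 z.
rewrite -(@cos_pihalf R) leNgt ltr_cos; try by rewrite in_itv /=;
  apply/andP; split; nra.
by rewrite -leNgt; nra.
Qed.

Lemma angleP x c : circle c -> 0 < dot (circle_pt x) c ->
  `|angle (circle_pt x) c| < 4^-1 /\ circle_pt (x + angle (circle_pt x) c) = c.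
Proof. by move=> Cc /(dot_gt0_close Cc)[y yl ->]; rewrite angleE. Qed.

Lemma dot_circle c : circle c -> dot c c = 1.
Proof. by move=> <-; rewrite /dot !expr2. Qed.

Lemma cts_dot (T : topologicalType) (A : set T) (f g : T -> R * R) :
  cts A f -> cts A g -> cts A (fun x => dot (f x) (g x)).
Proof.
by move=> cf cg; rewrite /dot; apply: cts_add; apply: cts_mul;
  by [apply: cts_fst|apply: cts_snd].
Qed.

Lemma cts_angle (T : topologicalType) (A : set T) (f g : T -> R * R) :
  cts A f -> cts A g -> (forall x, A x -> 0 < dot (f x) (g x)) ->
  cts A (fun x => angle (f x) (g x)).
Proof.
move=> cf cg pos; rewrite /angle; apply: cts_mul; last exact: cts_cst.
apply: cts_atan; apply: cts_mul.
  by rewrite /det; cts_tac.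
by apply: cts_inv; [exact: cts_dot|move=> x Ax; rewrite gt_eqF // pos].
Qed.

(** A circle-valued map on a compact set which contracts to a point lifts: along
    the contraction, in small enough uniform steps, the angle between successive
    values is less than a quarter of a turn, and the lift is the sum of these
    angles. *)
Lemma circle_lift (T : topologicalType) (K : set T) (sc : R -> T -> T) (x0 : T)
    (F : T -> R * R) :
  compact K -> cts ((`[0, 1] : set R) `*` K) (fun p => sc p.1 p.2) ->
  (forall t x, 0 <= t <= 1 -> K x -> K (sc t x)) ->
  (forall x, K x -> sc 1 x = x) -> (forall x, K x -> sc 0 x = x0) ->
  cts K F -> (forall x, K x -> circle (F x)) ->
  exists2 phi : T -> R, cts K phi & forall x, K x -> circle_pt (phi x) = F x.
Proof.
move=> cK csc Ksc sc1 sc0 cF CF.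
have [[k Kk]|K0] := pselect (exists k, K k); last first.
  by exists (fun=> 0) => [|x Kx]; [exact: cts_cst|case: K0; exists x].
have Kx0 : K x0 by rewrite -(sc0 k Kk); apply: Ksc => //; rewrite lexx ler01.
pose C := (`[0, 1] : set R) `*` K.
have cC : compact C by apply: compact_setX => //; exact: segment_compact.
have C01 t x : 0 <= t <= 1 -> K x -> C (t, x).
  by move=> t01 Kx; split=> //=; rewrite in_itv.
have cG : cts C (fun p => F (sc p.1 p.2)).
  apply: (cts_comp cF) => // -[t x] [/=]; rewrite in_itv /= => t01 Kx.
  exact: Ksc.
pose P (n : nat) (p : R * T) := forall s : R, 0 <= s <= 1 -> `|s - p.1| <= n%:R^-1 ->
  C p -> 0 < dot (F (sc p.1 p.2)) (F (sc s p.2)).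
(* By compactness, one step length works for all points and all times. *)
have : \forall n \near \oo, C `<=` P n.
  apply: (iffLR (compact_near_coveringP C) cC).
  move=> [t0 y0] C0.
  have CC0 : (C `*` C) ((t0, y0), (t0, y0)) by [].
  have cd : cts (C `*` C) (fun p : (R * T) * (R * T) =>
      dot (F (sc p.1.1 p.1.2)) (F (sc p.2.1 p.2.2))).
    apply: cts_dot.
      by apply: (@cts_comp _ _ _ _ _ _ (fun p : (R * T) * (R * T) => p.1) cG);
        [cts_tac|case=> p q []].
    by apply: (@cts_comp _ _ _ _ _ _ (fun p : (R * T) * (R * T) => p.2) cG);
      [cts_tac|case=> p q []].
  have pos : 0 < dot (F (sc t0 y0)) (F (sc t0 y0)).
    have [/= t01 Ky0] := C0; rewrite dot_circle //; apply: CF; exact: Ksc.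
  have h := cd _ CC0 _ (open_nbhs_nbhs (conj (@open_gt R 0) pos)).
  have {h} [[/= U V] [/= nU nV] UV] : \forall p \near ((t0, y0), (t0, y0)),
    (C `*` C) p -> 0 < dot (F (sc p.1.1 p.1.2)) (F (sc p.2.1 p.2.2)) by [].
  have [[/= U1 U2] [/= nU1 nU2] U12] := nU.
  have [[/= V1 V2] [/= nV1 nV2] V12] := nV.
  have [r /= r0 rV1] : exists2 r : R, 0 < r & ball t0 r `<=` V1.
    by move/nbhs_ballP: nV1.
  exists ((U1 `&` ball t0 (r / 2)) `*` (U2 `&` V2), [set n : nat | n%:R^-1 < r / 2]).
    split=> /=.
      exists (U1 `&` ball t0 (r / 2), U2 `&` V2); last by [].
      by split=> /=; apply: filterI => //; apply: nbhsx_ballx; rewrite divr_gt0.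
    have r2 : 0 < r / 2 by rewrite divr_gt0.
    exists (Num.truncn (r / 2)^-1).+1 => // n /= hn.
    rewrite invf_plt ?posrE ?ltr0n; last 2 first.
    - exact: leq_ltn_trans hn.
    - by [].
    by rewrite (lt_le_trans (truncnS_gt _)) // ler_nat.
  move=> [[t y] n] /= [[[U1t b1] [U2y V2y]] nr] s s01 /= sn Cp.
  apply: (UV ((t, y), (s, y))); last first.
    by split=> //=; apply: C01 => //; case: Cp.
  split=> /=; [exact: U12|apply: V12; split=> //=; apply: rV1].
  rewrite /ball /= in b1 *.
  rewrite (le_lt_trans (ler_distD t _ _)) // [r]splitr ltrD //.
  by rewrite distrC (le_lt_trans sn).
move=> [N _ /(_ N.+1 (leqnSn _)) hN].
pose n := N.+1; have n0 : 0 < n%:R :> R by rewrite ltr0n.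
have [xi0 exi0] := circle_pt_surj (CF _ Kx0).
pose st (i : nat) (x : T) := F (sc (i%:R / n%:R) x).
have in01 i : (i <= n)%N -> 0 <= (i%:R / n%:R : R) <= 1.
  by move=> il; rewrite divr_ge0 //= ler_pdivrMr // mul1r ler_nat.
have st_circle i x : (i <= n)%N -> K x -> circle (st i x).
  by move=> il Kx; apply: CF; apply: Ksc => //; exact: in01.
have st_dot i x : (i < n)%N -> K x -> 0 < dot (st i x) (st i.+1 x).
  move=> il Kx; apply: (hN (i%:R / n%:R, x)) => /=.
  - by apply: C01 => //; apply: in01; exact: ltnW.
  - exact: in01.
  - by rewrite -mulrBl -natr1 [_ + 1]addrC addrK mul1r ger0_norm // invr_ge0 ltW.
  - by apply: C01 => //; apply: in01; exact: ltnW.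
(* The lift after [m] steps of the contraction. *)
pose phi m x := xi0 + \sum_(i < m) angle (st i x) (st i.+1 x).
have phiE m x : (m <= n)%N -> K x -> circle_pt (phi m x) = st m x.
  elim: m => [|m IH] ml Kx; first by rewrite /phi big_ord0 addr0 exi0 /st mul0r sc0.
  have IHm := IH (ltnW ml) Kx.
  rewrite /phi big_ord_recr /= addrA -/(phi m x) -IHm.
  have [] // := @angleP (phi m x) (st m.+1 x).
  - exact: st_circle.
  - by rewrite IHm; exact: st_dot.
have st_cts i : (i <= n)%N -> cts K (st i).
  move=> il; apply: (cts_comp cF).
    apply: (@cts_comp _ _ _ _ C (fun p : R * T => sc p.1 p.2)
       (fun x => (i%:R / n%:R, x))) => //.
      by apply: cts_pair; [exact: cts_cst|exact: cts_id].
    by move=> x Kx; apply: C01 => //; exact: in01.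
  by move=> x Kx; apply: Ksc => //; exact: in01.
exists (phi n) => [|x Kx]; last by rewrite phiE // /st divff ?gt_eqF // sc1.
suff : forall m, (m <= n)%N -> cts K (phi m) by apply.
elim=> [|m IH] ml.
  apply: (@cts_eq _ _ _ (fun=> xi0)); last exact: cts_cst.
  by move=> x _; rewrite /phi big_ord0 addr0.
apply: (@cts_eq _ _ _ (fun x => phi m x + angle (st m x) (st m.+1 x))).
  by move=> x _; rewrite /phi big_ord_recr /= addrA.
apply: cts_add; first exact/IH/ltnW.
apply: cts_angle; [exact/st_cts/ltnW|exact: st_cts|].
by move=> x Kx; exact: st_dot.
Qed.

End Circle.

(** * A Sperner lemma on the cubical grid *)

Section Sperner.
Variables (m : nat) (l : nat -> nat -> nat -> nat).

Definition door2 (a b : nat) : bool :=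
  (a == 0%N) && (b == 1%N) || (a == 1%N) && (b == 0%N).
Definition door3 (a b c : nat) : bool := perm_eq [:: a; b; c] (iota 0 3).
Definition full (a b c d : nat) : bool := perm_eq [:: a; b; c; d] (iota 0 4).

Let addbE a b : a (+) b = xorb a b. Proof. by case: a b => [] []. Qed.

Lemma full_doors a b c d : (a <= 3)%N -> (b <= 3)%N -> (c <= 3)%N -> (d <= 3)%N ->
  full a b c d = door3 b c d (+) door3 a c d (+) door3 a b d (+) door3 a b c.
Proof.
have : all (fun a => all (fun b => all (fun c => all (fun d =>
    full a b c d == door3 b c d (+) door3 a c d (+) door3 a b d (+) door3 a b c)
  (iota 0 4)) (iota 0 4)) (iota 0 4)) (iota 0 4) by vm_compute.
have in4 q : (q <= 3)%N -> q \in iota 0 4 by rewrite mem_iota.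
move=> + /in4 a4 /in4 b4 /in4 c4 /in4 d4.
by move=> /allP/(_ _ a4)/allP/(_ _ b4)/allP/(_ _ c4)/allP/(_ _ d4)/eqP.
Qed.

Lemma door3_doors a b c : (a <= 2)%N -> (b <= 2)%N -> (c <= 2)%N ->
  door3 a b c = door2 b c (+) door2 a c (+) door2 a b.
Proof.
have : all (fun a => all (fun b => all (fun c =>
    door3 a b c == door2 b c (+) door2 a c (+) door2 a b)
  (iota 0 3)) (iota 0 3)) (iota 0 3) by vm_compute.
have in3 q : (q <= 2)%N -> q \in iota 0 3 by rewrite mem_iota.
move=> + /in3 a3 /in3 b3 /in3 c3.
by move=> /allP/(_ _ a3)/allP/(_ _ b3)/allP/(_ _ c3)/eqP.
Qed.

(** A cube is cut into six simplices, one for each monotone path of edges from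
    its lowest to its highest vertex; this is the parity of the number of those
    which carry all four labels. *)
Definition grid_cube i j k : bool :=
  let L a b c := l (a + i) (b + j) (c + k) in
  full (L 0 0 0) (L 1 0 0) (L 1 1 0) (L 1 1 1) (+)
  full (L 0 0 0) (L 1 0 0) (L 1 0 1) (L 1 1 1) (+)
  full (L 0 0 0) (L 0 1 0) (L 1 1 0) (L 1 1 1) (+)
  full (L 0 0 0) (L 0 1 0) (L 0 1 1) (L 1 1 1) (+)
  full (L 0 0 0) (L 0 0 1) (L 1 0 1) (L 1 1 1) (+)
  full (L 0 0 0) (L 0 0 1) (L 0 1 1) (L 1 1 1).

(** A square is cut along the diagonal of its monotone paths, so that the faces
    of the simplices of a cube are the triangles of its six squares. *)
Definition grid_square (q : nat -> nat -> nat) i j : bool :=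
  door3 (q i j) (q i.+1 j) (q i.+1 j.+1) (+) door3 (q i j) (q i j.+1) (q i.+1 j.+1).

Definition xor_sum (f : nat -> bool) : bool := \big[addb/false]_(i < m) f i.

Lemma xor_sumD f g : xor_sum (fun i => f i (+) g i) = xor_sum f (+) xor_sum g.
Proof. exact: big_split. Qed.

Lemma eq_xor_sum f g : (forall i, (i < m)%N -> f i = g i) -> xor_sum f = xor_sum g.
Proof. by move=> fg; apply: eq_bigr => i _; exact: fg. Qed.

Lemma xor_sum0 f : (forall i, (i < m)%N -> f i = false) -> xor_sum f = false.
Proof. by move=> f0; apply: big1 => i _; exact: f0. Qed.

Lemma xor_sum_exchange (f : nat -> nat -> bool) :
  xor_sum (fun i => xor_sum (f i)) = xor_sum (fun j => xor_sum (f^~ j)).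
Proof. exact: exchange_big. Qed.

Lemma xor_sum_telescope f : xor_sum (fun i => f i (+) f i.+1) = f 0%N (+) f m.
Proof.
rewrite /xor_sum; elim: m => [|n IH]; first by rewrite big_ord0 addbb.
by rewrite big_ord_recr /= IH -addbA; congr (_ (+) _); rewrite addbA addbb.
Qed.

Hypothesis l3 : forall i j k,
  (i <= m)%N -> (j <= m)%N -> (k <= m)%N -> (l i j k <= 3)%N.
Hypothesis lo0 : forall j k, (j <= m)%N -> (k <= m)%N -> l 0 j k = 0%N.
Hypothesis lo1 : forall i k, (i <= m)%N -> (k <= m)%N -> (l i 0 k <= 1)%N.
Hypothesis lo2 : forall i j, (i <= m)%N -> (j <= m)%N -> (l i j 0 <= 2)%N.
Hypothesis hi0 : forall j k, (j <= m)%N -> (k <= m)%N -> l m j k != 0%N.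
Hypothesis hi1 : forall i k, (i <= m)%N -> (k <= m)%N -> l i m k != 1%N.
Hypothesis hi2 : forall i j, (i <= m)%N -> (j <= m)%N -> l i j m != 2%N.

(** The triangles inside a cube belong to two simplices and cancel. *)
Lemma cube_faces i j k : (i < m)%N -> (j < m)%N -> (k < m)%N ->
  grid_cube i j k =
  (grid_square (fun a b => l i a b) j k (+) grid_square (fun a b => l i.+1 a b) j k) (+)
  ((grid_square (fun a b => l a j b) i k (+) grid_square (fun a b => l a j.+1 b) i k) (+)
  (grid_square (fun a b => l a b k) i j (+) grid_square (fun a b => l a b k.+1) i j)).
Proof.
move=> im jm km; rewrite /grid_cube /grid_square !add0n !add1n.
rewrite !full_doors; try by apply: l3; try exact: ltnW.
by rewrite !addbE; Btauto.btauto.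
Qed.

Lemma door3_without q a b c : (q <= 2)%N -> a != q -> b != q -> c != q ->
  door3 a b c = false.
Proof.
move=> q2 aq bq cq; apply/negP => /perm_mem/(_ q).
by rewrite mem_iota !inE leq0n ltnS q2 -[_ == a]eq_sym (negbTE aq)
  -[_ == b]eq_sym (negbTE bq) -[_ == c]eq_sym (negbTE cq).
Qed.

Lemma square_without q (f : nat -> nat -> nat) i j :
  (q <= 2)%N -> (forall a b, (a <= m)%N -> (b <= m)%N -> f a b != q) ->
  (i < m)%N -> (j < m)%N -> grid_square f i j = false.
Proof.
move=> q2 fq im jm; rewrite /grid_square.
by rewrite !(@door3_without q) //; apply: fq => //; exact: ltnW.
Qed.

(** The same count one dimension lower: the doors of the bottom square lie on
    one edge, where the labels go from 0 to 1, hence change an odd number of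
    times. *)
Lemma bottom_odd : xor_sum (fun i => xor_sum (grid_square (fun a b => l a b 0%N) i)) = true.
Proof.
pose q a b := l a b 0%N.
have -> : xor_sum (fun i => xor_sum (grid_square q i)) = xor_sum (fun i => xor_sum (fun j =>
    (door2 (q i j) (q i j.+1) (+) door2 (q i.+1 j) (q i.+1 j.+1)) (+)
    (door2 (q i j) (q i.+1 j) (+) door2 (q i j.+1) (q i.+1 j.+1)))).
  apply: eq_xor_sum => i im; apply: eq_xor_sum => j jm; rewrite /grid_square.
  rewrite !door3_doors; try by apply: lo2; try exact: ltnW.
  by rewrite !addbE; Btauto.btauto.
under [X in xor_sum X]eq_fun do rewrite xor_sumD.
rewrite xor_sumD xor_sum_exchange.
under [X in xor_sum X (+) _]eq_fun => j do
  rewrite (xor_sum_telescope (fun i => door2 (q i j) (q i j.+1))).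
under [X in _ (+) xor_sum X]eq_fun => i do
  rewrite (xor_sum_telescope (fun j => door2 (q i j) (q i.+1 j))).
rewrite xor_sum0 /= => [|j jm]; last first.
  have -> : door2 (q 0%N j) (q 0%N j.+1) = false by rewrite /q !lo0 // ltnW.
  by rewrite /door2 (negbTE (hi0 _ _)) ?(negbTE (hi0 _ _)) //= ?andbF // ltnW.
rewrite -[RHS](_ : (q 0%N 0%N == 0%N) (+) (q m 0%N == 0%N) = true); last first.
  by rewrite /q lo0 // (negbTE (hi0 _ _)).
rewrite -(xor_sum_telescope (fun i => q i 0%N == 0%N)).
apply: eq_xor_sum => i im; have im' := ltnW im.
rewrite [X in _ (+) X](_ : _ = false) ?addbF; last first.
  by rewrite /door2 ![_ == 1%N](negbTE (hi1 _ _)) // !andbF.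
have := lo1 im' (leq0n m); have := lo1 im (leq0n m); rewrite /q /door2.
by case: (l i 0 0) => [|[|?]] //; case: (l i.+1 0 0) => [|[|?]].
Qed.

(** Modulo 2, each cube counts as its boundary triangles labelled 0, 1, 2; these
    cancel inside the grid, and the same count in the only face that carries
    some of them, and then on an edge of that face, ends with an odd number. *)
Lemma sperner_cube : exists i j k, [/\ (i < m)%N, (j < m)%N, (k < m)%N &
  forall q, (q <= 3)%N -> exists a b c : bool, l (a + i) (b + j) (c + k) = q].
Proof.
have : xor_sum (fun i => xor_sum (fun j => xor_sum (grid_cube i j))) = true.
  rewrite -bottom_odd.
  have -> : xor_sum (fun i => xor_sum (fun j => xor_sum (grid_cube i j))) =
    xor_sum (fun i => xor_sum (fun j => xor_sum (fun k =>
  (grid_square (fun a b => l i a b) j k (+) grid_square (fun a b => l i.+1 a b) j k) (+)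
  ((grid_square (fun a b => l a j b) i k (+) grid_square (fun a b => l a j.+1 b) i k) (+)
  (grid_square (fun a b => l a b k) i j (+) grid_square (fun a b => l a b k.+1) i j))))).
    apply: eq_xor_sum => i im; apply: eq_xor_sum => j jm; apply: eq_xor_sum => k km.
    exact: cube_faces.
  pose X i j k := grid_square (fun a b => l i a b) j k.
  pose Y i j k := grid_square (fun a b => l a j b) i k.
  pose Z i j k := grid_square (fun a b => l a b k) i j.
  rewrite -[LHS]/(xor_sum (fun i => xor_sum (fun j => xor_sum (fun k =>
    (X i j k (+) X i.+1 j k) (+) ((Y i j k (+) Y i j.+1 k) (+) (Z i j k (+) Z i j k.+1)))))).
  have -> : xor_sum (fun i => xor_sum (fun j => xor_sum (fun k =>
    (X i j k (+) X i.+1 j k) (+) ((Y i j k (+) Y i j.+1 k) (+) (Z i j k (+) Z i j k.+1))))) =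
    xor_sum (fun i => xor_sum (fun j => xor_sum (fun k => X i j k (+) X i.+1 j k))) (+)
    (xor_sum (fun i => xor_sum (fun j => xor_sum (fun k => Y i j k (+) Y i j.+1 k))) (+)
    xor_sum (fun i => xor_sum (fun j => xor_sum (fun k => Z i j k (+) Z i j k.+1)))).
    rewrite -!xor_sumD; apply: eq_xor_sum => i _.
    rewrite -!xor_sumD; apply: eq_xor_sum => j _.
    by rewrite -!xor_sumD.
  have -> : xor_sum (fun i => xor_sum (fun j => xor_sum (fun k => X i j k (+) X i.+1 j k))) = false.
    rewrite xor_sum_exchange; apply: xor_sum0 => j jm.
    rewrite xor_sum_exchange; apply: xor_sum0 => k km.
    rewrite (xor_sum_telescope (fun i => X i j k)) /X.
    rewrite (@square_without 1) //; last by move=> a b am bm; rewrite lo0.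
    by rewrite (@square_without 0) //; move=> a b am bm; rewrite hi0.
  have -> : xor_sum (fun i => xor_sum (fun j => xor_sum (fun k => Y i j k (+) Y i j.+1 k))) = false.
    apply: xor_sum0 => i im; rewrite xor_sum_exchange; apply: xor_sum0 => k km.
    rewrite (xor_sum_telescope (fun j => Y i j k)) /Y.
    rewrite (@square_without 2) //; last first.
      by move=> a b am bm; have := lo1 am bm; case: (l a 0 b) => [|[|]].
    by rewrite (@square_without 1) //; move=> a b am bm; rewrite hi1.
  apply: eq_xor_sum => i im; apply: eq_xor_sum => j jm.
  rewrite (xor_sum_telescope (fun k => Z i j k)) /Z [X in _ (+) X](@square_without 2) ?addbF //.
have ex f : xor_sum f = true -> exists2 i, (i < m)%N & f i.
  move=> fT; apply: contrapT => nf; suff : xor_sum f = false by rewrite fT.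
  by apply: xor_sum0 => i im; apply/negP => fi; apply: nf; exists i.
move=> /ex[i im /ex[j jm /ex[k km C]]]; exists i, j, k; split=> // q q3.
have fl a b c d : full a b c d -> q \in [:: a; b; c; d].
  by move=> /perm_mem ->; rewrite mem_iota.
apply: contrapT => nq.
have nL (a b c : bool) : q == l (a + i) (b + j) (c + k) = false.
  by apply/negP => /eqP qE; apply: nq; exists a, b, c.
have L0 := nL false; have L1 := nL true; rewrite /= in L0 L1.
have F a b c d : (q == a) = false -> (q == b) = false -> (q == c) = false ->
  (q == d) = false -> full a b c d = false.
  move=> qa qb qc qd; apply/negP => /fl.
  by rewrite !inE qa qb qc qd.
move: C; rewrite /grid_cube /= !F //; by
  [exact: (nL false false false)|exact: (nL true true true)|
   exact: (nL true false false)|exact: (nL false true false)|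
   exact: (nL false false true)|exact: (nL true true false)|
   exact: (nL true false true)|exact: (nL false true true)].
Qed.

End Sperner.

(** * A zero theorem on the cube *)

Section Zero.
Variable R : realType.
Implicit Types x y z : R * R * R.

Definition cube3 : set (R * R * R) :=
  [set x | [/\ -1 <= x.1.1 <= 1, -1 <= x.1.2 <= 1 & -1 <= x.2 <= 1]].

Lemma cube3_compact : compact cube3.
Proof.
have -> : cube3 = ((`[-1, 1] : set R) `*` (`[-1, 1] : set R)) `*` (`[-1, 1] : set R).
  apply/seteqP; split=> x /=; rewrite /cube3 /= !in_itv /=; first by case.
  by case=> [[]].
by do 2?apply: compact_setX; exact: segment_compact.
Qed.

(** A nowhere vanishing map would have, at a small enough scale, a component of
    constant sign on every grid cube; labelling a vertex by the first negative
    component, this contradicts the existence of a cube carrying all labels. *)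
Lemma cube_zero (h : R * R * R -> R * R * R) :
  cts cube3 h ->
  (forall x, cube3 x -> (x.1.1 = -1 -> (h x).1.1 < 0) /\ (x.1.1 = 1 -> 0 < (h x).1.1)) ->
  (forall x, cube3 x -> (x.1.2 = -1 -> (h x).1.2 < 0) /\ (x.1.2 = 1 -> 0 < (h x).1.2)) ->
  (forall x, cube3 x -> (x.2 = -1 -> (h x).2 < 0) /\ (x.2 = 1 -> 0 < (h x).2)) ->
  exists2 x, cube3 x & h x = (0, 0, 0).
Proof.
move=> ch h0 h1 h2; apply: contrapT => noz.
pose co (i : 'I_3) (x : R * R * R) : R :=
  if val i == 0%N then x.1.1 else if val i == 1%N then x.1.2 else x.2.
have cco i : cts cube3 (fun x => co i (h x)).
  by rewrite /co; case: eqP => _; [|case: eqP => _];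
    [do 2!apply: cts_fst|apply/cts_snd/cts_fst|apply: cts_snd].
pose near_pt n x y := [/\ `|y.1.1 - x.1.1| < n.+1%:R^-1,
  `|y.1.2 - x.1.2| < n.+1%:R^-1 & `|y.2 - x.2| < n.+1%:R^-1].
pose P (n : nat) x := exists i, (forall y, cube3 y -> near_pt n x y -> 0 < co i (h y))
   \/ (forall y, cube3 y -> near_pt n x y -> co i (h y) < 0).
(* Some component has a constant sign near each point; by compactness, the size
   of the neighbourhood does not depend on the point. *)
have : \forall n \near \oo, cube3 `<=` P n.
  apply: (iffLR (compact_near_coveringP _) cube3_compact) => x Cx.
  have [i ni] : exists i, co i (h x) != 0.
    apply: contrapT => ni; apply: noz; exists x => //.
    have z i : co i (h x) = 0.
      by apply/eqP/negPn/negP => nz; apply: ni; exists i.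
    have := z ord0; have := z (Ordinal (isT : 1 < 3)%N).
    have := z (Ordinal (isT : 2 < 3)%N); rewrite /co /=.
    by case: (h x) => [[? ?] ?] /= -> -> ->.
  have [r r0 hr] : exists2 r : R, 0 < r & (forall y, cube3 y -> ball x r y -> 0 < co i (h y))
      \/ (forall y, cube3 y -> ball x r y -> co i (h y) < 0).
    have [neg|pos|z] := ltgtP (co i (h x)) 0; last by rewrite z eqxx in ni.
      have := cco i x Cx _ (open_nbhs_nbhs (conj (@open_lt R 0) neg)).
      rewrite /= => /nbhs_ballP[r r0 hr]; exists r => //; right=> y Cy yr.
      exact: hr.
    have := cco i x Cx _ (open_nbhs_nbhs (conj (@open_gt R 0) pos)).
    rewrite /= => /nbhs_ballP[r r0 hr]; exists r => //; left=> y Cy yr.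
    exact: hr.
  exists (ball x (r / 2), [set n : nat | n.+1%:R^-1 < r / 2]).
    split=> /=; first by apply: nbhsx_ballx; rewrite divr_gt0.
    have r2 : 0 < r / 2 by rewrite divr_gt0.
    exists (Num.truncn (r / 2)^-1).+1 => // n /= hn.
    rewrite invf_plt ?posrE ?ltr0n //.
    by rewrite (lt_le_trans (truncnS_gt _)) // ler_nat ltnW.
  move=> [x' n] /= [xx' nr]; exists i.
  have tri (a b c : R) : `|a - b| < r / 2 -> `|c - b| < n.+1%:R^-1 -> `|a - c| < r.
    move=> ab bc; rewrite (le_lt_trans (ler_distD b _ _)) // [r]splitr ltrD //.
    by rewrite distrC (lt_trans bc).
  have sub y : near_pt n x' y -> ball x r y.
    case: xx' => [[b1 b2] b3] [n1 n2 n3].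
    by split; [split|]; [apply: tri b1 n1|apply: tri b2 n2|apply: tri b3 n3].
  by case: hr => hr; [left|right] => y Cy /sub; exact: hr.
case=> n _ /(_ n (leqnn n)) hP.
(* A grid of mesh [1 / (n + 2)] on [-1, 1], finer than this size. *)
pose m := (2 * n.+2)%N; pose g (i : nat) : R := i%:R / n.+2%:R - 1.
have n20 : 0 < n.+2%:R :> R by rewrite ltr0n.
have g0 : g 0%N = -1 by rewrite /g mul0r add0r.
have gm : g m = 1 by rewrite /g /m natrM mulfK ?gt_eqF //; lra.
have g01 i : (i <= m)%N -> -1 <= g i <= 1.
  move=> im; have : g i <= g m by rewrite /g lerD2r ler_pM2r ?invr_gt0 // ler_nat.
  by rewrite gm => ->; rewrite andbT /g lerDr divr_ge0.
have gS i (a : bool) : `|g (a + i)%N - g i| < n.+1%:R^-1.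
  have -> : g (a + i)%N - g i = a%:R / n.+2%:R by rewrite /g natrD; ring.
  rewrite ger0_norm ?divr_ge0 //; apply: (@le_lt_trans _ _ n.+2%:R^-1).
    by rewrite ler_piMl ?invr_ge0 ?ler0n //; case: (a).
  by rewrite ltf_pV2 ?posrE ?ltr0n // ltr_nat.
pose pt i j k := (g i, g j, g k).
have Cpt i j k : (i <= m)%N -> (j <= m)%N -> (k <= m)%N -> cube3 (pt i j k).
  by move=> im jm km; split; exact: g01.
pose lab x : nat := if (h x).1.1 < 0 then 0%N else if (h x).1.2 < 0 then 1%N
  else if (h x).2 < 0 then 2%N else 3%N.
have [] := @sperner_cube m (fun i j k => lab (pt i j k)).
- by move=> i j k _ _ _; rewrite /lab; do 3!case: ifP => //.
- move=> j k jm km; rewrite /lab (h0 (pt 0%N j k) (Cpt _ _ _ _ _ _)).1 //.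
- move=> i k im km; rewrite /lab (h1 (pt i 0%N k) (Cpt _ _ _ _ _ _)).1 //.
  by case: ifP.
- move=> i j im jm; rewrite /lab (h2 (pt i j 0%N) (Cpt _ _ _ _ _ _)).1 //.
  by do 2!case: ifP => //.
- move=> j k jm km; rewrite /lab.
  rewrite ltNge (ltW ((h0 (pt m j k) (Cpt _ _ _ _ _ _)).2 _)) //=.
  by do 2!case: ifP => //.
- move=> i k im km; rewrite /lab.
  rewrite [(h (pt i m k)).1.2 < 0]ltNge (ltW ((h1 (pt i m k) (Cpt _ _ _ _ _ _)).2 _)) //=.
  by do 2!case: ifP => //.
- move=> i j im jm; rewrite /lab.
  rewrite [(h (pt i j m)).2 < 0]ltNge (ltW ((h2 (pt i j m) (Cpt _ _ _ _ _ _)).2 _)) //=.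
  by do 2!case: ifP => //.
move=> i [j [k [im jm km labs]]].
have [q hq] := hP (pt i j k) (Cpt _ _ _ (ltnW im) (ltnW jm) (ltnW km)).
have Cc (a b c : bool) : cube3 (pt (a + i)%N (b + j)%N (c + k)%N).
  by apply: Cpt; [case: (a)|case: (b)|case: (c)] => //; exact: ltnW.
have Nc (a b c : bool) : near_pt n (pt i j k) (pt (a + i)%N (b + j)%N (c + k)%N).
  by split; exact: gS.
case: hq => hq.
  have q3 : (q <= 3)%N by rewrite ltnW // ltn_ord.
  have [a [b [c]]] := labs q q3; have := hq _ (Cc a b c) (Nc a b c).
  rewrite /lab /co; case: (q) => [[|[|[|//]]] ?] /=.
  - by move=> /ltW; rewrite leNgt => /negbTE ->; do 2!case: ifP => //.
  - by move=> /ltW; rewrite leNgt => /negbTE ->; do 2!case: ifP => //.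
  - by move=> /ltW; rewrite leNgt => /negbTE ->; do 2!case: ifP => //.
have [a [b [c]]] := labs 3%N (leqnn 3); have := hq _ (Cc a b c) (Nc a b c).
rewrite /lab /co; case: (q) => [[|[|[|//]]] ?] /= -> //; by do ?case: ifP.
Qed.

End Zero.
Arguments cube3 {R}.

(** * Invariance of the boundary of the solid torus *)

Section Normalisation.
Variable R : realType.
Implicit Types v w : R * R * R.

Definition sqn w : R := w.1.1 ^+ 2 + w.1.2 ^+ 2 + w.2 ^+ 2.
Definition unit3 w : R * R * R :=
  (w.1.1 / Num.sqrt (sqn w), w.1.2 / Num.sqrt (sqn w), w.2 / Num.sqrt (sqn w)).

Lemma sqn_ge0 w : 0 <= sqn w.
Proof. by rewrite /sqn !addr_ge0 // sqr_ge0. Qed.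

Lemma sqn_eq0 w : sqn w = 0 -> w = (0, 0, 0).
Proof.
have p (a : R) := sqr_ge0 a; case: w => [[a b] c]; rewrite /sqn /= => e.
have := p a; have := p b; have := p c => c0 b0 a0.
have /eqP : a ^+ 2 = 0 by lra.
have /eqP : b ^+ 2 = 0 by lra.
have /eqP : c ^+ 2 = 0 by lra.
by rewrite !sqrf_eq0 => /eqP -> /eqP -> /eqP ->.
Qed.

Lemma sqn_gt0 w : w != (0, 0, 0) -> 0 < sqn w.
Proof.
by move=> w0; rewrite lt_def sqn_ge0 andbT; apply: contra w0 => /eqP/sqn_eq0/eqP.
Qed.

Lemma unit3_sphere w : 0 < sqn w -> sphere (unit3 w).
Proof.
move=> w0; rewrite /sphere /unit3 /= !exprMn exprVn sqr_sqrtr ?sqn_ge0 //.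
by rewrite -!mulrDl divff // gt_eqF.
Qed.

Lemma unit3_scale k w : 0 < k -> unit3 (k * w.1.1, k * w.1.2, k * w.2) = unit3 w.
Proof.
move=> k0; rewrite /unit3 /=.
have -> : sqn (k * w.1.1, k * w.1.2, k * w.2) = k ^+ 2 * sqn w.
  by rewrite /sqn /=; ring.
rewrite sqrtrM ?sqr_ge0 // sqrtr_sqr ger0_norm ?ltW //.
by rewrite -!mulf_div divff ?gt_eqF // !mul1r.
Qed.

Lemma unit3_id w : sphere w -> unit3 w = w.
Proof.
by move=> Sw; rewrite /unit3 [sqn w]Sw sqrtr1 !divr1; case: (w) => [[]].
Qed.

Lemma sphere_third v : sphere v ->
  1 - v.1.1 ^+ 2 - v.1.2 ^+ 2 = v.2 ^+ 2.
Proof. by rewrite /sphere /= => Sv; apply/eqP; rewrite !subr_eq -Sv; apply/eqP; ring. Qed.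

Lemma cts_unit3 (T : topologicalType) (A : set T) (f : T -> R * R * R) :
  cts A f -> (forall x, A x -> 0 < sqn (f x)) -> cts A (fun x => unit3 (f x)).
Proof.
move=> cf pos; rewrite /unit3 /sqn.
by cts_tac => // x Ax; rewrite gt_eqF // sqrtr_gt0 [X in _ < X]/(sqn (f x)) pos.
Qed.

End Normalisation.

Section Boundary.
Variable R : realType.
Implicit Types (x y z : Mpt R).

(** Moves the boundary of the solid torus into its interior for t > 0. *)
Definition push (t : R) z : Mpt R := (z.1, unit3 (z.2.1.1, z.2.1.2, z.2.2 + t)).

Lemma push_sqn t z : north z -> 0 <= t ->
  0 < sqn (z.2.1.1, z.2.1.2, z.2.2 + t).
Proof.
move=> [[_ Sz] z0] t0; rewrite /sqn /=.
have -> : z.2.1.1 ^+ 2 + z.2.1.2 ^+ 2 + (z.2.2 + t) ^+ 2 =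
  1 + (2 * z.2.2 * t + t ^+ 2).
  by rewrite -[X in X + (2 * _ * _ + _)]Sz; ring.
by rewrite ltr_pwDl // addr_ge0 ?mulr_ge0 // sqr_ge0.
Qed.

Lemma push_north t z : north z -> 0 <= t -> north (push t z).
Proof.
move=> Nz t0; have pos := push_sqn Nz t0; have [[Cz _] z0] := Nz.
split; first by split=> //; exact: unit3_sphere.
by rewrite /= divr_ge0 ?sqrtr_ge0 // addr_ge0.
Qed.

Lemma push_gt0 t z : north z -> 0 < t -> 0 < (push t z).2.2.
Proof.
move=> Nz t0; rewrite /= divr_gt0 //.
  by case: Nz => _ z0; rewrite ltr_wpDl.
by rewrite sqrtr_gt0 push_sqn // ltW.
Qed.

Lemma push0 z : north z -> push 0 z = z.
Proof.
by move=> [[_ Sz] _]; rewrite /push addr0 unit3_id; case: (z) Sz => ? [[]].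
Qed.

(** If a boundary point [x] went to an interior point [y], a small cube around
    [y] would go back to a neighbourhood of [x]; pushing it off the boundary
    except on the boundary of the cube, where nothing moves, and returning to
    the cube, one would get a map that misses the centre and is the identity on
    the boundary of the cube. *)
Lemma boundary_invariance (f g : Mpt R -> Mpt R) (x : Mpt R) :
  cts (@north R) f -> cts (@north R) g ->
  (forall x, north x -> north (f x) /\ g (f x) = x) ->
  (forall y, north y -> north (g y) /\ f (g y) = y) ->
  north x -> x.2.2 = 0 -> (f x).2.2 = 0.
Proof.
move=> cf cg fP gP Nx x0; set y := f x.
have [Ny gy] := fP x Nx; rewrite -/y in Ny gy.
apply: contrapT => /eqP y0.
have {}y0 : 0 < y.2.2 by rewrite lt_def y0; case: Ny.
have [[Cy Sy] _] := Ny; have [a0 ea0] := circle_pt_surj Cy.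
pose rad (p : R * R * R) : R := 1 - (y.2.1.1 + p.1.2) ^+ 2 - (y.2.1.2 + p.2) ^+ 2.
(* [ki] is a chart at [y], with inverse [ka]; [q] below pushes the points of a
   small cube by an amount which vanishes exactly on its boundary. *)
pose ki (p : R * R * R) : Mpt R :=
  (circle_pt (a0 + p.1.1), (y.2.1.1 + p.1.2, y.2.1.2 + p.2, Num.sqrt (rad p))).
pose ka (z : Mpt R) : R * R * R := (angle y.1 z.1, z.2.1.1 - y.2.1.1, z.2.1.2 - y.2.1.2).
have ki_north p : 0 <= rad p -> north (ki p).
  move=> p0; split; last exact: sqrtr_ge0.
  split; first exact: circle_pt_circle.
  by rewrite /sphere /= sqr_sqrtr // /rad; ring.
have y3 : y.2.2 = Num.sqrt (1 - y.2.1.1 ^+ 2 - y.2.1.2 ^+ 2).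
  rewrite sphere_third //.
  by rewrite sqrtr_sqr gtr0_norm.
have ki0 : ki (0, 0, 0) = y.
  rewrite /ki /rad /= !addr0 ea0 -y3.
  by rewrite /y; case: (f x) => ? [[]].
have rad0 : 0 < rad (0, 0, 0).
  by rewrite /rad /= !addr0 -sqrtr_gt0 -y3.
pose A : set (R * R * R * R) := [set q | 0 <= rad q.1 /\ 0 <= q.2].
pose Phi (q : R * R * R * R) : Mpt R := f (push q.2 (g (ki q.1))).
have cki : cts A (fun q => ki q.1).
  rewrite /ki /rad; cts_tac.
  apply: (@cts_comp_cont _ _ _ _ (@circle_pt R)); first exact: circle_pt_continuous.
  by cts_tac.
have gki_north q : A q -> north (g (ki q.1)).
  by case=> q1 _; apply: (gP _ _).1; exact: ki_north.
have cgki : cts A (fun q => g (ki q.1)).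
  by apply: (cts_comp cg) => // q [q1 _]; exact: ki_north.
have cPhi : cts A Phi.
  apply: (cts_comp cf); last by move=> q Aq; apply: push_north (gki_north q Aq) _; case: Aq.
  rewrite /push; apply: cts_pair; first exact: cts_fst.
  apply: cts_unit3.
    by do 2?apply: cts_pair; cts_tac.
  by move=> q Aq; apply: push_sqn (gki_north q Aq) _; case: Aq.
have A0 : A ((0, 0, 0), 0) by split=> //=; exact: ltW.
have Phi0 : Phi ((0, 0, 0), 0) = y by rewrite /Phi /= ki0 gy push0.
have cdot : cts A (fun q => dot y.1 (Phi q).1).
  by apply: cts_dot; [exact: cts_cst|exact: cts_fst].
have dot0 : 0 < dot y.1 (Phi ((0, 0, 0), 0)).1 by rewrite Phi0 dot_circle.
have near1 : \forall q \near (((0, 0, 0), 0) : R * R * R * R), A q -> 0 < dot y.1 (Phi q).1.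
  exact: cdot _ A0 _ (open_nbhs_nbhs (conj (@open_gt R 0) dot0)).
have crad : cts setT (fun q : R * R * R * R => rad q.1) by rewrite /rad; cts_tac.
have near2 : \forall q \near (((0, 0, 0), 0) : R * R * R * R), setT q -> 0 < rad q.1.
  have W : nbhs (rad ((0, 0, 0, 0) : R * R * R * R).1) [set u | 0 < u].
    by apply: open_nbhs_nbhs; split; [exact: open_gt|exact: rad0].
  exact: crad W.
have /nbhs_ballP[r1 /= r10 hr1] := near1.
have /nbhs_ballP[r2 /= r20 hr2] := near2.
pose eps : R := Num.min (Num.min r1 r2) 4^-1 / 2.
have eps0 : 0 < eps by rewrite divr_gt0 // !lt_min r10 r20 /=; lra.
have [e1 e2 e4] : [/\ eps < r1, eps < r2 & eps < 4^-1].
  have : 2 * eps = Num.min (Num.min r1 r2) 4^-1 by rewrite /eps mulrC divfK.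
  have : Num.min (Num.min r1 r2) 4^-1 <= r1 by rewrite !ge_min lexx.
  have : Num.min (Num.min r1 r2) 4^-1 <= r2 by rewrite !ge_min lexx orbT.
  have : Num.min (Num.min r1 r2) 4^-1 <= 4^-1 by rewrite !ge_min lexx orbT.
  by move=> h1 h2 h3 h4; split; lra.
clearbody eps.
pose nv (v : R * R * R) : R := Num.max (Num.max `|v.1.1| `|v.1.2|) `|v.2|.
pose q (v : R * R * R) : R * R * R * R :=
  ((eps * v.1.1, eps * v.1.2, eps * v.2), eps * (1 - nv v)).
have ab (a : R) : -1 <= a <= 1 -> `|eps * a| <= eps.
  by move=> a1; rewrite normrM (gtr0_norm eps0) ler_piMr ?ler_norml // ltW.
have nv1 v : cube3 v -> nv v <= 1 by case=> v1 v2 v3; rewrite !ge_max !ler_norml v1 v2 v3.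
have nvg v : 0 <= nv v by rewrite !le_max normr_ge0.
have qt v : cube3 v -> 0 <= eps * (1 - nv v) <= eps.
  move=> Cv; have := nv1 v Cv; have := nvg v => ? ?.
  by apply/andP; split; nra.
have qball r v : eps < r -> cube3 v -> ball ((0, 0, 0), 0) r (q v).
  move=> er Cv; have [v1 v2 v3] := Cv.
  do 3?split; rewrite /ball /= sub0r normrN.
  - exact: le_lt_trans (ab _ v1) er.
  - exact: le_lt_trans (ab _ v2) er.
  - exact: le_lt_trans (ab _ v3) er.
  - have /andP[q0 q1] := qt v Cv; rewrite ger0_norm //; exact: le_lt_trans er.
have Aq v : cube3 v -> A (q v).
  move=> Cv; split; last by case/andP: (qt v Cv).
  by apply: ltW; apply: (hr2 (q v)) => //; exact: qball.
have dotq v : cube3 v -> 0 < dot y.1 (Phi (q v)).1.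
  by move=> Cv; apply: hr1; [exact: qball|exact: Aq].
have Phi_north v : cube3 v -> north (Phi (q v)).
  move=> Cv; apply: (fP _ _).1; apply: push_north (gki_north _ (Aq v Cv)) _.
  by case: (Aq v Cv).
pose H v := ka (Phi (q v)).
have cq : cts cube3 q by rewrite /q /nv; cts_tac.
have cPq : cts cube3 (fun v => Phi (q v)) by apply: (cts_comp cPhi) => // v; exact: Aq.
have cH : cts cube3 H.
  rewrite /H /ka; apply: cts_pair; last first.
    apply: cts_add; last exact: cts_cst.
    by apply: cts_snd; apply: cts_fst; exact: cts_snd.
  apply: cts_pair; last first.
    apply: cts_add; last exact: cts_cst.
    by do 2!apply: cts_fst; exact: cts_snd.
  by apply: cts_angle => //; [exact: cts_cst|exact: cts_fst].
have edge v : cube3 v -> nv v = 1 -> H v = (eps * v.1.1, eps * v.1.2, eps * v.2).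
  move=> Cv n1; have qA := Aq v Cv.
  have rq : 0 <= rad (q v).1 by case: qA.
  rewrite /H /Phi {1}/q /= n1 subrr mulr0 push0; last exact: gki_north qA.
  have -> : f (g (ki (q v).1)) = ki (q v).1 by apply: (gP _ _).2; exact: ki_north.
  rewrite /ka /ki /= -ea0 angleE; last first.
    by case: Cv => v1 _ _; exact: le_lt_trans (ab _ v1) e4.
  by congr (_, _, _); ring.
have norm1 (a : R) : a = 1 \/ a = -1 -> `|a| = 1 by case=> ->; rewrite ?normrN normr1.
have [v Cv Hv] : exists2 v, cube3 v & H v = (0, 0, 0).
  have sgn (a : R) : (a = -1 -> eps * a < 0) /\ (a = 1 -> 0 < eps * a).
    by split=> ->; rewrite ?mulrN1 ?oppr_lt0 ?mulr1.
  have case1 v : cube3 v -> (`|v.1.1| = 1 \/ `|v.1.2| = 1 \/ `|v.2| = 1) ->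
      H v = (eps * v.1.1, eps * v.1.2, eps * v.2).
    move=> Cv n1; apply: edge => //; apply/eqP; rewrite eq_le nv1 //=.
    by rewrite !le_max; case: n1 => [->|[->|->]]; rewrite lexx ?orbT.
  apply: cube_zero => // v Cv; split=> ev; rewrite case1 //=;
    try (by apply sgn); try (by left; apply: norm1; auto);
    try (by right; left; apply: norm1; auto); by right; right; apply: norm1; auto.
(* At a zero, the pushed point goes back to [y], so it is [x], which lies on the
   boundary: nothing was pushed, and [v] is on the boundary of the cube. *)
have Py : Phi (q v) = y.
  have NP := Phi_north v Cv; have [[CP SP] P0] := NP.
  move: Hv; rewrite /H /ka => -[ha hb hc].
  have dq : 0 < dot (circle_pt a0) (Phi (q v)).1 by rewrite ea0; exact: dotq.
  have [_] := angleP CP dq; rewrite ea0 ha addr0 ea0 => yP.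
  have h1 : (Phi (q v)).2.1.1 = y.2.1.1 by lra.
  have h2 : (Phi (q v)).2.1.2 = y.2.1.2 by lra.
  have h3 : (Phi (q v)).2.2 = y.2.2.
    apply/eqP; rewrite -(@eqrXn2 _ 2) //; last exact: ltW.
    by rewrite -!sphere_third // h1 h2.
  case: (Phi (q v)) yP h1 h2 h3 => P1 [[P2 P3] P4] /= <- -> -> ->.
  by case: (y) => ? [[]].
have Np : north (push (q v).2 (g (ki (q v).1))).
  by apply: push_north (gki_north _ (Aq v Cv)) _; case: (Aq v Cv).
have xE : push (q v).2 (g (ki (q v).1)) = x.
  by rewrite -[LHS](fP _ Np).2 -gy; congr g; exact: Py.
have [q2|q2] := ltP 0 (q v).2.
  by have := push_gt0 (gki_north _ (Aq v Cv)) q2; rewrite xE x0 ltxx.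
have {}q2 : (q v).2 = 0.
  by apply/eqP; rewrite eq_le q2 /=; case: (Aq v Cv).
have n1 : nv v = 1.
  by move/eqP: q2; rewrite /= mulf_eq0 gt_eqF //= subr_eq0 => /eqP.
have := edge v Cv n1; rewrite Hv => -[/esym/eqP + /esym/eqP + /esym/eqP].
rewrite !mulf_eq0 !(gt_eqF eps0) /= => /eqP v1 /eqP v2 /eqP v3.
move: n1; rewrite /nv v1 v2 v3 normr0 !maxxx => /eqP.
by rewrite eq_sym oner_eq0.
Qed.

End Boundary.

(** * Every proper embedding extends to a homeomorphism *)

Section Homeomorphisms.
Variables (T U V : topologicalType).

(** Homeomorphisms with a given inverse. *)
Definition mutual (A : set T) (B : set U) (f : T -> U) (g : U -> T) : Prop :=
  [/\ cts A f, cts B g, (forall x, A x -> B (f x) /\ g (f x) = x)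
    & (forall y, B y -> A (g y) /\ f (g y) = y)].

Lemma homeo_mutual A B f : homeo_on A B f <-> exists g, mutual A B f g.
Proof.
by split=> -[g [h1 h2 h3 h4]]; exists g; split=> //; apply/ctsP.
Qed.

End Homeomorphisms.

Lemma mutual_comp (T U V : topologicalType) (A : set T) (B : set U) (C : set V)
    f g h k :
  mutual A B f g -> mutual B C h k -> mutual A C (h \o f) (g \o k).
Proof.
move=> [cf cg fP gP] [ch ck hP kP]; split.
- by apply: (cts_comp ch cf) => x /fP[].
- by apply: (cts_comp cg ck) => x /kP[].
- by move=> x /fP[Bx fx] /=; have [Cx ->] := hP _ Bx.
- by move=> y /kP[By ky] /=; have [Ay ->] := gP _ By.
Qed.

Lemma mutual_image (T U : topologicalType) (A : set T) (B : set U) f g (C : set T) :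
  mutual A B f g -> C `<=` A -> mutual C (f @` C) f g.
Proof.
move=> [cf cg fP gP] CA; split.
- exact: cts_subset cf.
- by apply: cts_subset cg => _ [x Cx <-]; case: (fP x (CA x Cx)).
- by move=> x Cx; split; [exists x|case: (fP x (CA x Cx))].
- by move=> _ [x Cx <-]; have [_ ->] := fP x (CA x Cx).
Qed.

Section StandardEmbedding.
Variable R : realType.
Implicit Types (v : R * R * R) (x y z : Mpt R) (p : Apt R * R).

(** The plane with coordinates [Y], [Z] is lifted to the surface
    [c = 1 - l1 a b], where [a = (Y + Z) / 2] and [b = (Y - Z) / 2], and projected
    radially to the sphere. The square of equation [max(|Y|, |Z|) = 1] goes to the
    equator, and the exchange of [Y] and [Z] becomes a reflection. *)
Definition l1 (a b : R) : R := `|a| + `|b|.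
Definition fib (Y Z : R) : R * R * R :=
  unit3 ((Y + Z) / 2, (Y - Z) / 2, 1 - l1 ((Y + Z) / 2) ((Y - Z) / 2)).
Definition cone v : R := v.2 + l1 v.1.1 v.1.2.
Definition fibY v : R := v.1.1 / cone v + v.1.2 / cone v.
Definition fibZ v : R := v.1.1 / cone v - v.1.2 / cone v.

Lemma l1_ge0 a b : 0 <= l1 a b. Proof. by rewrite addr_ge0. Qed.

Lemma l1_le (a b c : R) : (l1 a b <= c) = (- c <= a + b <= c) && (- c <= a - b <= c).
Proof.
rewrite /l1; apply/idP/idP.
  move=> h; have := ler_normD a b; have := ler_normB a b => h1 h2.
  by rewrite -!ler_norml (le_trans h1 h) (le_trans h2 h).
case/andP=> /andP[h1 h2] /andP[h3 h4].
have [a0|a0] := leP 0 a; have [b0|b0] := leP 0 b;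
  rewrite ?(ger0_norm a0) ?(ltr0_norm a0) ?(ger0_norm b0) ?(ltr0_norm b0); lra.
Qed.

Lemma fib_sqn (a b : R) : 0 < sqn (a, b, 1 - l1 a b).
Proof.
apply: sqn_gt0; apply/negP => /eqP[a0 b0]; rewrite a0 b0 /l1 !normr0 => /eqP.
by rewrite addr0 subr0 oner_eq0.
Qed.

Lemma fib_sphere Y Z : sphere (fib Y Z).
Proof. exact/unit3_sphere/fib_sqn. Qed.

Lemma cone_unit3 (a b c : R) : cone (unit3 (a, b, c)) = (c + l1 a b) / Num.sqrt (sqn (a, b, c)).
Proof.
by rewrite /cone /l1 /unit3 /= !normrM !normfV (ger0_norm (sqrtr_ge0 _)); ring.
Qed.

Lemma fib_cone Y Z :
  cone (fib Y Z) = (Num.sqrt (sqn ((Y + Z) / 2, (Y - Z) / 2,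
     1 - l1 ((Y + Z) / 2) ((Y - Z) / 2))))^-1.
Proof. by rewrite /fib cone_unit3 subrK mul1r. Qed.

Lemma fib_cone_gt0 Y Z : 0 < cone (fib Y Z).
Proof. by rewrite fib_cone invr_gt0 sqrtr_gt0 fib_sqn. Qed.

(** The inverse projection divides by the homogeneous function which is 1 on
    the surface. *)
Lemma fibYK Y Z : fibY (fib Y Z) = Y.
Proof.
have s0 : Num.sqrt (sqn ((Y + Z) / 2, (Y - Z) / 2, 1 - l1 ((Y + Z) / 2) ((Y - Z) / 2))) != 0.
  by rewrite gt_eqF // sqrtr_gt0 fib_sqn.
by rewrite /fibY fib_cone /fib /= !invrK !divfK //; lra.
Qed.

Lemma fibZK Y Z : fibZ (fib Y Z) = Z.
Proof.
have s0 : Num.sqrt (sqn ((Y + Z) / 2, (Y - Z) / 2, 1 - l1 ((Y + Z) / 2) ((Y - Z) / 2))) != 0.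
  by rewrite gt_eqF // sqrtr_gt0 fib_sqn.
by rewrite /fibZ fib_cone /fib /= !invrK !divfK //; lra.
Qed.

Lemma fibK v : sphere v -> 0 < cone v -> fib (fibY v) (fibZ v) = v.
Proof.
move=> Sv c0; have cn0 : cone v != 0 by rewrite gt_eqF.
rewrite -[RHS](unit3_id Sv) /fib /fibY /fibZ.
have -> : (v.1.1 / cone v + v.1.2 / cone v + (v.1.1 / cone v - v.1.2 / cone v)) / 2 =
  (cone v)^-1 * v.1.1 by field.
have -> : (v.1.1 / cone v + v.1.2 / cone v - (v.1.1 / cone v - v.1.2 / cone v)) / 2 =
  (cone v)^-1 * v.1.2 by field.
have -> : 1 - l1 ((cone v)^-1 * v.1.1) ((cone v)^-1 * v.1.2) = (cone v)^-1 * v.2.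
  rewrite /l1 !normrM gtr0_norm ?invr_gt0 // -mulrDr.
  have -> : `|v.1.1| + `|v.1.2| = cone v - v.2 by rewrite /cone /l1; ring.
  by rewrite mulrBr mulVf ?gt_eqF //; ring.
by rewrite unit3_scale // invr_gt0.
Qed.

Lemma cts_fib (T : topologicalType) (A : set T) (f g : T -> R) :
  cts A f -> cts A g -> cts A (fun q => fib (f q) (g q)).
Proof.
move=> cf cg; rewrite /fib; apply: cts_unit3 => [|q _]; last exact: fib_sqn.
by rewrite /l1; cts_tac.
Qed.

Lemma cts_cone (T : topologicalType) (A : set T) (f : T -> R * R * R) :
  cts A f -> cts A (fun q => cone (f q)).
Proof. by move=> cf; rewrite /cone /l1; cts_tac. Qed.

Lemma cts_fibYZ (T : topologicalType) (A : set T) (f : T -> R * R * R) :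
  cts A f -> (forall q, A q -> 0 < cone (f q)) ->
  cts A (fun q => fibY (f q)) /\ cts A (fun q => fibZ (f q)).
Proof.
move=> cf pos; have cc := cts_cone cf.
have nz q : A q -> cone (f q) != 0 by move=> Aq; rewrite gt_eqF // pos.
by split; rewrite /fibY /fibZ; cts_tac.
Qed.

(** The rows and the heights of the planar data range over [-6, 6]. *)
Definition std p : Mpt R := (p.1.1, fib (6 * p.1.2) (6 * p.2)).
Definition cap : set (Mpt R) :=
  [set x | [/\ S1S2 x, 0 < cone x.2, -6 <= fibY x.2 <= 6 & -6 <= fibZ x.2 <= 6]].
Definition std_inv x : Apt R * R := ((x.1, fibY x.2 / 6), fibZ x.2 / 6).

Lemma std_mutual : mutual thick_annulus cap std std_inv.
Proof.
have n6 : 6 != 0 :> R by rewrite pnatr_eq0.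
have i6 (a : R) : a \in `[-1, 1] -> -6 <= 6 * a <= 6.
  by rewrite in_itv /= => /andP[? ?]; apply/andP; split; lra.
have i6' (a : R) : -6 <= a <= 6 -> a / 6 \in `[-1, 1].
  by move=> /andP[? ?]; rewrite in_itv /=; apply/andP; split; lra.
split.
- rewrite /std; apply: cts_pair; first by cts_tac.
  by apply: cts_fib; cts_tac.
- have [||cY cZ] := @cts_fibYZ _ cap (fun x => x.2).
  + by cts_tac.
  + by move=> x [].
  rewrite /std_inv; apply: cts_pair; last by apply: cts_mul => //; exact: cts_cst.
  by apply: cts_pair; [cts_tac|apply: cts_mul => //; exact: cts_cst].
- move=> p [[/= Cp p1] p2]; split.
    split; rewrite /= ?fibYK ?fibZK; [|exact: fib_cone_gt0|exact: i6|exact: i6].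
    by split=> //=; exact: fib_sphere.
  rewrite /std_inv /= fibYK fibZK ![6 * _]mulrC !mulfK //.
  by case: (p) => [[]].
- move=> x [[Cx Sx] c0 xY xZ]; split.
    by split; [split|] => //=; exact: i6'.
  rewrite /std /std_inv /= ![6 * _]mulrC !divfK // fibK //; by case: (x).
Qed.

(** These maps of the sphere keep the meridians; one of them takes the image of
    the thickened annulus to the product with the northern hemisphere. *)
Definition tilt (k : R) x : Mpt R :=
  (x.1, unit3 (x.2.1.1, x.2.1.2, x.2.2 + k * l1 x.2.1.1 x.2.1.2)).

Lemma tilt_sqn k x : S1S2 x -> 0 < sqn (x.2.1.1, x.2.1.2, x.2.2 + k * l1 x.2.1.1 x.2.1.2).
Proof.
move=> [_ /= Sx]; apply: sqn_gt0; apply/negP => /eqP[a0 b0].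
rewrite a0 b0 /l1 !normr0 addr0 mulr0 addr0 => c0.
by move: Sx; rewrite /sphere /= a0 b0 c0 !expr2 !mulr0 !addr0 => /esym/eqP; rewrite oner_eq0.
Qed.

Lemma tilt_S1S2 k x : S1S2 x -> S1S2 (tilt k x).
Proof. by move=> Sx; split; [case: Sx|apply: unit3_sphere; exact: tilt_sqn]. Qed.

Lemma tiltK k x : S1S2 x -> tilt (- k) (tilt k x) = x.
Proof.
move=> Sx; have [Cx /= S2x] := Sx; rewrite {1}/tilt /=.
set s := Num.sqrt _; have s0 : 0 < s by rewrite sqrtr_gt0; exact: tilt_sqn.
set w := (X in unit3 X).
have -> : w = (s^-1 * x.2.1.1, s^-1 * x.2.1.2, s^-1 * x.2.2).
  rewrite /w /l1 !normrM !normfV (gtr0_norm s0) ; congr (_, _, _); ring.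
by rewrite (@unit3_scale _ _ x.2) ?invr_gt0 // unit3_id //; case: (x).
Qed.

Lemma cts_tilt k : cts S1S2 (tilt k).
Proof.
rewrite /tilt; apply: cts_pair; first by cts_tac.
apply: cts_unit3; first by rewrite /l1; cts_tac.
by move=> x Sx; exact: tilt_sqn.
Qed.

Lemma tilt_mutual k : mutual S1S2 S1S2 (tilt k) (tilt (- k)).
Proof.
split; try exact: cts_tilt.
  by move=> x Sx; split; [exact: tilt_S1S2|exact: tiltK].
move=> x Sx; split; [exact: tilt_S1S2|].
by rewrite -{1}[k]opprK tiltK.
Qed.

Lemma capE x : S1S2 x -> cap x <-> l1 x.2.1.1 x.2.1.2 <= 6 * cone x.2.
Proof.
move=> Sx; have a0 := l1_ge0 x.2.1.1 x.2.1.2.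
have E : 0 < cone x.2 -> ((-6 <= fibY x.2 <= 6) && (-6 <= fibZ x.2 <= 6)) =
    (l1 x.2.1.1 x.2.1.2 <= 6 * cone x.2).
  move=> c0; rewrite /fibY /fibZ -l1_le /l1 !normrM !normfV (gtr0_norm c0) -mulrDl.
  by rewrite ler_pdivrMr.
have cE : cone x.2 = x.2.2 + l1 x.2.1.1 x.2.1.2 by [].
split; first by move=> [_ c0 h1 h2]; rewrite -E // h1.
move=> h; have c0 : 0 < cone x.2.
  have [l0|l0] := eqVneq (l1 x.2.1.1 x.2.1.2) 0; last first.
    by have := lt_def 0 (l1 x.2.1.1 x.2.1.2); rewrite l0 a0 => ?; lra.
  rewrite lt_neqAle; apply/andP; split; last lra.
  apply/eqP => z0; move: (Sx) => /(tilt_sqn 0).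
  rewrite cE l0 in z0; move: l0; rewrite /l1 => l0.
  have n1 := normr_ge0 x.2.1.1; have n2 := normr_ge0 x.2.1.2.
  have /eqP : `|x.2.1.1| = 0 by lra.
  have /eqP : `|x.2.1.2| = 0 by lra.
  rewrite !normr_eq0 => /eqP h1 /eqP h2.
  have h3 : x.2.2 = 0 by lra.
  by rewrite /sqn /= h1 h2 h3 normr0 !(addr0, mulr0, expr0n) ltxx.
by move: (E c0); rewrite h => /andP[].
Qed.

Lemma cap_north x : S1S2 x -> cap x <-> north (tilt (5 / 6) x).
Proof.
move=> Sx; have s0 := tilt_sqn (5 / 6) Sx; rewrite capE //.
suff -> : north (tilt (5 / 6) x) <-> 0 <= x.2.2 + 5 / 6 * l1 x.2.1.1 x.2.1.2.
  by rewrite /cone; split=> h; lra.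
split=> [[_]|h]; first by rewrite /= ler_pdivlMr ?mul0r // sqrtr_gt0.
split; first exact: tilt_S1S2.
by rewrite /= ler_pdivlMr ?mul0r // sqrtr_gt0.
Qed.

Definition flip x : Mpt R := (x.1, (x.2.1, - x.2.2)).

Lemma flipK x : flip (flip x) = x.
Proof. by case: x => ? [? ?]; rewrite /flip /= opprK. Qed.

Lemma flip_S1S2 x : S1S2 x -> S1S2 (flip x).
Proof. by case=> Cx Sx; split=> //; rewrite /sphere /= sqrrN. Qed.

Lemma cts_flip A : cts A flip.
Proof. by rewrite /flip; cts_tac. Qed.

Lemma flip_mutual : mutual S1S2 S1S2 flip flip.
Proof.
by split; try exact: cts_flip; move=> x Sx; rewrite flipK; split=> //; exact: flip_S1S2.
Qed.

(** The sphere is the double of the northern hemisphere. *)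
Definition double (f : Mpt R -> Mpt R) x : Mpt R :=
  if 0 <= x.2.2 then f x else flip (f (flip x)).

Lemma cts_double f : cts (@north R) f -> (forall x, north x -> north (f x)) ->
  (forall x, north x -> x.2.2 = 0 -> (f x).2.2 = 0) -> cts S1S2 (double f).
Proof.
move=> cf fN f0.
have c3 : continuous (fun x : Mpt R => x.2.2) by apply: ctsT; cts_tac.
have c0 : continuous (fun x : Mpt R => 0 : R) by apply: ctsT; exact: cts_cst.
apply: (@cts_setU _ _ _ [set x : Mpt R | 0 <= x.2.2] [set x : Mpt R | x.2.2 <= 0]).
- exact: closed_le_fun.
- exact: closed_le_fun.
- by move=> x _; case/orP: (le_total 0 x.2.2); [left|right].
- by apply: cts_eq cf => x [Sx /= x0]; rewrite /double x0.
have fN' x : (S1S2 `&` [set x : Mpt R | x.2.2 <= 0]) x -> north (flip x).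
  by case=> Sx x0; split; [exact: flip_S1S2|rewrite /= oppr_ge0].
apply: (@cts_eq _ _ _ (fun x => flip (f (flip x)))).
  move=> x Sx; rewrite /double; case: ifPn => // x0.
  have x00 : x.2.2 = 0 by apply/eqP; rewrite eq_le x0; case: Sx => _ ->.
  have fx : flip x = x by case: (x) x00 => ? [? ?] /= ->; rewrite /flip /= oppr0.
  have Nx : north x by rewrite -fx; exact: fN'.
  rewrite fx; case: (f x) (f0 x Nx x00) => ? [? ?] /= ->.
  by rewrite /flip /= oppr0.
apply: (@cts_comp _ _ _ _ setT flip) => //; first exact: cts_flip.
by apply: (cts_comp cf) => //; exact: cts_flip.
Qed.

Lemma double_mutual f g : mutual (@north R) (@north R) f g ->
  mutual S1S2 S1S2 (double f) (double g).
Proof.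
move=> [cf cg fP gP].
have f0 x : north x -> x.2.2 = 0 -> (f x).2.2 = 0 by exact: (boundary_invariance cf cg).
have g0 x : north x -> x.2.2 = 0 -> (g x).2.2 = 0 by exact: (boundary_invariance cg cf).
have half (f1 g1 : Mpt R -> Mpt R) :
    (forall x, north x -> north (f1 x) /\ g1 (f1 x) = x) ->
    (forall x, north x -> x.2.2 = 0 -> (g1 x).2.2 = 0) ->
    forall x, S1S2 x -> S1S2 (double f1 x) /\ double g1 (double f1 x) = x.
  move=> f1P g10 x Sx; have [x0|x0] := leP 0 x.2.2.
    have [[Sfx fx0] gfx] := f1P x (conj Sx x0).
    have -> : double f1 x = f1 x by rewrite /double x0.
    by rewrite /double fx0.
  have -> : double f1 x = flip (f1 (flip x)) by rewrite /double leNgt x0.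
  have Nx : north (flip x) by split; [exact: flip_S1S2|rewrite /= oppr_ge0 ltW].
  have [Nfx gfx] := f1P _ Nx; have [Sfx fx0] := Nfx; split; first exact: flip_S1S2.
  rewrite /double [(flip _).2.2]/= oppr_ge0; case: ifPn => h; last by rewrite flipK gfx flipK.
  have fx00 : (f1 (flip x)).2.2 = 0 by apply/eqP; rewrite eq_le h fx0.
  have := g10 _ Nfx fx00; rewrite gfx /= => /eqP; rewrite oppr_eq0 => /eqP xz.
  by rewrite xz ltxx in x0.
split.
- by apply: cts_double => // x /fP[].
- by apply: cts_double => // x /gP[].
- exact: half.
- exact: half.
Qed.

(** The solid torus is half of the double, so the given homeomorphism of
    the solid torus doubles, its boundary being invariant. *)
Lemma extend_north (h h' : Mpt R -> Mpt R) (e : Apt R * R -> Mpt R) :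
  mutual S1S2 S1S2 h h' -> homeo_on thick_annulus (h @` @north R) e ->
  exists E E', mutual S1S2 S1S2 E E' /\ forall p, thick_annulus p -> e p = E (std p).
Proof.
move=> mh /homeo_mutual[e' me].
have NS : @north R `<=` S1S2 by move=> x [].
have CS : cap `<=` S1S2 by move=> x [].
have mhN := mutual_image mh NS.
have mt : mutual cap (@north R) (tilt (5 / 6)) (tilt (- (5 / 6))).
  have := mutual_image (tilt_mutual (5 / 6)) CS; congr (mutual _ _ _ _).
  apply/seteqP; split=> [_ [x Cx <-]|y Ny]; first by apply/cap_north => //; exact: CS.
  have [_ _ _ tP] := tilt_mutual (5 / 6); have [Sx xE] := tP y (NS y Ny).
  by exists (tilt (- (5 / 6)) y) => //; apply/cap_north => //; rewrite xE.
have mst := mutual_comp std_mutual mt.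
have sym (T U : topologicalType) (A : set T) (B : set U) f g :
    mutual A B f g -> mutual B A g f by case.
have mf := mutual_comp (mutual_comp (sym _ _ _ _ _ _ mst) me) (sym _ _ _ _ _ _ mhN).
have mE := mutual_comp (mutual_comp (tilt_mutual (5 / 6)) (double_mutual mf)) mh.
eexists; eexists; split; first exact: mE.
move=> p Tp /=; have [_ _ sP _] := std_mutual; have [Cp stdp] := sP p Tp.
have [_ _ tP _] := mt; have [Np tp] := tP _ Cp.
rewrite /double (proj2 Np) /= tp stdp.
by have [_ _ eP _] := me; have [_ _ _ hP] := mhN; have [_ ->] := hP _ (eP p Tp).1.
Qed.

(** Both solid tori of the decomposition are images of the northern one under
    homeomorphisms of the whole space. *)
Theorem extend_embedding (e : Apt R * R -> Mpt R) : proper_annulus_embedding e ->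
  exists E E', mutual S1S2 S1S2 E E' /\ forall p, thick_annulus p -> e p = E (std p).
Proof.
move=> [V1 [V2 [[_ [H [[_ _ Hh] H1 H2]]] he]]].
have /homeo_mutual[h' mh] : homeo_on S1S2 S1S2 (H 1) by apply: Hh; rewrite ler01 lexx.
case: he => he; first by apply: (extend_north mh); rewrite H1.
apply: (extend_north (mutual_comp flip_mutual mh)).
suff -> : (H 1 \o flip) @` @north R = V2 by [].
rewrite -H2 -image_comp; congr (_ @` _); apply/seteqP; split=> [_ [x [Sx x0] <-]|x [Sx x0]].
  by split; [exact: flip_S1S2|rewrite /= oppr_le0].
exists (flip x); last exact: flipK.
by split; [exact: flip_S1S2|rewrite /= oppr_ge0].
Qed.

End StandardEmbedding.

(** * Piecewise linear interpolation *)

Section Interpolation.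
Variable R : realType.
Implicit Types (v : int -> R) (n : int) (s u : R).

(** The piecewise linear function through the points [(n, v n)]. *)
Definition interp v u : R :=
  v (Num.floor u) + (u - (Num.floor u)%:~R) * (v (Num.floor u + 1) - v (Num.floor u)).

Lemma interp_decomp u : exists n s, [/\ 0 <= s, s < 1 & u = n%:~R + s].
Proof.
exists (Num.floor u), (u - (Num.floor u)%:~R).
have /andP[h1 h2] := floor_itv u; rewrite intrD in h2.
by split; [rewrite subr_ge0|lra|ring].
Qed.

Lemma floorD n s : 0 <= s -> s < 1 -> Num.floor (n%:~R + s) = n.
Proof.
move=> s0 s1; apply/floor_def/andP; split; first by rewrite lerDl.
by rewrite intrD ltrD2l.
Qed.

Lemma interpE v n s : 0 <= s <= 1 ->
  interp v (n%:~R + s) = v n + s * (v (n + 1) - v n).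
Proof.
move=> /andP[s0]; rewrite le_eqVlt => /orP[/eqP ->|s1]; last first.
  by rewrite /interp floorD // [_ + s - _]addrAC subrr add0r.
rewrite /interp (_ : n%:~R + 1 = (n + 1)%:~R + 0 :> R); last by rewrite intrD addr0.
by rewrite floorD // addr0 subrr mul0r; ring.
Qed.

Lemma interp_int v n : interp v n%:~R = v n.
Proof. by have := @interpE v n 0; rewrite addr0 mul0r addr0 lexx ler01; apply. Qed.

Lemma interp_continuous v : continuous (interp v).
Proof.
apply: ctsT; apply: cts_local => u _; set n := Num.floor u.
have /andP[h1 h2] := floor_itv u; rewrite intrD -/n in h1 h2.
exists [set w : R | n%:~R - 1 < w < n%:~R + 1]; split.
- rewrite (_ : mkset _ = [set w : R | n%:~R - 1 < w] `&` [set w : R | w < n%:~R + 1]).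
    by apply: openI; [exact: open_gt|exact: open_lt].
  by apply/seteqP; split=> w /= => [/andP[]|[-> ->]].
- by apply/andP; split=> //; lra.
apply: (@cts_eq _ _ _ (fun w : R => v n + (v (n + 1) - v n) * Num.max (w - n%:~R) (0:R)
    + (v n - v (n - 1)) * Num.min (w - n%:~R) 0)); last by cts_tac.
move=> w [_ /= /andP[w1 w2]]; have [wn|wn] := leP n%:~R w.
  rewrite max_l ?subr_ge0 // min_r ?subr_ge0 // mulr0 addr0.
  have -> : w = n%:~R + (w - n%:~R) by ring.
  rewrite interpE; first by ring.
  by apply/andP; split; lra.
rewrite max_r; last lra.
rewrite min_l; last lra.
have -> : w = (n - 1)%:~R + (w - n%:~R + 1) by rewrite intrB; ring.
rewrite interpE; last by apply/andP; split; lra.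
by rewrite subrK intrB; ring.
Qed.

Lemma interp_period v n (c : R) u : (forall m, v (m + n) = v m + c) ->
  interp v (u + n%:~R) = interp v u + c.
Proof.
move=> vP; have [m [s [s0 s1 ->]]] := interp_decomp u.
have s01 : 0 <= s <= 1 by rewrite s0 ltW.
have -> : m%:~R + s + n%:~R = (m + n)%:~R + s by rewrite intrD; ring.
by rewrite !interpE // addrAC !vP; ring.
Qed.

Lemma interp_ge v (a u : R) : (forall n, a <= v n) -> a <= interp v u.
Proof.
move=> va; have [n [s [s0 s1 ->]]] := interp_decomp u.
rewrite interpE ?s0 ?(ltW s1) //; have := va n; have := va (n + 1) => h1 h2.
rewrite -subr_ge0 (_ : _ - a = (1 - s) * (v n - a) + s * (v (n + 1) - a)); last by ring.
by apply: addr_ge0; apply: mulr_ge0; lra.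
Qed.

Lemma interp_le v (a u : R) : (forall n, v n <= a) -> interp v u <= a.
Proof.
move=> va; have [n [s [s0 s1 ->]]] := interp_decomp u.
rewrite interpE ?s0 ?(ltW s1) //; have := va n; have := va (n + 1) => h1 h2.
rewrite -subr_ge0 (_ : a - _ = (1 - s) * (a - v n) + s * (a - v (n + 1))); last by ring.
by apply: addr_ge0; apply: mulr_ge0; lra.
Qed.

End Interpolation.

(** * Diagrams on a grid *)

(** The first [n] values of a list are extended to the integers by adding the
    constant [c] after each period of length [n]. *)
Definition ext (n : nat) (c : int) (s : seq int) (j : int) : int :=
  nth 0 s `|(j %% n%:Z)%Z| + c * (j %/ n%:Z)%Z.

Lemma extD n c s (j : int) : (0 < n)%N -> ext n c s (j + n%:Z) = ext n c s j + c.
Proof.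
move=> n0; have nz : n%:Z != 0 by rewrite eqz_nat -lt0n.
rewrite /ext modzDr.
have -> : ((j + n%:Z) %/ n%:Z)%Z = 1 + (j %/ n%:Z)%Z by rewrite -divzMDl // mul1r addrC.
by rewrite mulrDr mulr1 [c + _]addrC addrA.
Qed.

Lemma ext_nat n c s (j : nat) : (0 < n)%N -> (j <= n)%N ->
  nth 0 s n = nth 0 s 0 + c -> ext n c s j = nth 0 s j.
Proof.
move=> n0; rewrite leq_eqVlt => /orP[/eqP ->|jn] sn; last first.
  by rewrite /ext modz_nat divz_nat modn_small // divn_small // mulr0 addr0.
by rewrite /ext modz_nat divz_nat modnn divnn n0 mulr1 sn.
Qed.

(** The columns of the vertices, in the universal cover: 34 columns are two turns,
    as the annulus has 17 columns. Both diagrams have these columns. *)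
Definition xs : seq int :=
  [:: 5; 6; 7; 8; 9; 10; 11; 12; 13; 14; 15; 14; 13; 12; 11; 10; 9; 8; 9; 10; 11;
      12; 13; 14; 15; 16; 17; 18; 19; 20; 21; 22; 23; 24; 25; 26; 27; 28; 29; 30;
      31; 32; 31; 30; 31; 32; 33; 34; 35; 36; 37; 38; 39].

(** A diagram is a closed polygon with 52 edges. The vertex [j] is in the column
    [gx j] and in the row [gy j]; [go j] is 1 on overpasses, -1 on underpasses and
    0 elsewhere; [gz j] is the height of the knot above the vertex. Each edge
    joins successive columns and is at most diagonal, so that edges can meet only
    at vertices if the edges over each column are linearly ordered. *)
Section GridChecks.
Variables ys os zs : seq int.
Implicit Types j k l : nat.

Definition gx j : int := nth 0 xs j.
Definition gy j : int := nth 0 ys j.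
Definition go j : int := nth 0 os j.
Definition gz j : int := nth 0 zs j.
Definition gdx j : int := gx j.+1 - gx j.
Definition gdy j : int := gy j.+1 - gy j.
Lemma gdxE j : gdx j = gx j.+1 - gx j. Proof. by []. Qed.
Lemma gdyE j : gdy j = gy j.+1 - gy j. Proof. by []. Qed.

Definition gup j : bool := gdx j == 1.
(** The column of an edge is that of its left end; [gyl] and [gyr] are the rows
    of its two ends. *)
Definition gcol j : int := if gup j then gx j else gx j.+1.
Definition gyl j : int := if gup j then gy j else gy j.+1.
Definition gyr j : int := if gup j then gy j.+1 else gy j.
(** Equality of points of the annulus, where columns count modulo 17. *)
Definition meet j k : bool :=
  [&& j != k, (gx j %% 17)%Z == (gx k %% 17)%Z & gy j == gy k].
Definition below j k : bool :=
  [&& gyl j <= gyl k, gyr j <= gyr k & (gyl j != gyl k) || (gyr j != gyr k)].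
(** At a crossing the two edges of a passage have the same direction. *)
Definition straight j : bool :=
  [&& (0 < j)%N, gdx j.-1 == gdx j & gdy j.-1 == gdy j].

Definition idx := iota 0 52.
(** The vertices 0 and 52 are the same. *)
Definition cyc j : int := go (j %% 52).

Definition periods_ok : bool :=
  [&& gy 52 == gy 0, go 52 == go 0, gz 52 == gz 0 & gx 52 == gx 0 + 34].
Definition steps_ok : bool :=
  all (fun j => [&& `|gdx j| == 1, `|gdy j| <= 1, `|gy j| <= 5 & `|gz j| <= 2]) idx.
Definition edges_ok : bool :=
  all (fun j => all (fun k => [|| j == k, (gcol j %% 17)%Z != (gcol k %% 17)%Z,
    below j k | below k j]) idx) idx.
Definition crossings_ok : bool :=
  all (fun j => all (fun k => meet j k ==>
    [&& go j == - go k, `|go j| == 1, (go j == 1) ==> (gz k < gz j), straight j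
      , gdx j * gdy k != gdy j * gdx k & all (fun l => meet j l ==> (l == k)) idx])
    idx) idx.
Definition overs_ok : bool :=
  all (fun j => (go j != 0) ==> has (meet j) idx) idx.
(** Two crossings at distance [d] along the curve, with none in between. *)
Definition alternating_ok : bool :=
  all (fun j => all (fun d => [&& cyc j != 0, cyc (j + d) != 0
    & all (fun e => cyc (j + e) == 0) (iota 1 d.-1)] ==> (cyc (j + d) == - cyc j))
    (iota 1 52)) idx.

Definition grid_ok : bool :=
  [&& periods_ok, steps_ok, edges_ok, crossings_ok, overs_ok & alternating_ok].

End GridChecks.

Definition ys1 : seq int :=
  [:: 1; 1; 1; 1; 1; 1; 1; 1; 1; 0; -1; -2; -3; -3; -3; -3; -3; -3; -4; -4; -4; -4;
      -4; -4; -4; -4; -3; -2; -1; -1; -1; -1; -2; -3; -4; -5; -5; -5; -5; -5; -4;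
      -3; -2; -1; 0; 1; 0; -1; 0; 1; 1; 1; 1].
Definition ys2 : seq int :=
  [:: 1; 1; 1; 1; 1; 1; 1; 1; 1; 0; -1; -2; -3; -3; -3; -3; -3; -3; -2; -1; 0; 1;
      2; 2; 2; 2; 1; 1; 1; 0; -1; -1; -2; -3; -4; -5; -5; -5; -5; -5; -4; -3; -2;
      -1; 0; 1; 0; -1; -1; -1; 0; 1; 1].

(** The overpasses [js] and the underpasses [ks]. *)
Definition signs (js ks : seq nat) : seq int :=
  [seq if j \in js then 1 else if j \in ks then -1 else 0 | j <- iota 0 53].
Definition os1 : seq int := signs [:: 9; 42; 23]%N [:: 44; 11; 40]%N.
Definition os2 : seq int := signs [:: 21; 9; 42; 50]%N [:: 7; 44; 11; 29]%N.

(** Heights are in half rows. *)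
Definition zs1 : seq int :=
  [:: 2; 1; 1; 1; 1; 1; 1; 1; 1; 1; 1; 0; 0; 0; 0; 0; 0; 1; 2; 2; 2; 2; 2; 2; 2; 2;
      2; 2; 2; 0; -2; -2; 0; 0; 0; 0; 0; 0; 0; 0; 0; 0; 1; 0; 0; 0; 0; -2; -2; -2;
      0; 2; 2].
Definition zs2 : seq int :=
  [:: 2; 1; 1; 1; 1; 1; 1; 1; 1; 1; 1; 0; 0; 0; 0; 0; 0; 1; 2; 2; 2; 2; 2; 2; 2; 2;
      2; 0; -2; -2; -2; -2; 0; 0; 0; 0; 0; 0; 0; 0; 0; 0; 1; 0; 0; 0; 0; -2; 0; 2;
      2; 2; 2].

Lemma grid_ok1 : grid_ok ys1 os1 zs1. Proof. by vm_compute. Qed.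
Lemma grid_ok2 : grid_ok ys2 os2 zs2. Proof. by vm_compute. Qed.

(** The embedding of the integers, with the ring as an argument. *)
Definition rint (R : realType) (n : int) : R := n%:~R.

Lemma int0_of_small (R : realType) (n : int) : -1 < rint R n < 1 -> n = 0.
Proof.
rewrite /rint => /andP[h1 h2].
have a : (-1 < n)%R by rewrite -(ltr_int R).
have b : (n < 1)%R by rewrite -(ltr_int R).
lia.
Qed.

Section GridDiagram.
Variable R : realType.
Variables ys os zs : seq int.
Hypothesis ok : grid_ok ys os zs.
Implicit Types (j k l : nat) (s t u : R).

Local Notation gy := (gy ys).
Local Notation go := (go os).
Local Notation gz := (gz zs).
Local Notation gdy := (gdy ys).
Local Notation meet := (meet ys).

Local Notation r := (@rint R).

Lemma idxP j : (j < 52)%N -> j \in idx. Proof. by rewrite mem_iota. Qed.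

Lemma grid_stepP j : (j < 52)%N ->
  [/\ gdx j = 1 \/ gdx j = -1, -1 <= gdy j <= 1, -5 <= gy j <= 5 & -2 <= gz j <= 2].
Proof.
move=> /idxP jI; case/and5P: ok => _ /allP/(_ _ jI)/and4P[h1 h2 h3 h4] _ _ _.
rewrite !ler_norml in h2 h3 h4; split=> //.
by move/eqP: h1 => h1; case: (leP 0 (gdx j)) h1 => h; [rewrite ger0_norm //; left|
  rewrite ltr0_norm // => <-; right; rewrite opprK].
Qed.

Lemma grid_edgeP j k : (j < 52)%N -> (k < 52)%N -> j != k ->
  (gcol j = gcol k %[mod 17])%Z -> below ys j k \/ below ys k j.
Proof.
move=> /idxP jI /idxP kI jk e; case/and5P: ok => _ _ /allP/(_ _ jI)/allP/(_ _ kI).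
by rewrite (negbTE jk) e eqxx /= => /orP.
Qed.

Lemma grid_meetP j k : (j < 52)%N -> (k < 52)%N -> meet j k ->
  [/\ go j = - go k, go j = 1 \/ go j = -1, go j = 1 -> gz k < gz j,
      straight ys j & gdx j * gdy k != gdy j * gdx k]
  /\ forall l, (l < 52)%N -> meet j l -> l = k.
Proof.
move=> /idxP jI /idxP kI jk; case/and5P: ok => _ _ _ /allP/(_ _ jI)/allP/(_ _ kI).
rewrite jk implyTb => /and5P[/eqP h1 /eqP h2 h3 h4 /andP[h5 /allP h6]] _.
split; last by move=> l /idxP/h6 + jl; rewrite jl /= => /eqP.
split=> //; last by move=> o1; move: h3; rewrite o1 eqxx.
by case: (leP 0 (go j)) h2 => h; [rewrite ger0_norm //; left|
  rewrite ltr0_norm // => <-; right; rewrite opprK].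
Qed.

Lemma grid_overP j : (j < 52)%N -> go j != 0 -> exists2 k, (k < 52)%N & meet j k.
Proof.
move=> /idxP jI o0; case/and5P: ok => _ _ _ _ /andP[h _].
have := allP h j jI; rewrite o0 => /hasP[k]; rewrite mem_iota => kI jk; exists k => //.
Qed.

Lemma meet_sym j k : meet j k = meet k j.
Proof. by rewrite /meet eq_sym [X in [&& _, X & _]]eq_sym [gy j == _]eq_sym. Qed.

Lemma grid_periodP : [/\ gy 52 = gy 0 + 0, go 52 = go 0 + 0, gz 52 = gz 0 + 0
  & gx 52 = gx 0 + 34].
Proof.
by case/and5P: ok => /and4P[/eqP h1 /eqP h2 /eqP h3 /eqP h4] _ _ _ _; rewrite !addr0.
Qed.

(** The polygon runs along one edge per unit of time; [po] interpolates the
    passages in the same way, and only its values at vertices matter. *)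
Definition px u : R := interp (fun n => r (ext 52 34 xs n)) u.
Definition py u : R := interp (fun n => r (ext 52 0 ys n)) u.
Definition pz u : R := interp (fun n => r (ext 52 0 zs n)) u.
Definition po u : R := interp (fun n => r (ext 52 0 os n)) u.

Lemma interp_period52 c (a : seq int) u :
  interp (fun n => r (ext 52 c a n)) (u + 52) = interp (fun n => r (ext 52 c a n)) u + r c.
Proof. by apply: (@interp_period R _ 52) => m; rewrite extD // /r intrD. Qed.

Lemma interp_nat c (a : seq int) j s : nth 0 a 52 = nth 0 a 0 + c ->
  (j < 52)%N -> 0 <= s <= 1 ->
  interp (fun n => r (ext 52 c a n)) (j%:R + s) =
  r (nth 0 a j) + s * r (nth 0 a j.+1 - nth 0 a j).
Proof.
move=> ac j52 s01; rewrite -[j%:R]/((j%:Z)%:~R) interpE //.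
have -> : ext 52 c a j = nth 0 a j by apply: ext_nat => //; exact: ltnW.
have -> : ext 52 c a (j%:Z + 1) = nth 0 a j.+1.
  by rewrite -[j%:Z + 1]/((j + 1)%:Z) addn1; exact: ext_nat.
by rewrite /r intrB.
Qed.

Lemma pxE j s : (j < 52)%N -> 0 <= s <= 1 -> px (j%:R + s) = r (gx j) + s * r (gdx j).
Proof. by move=> j52 s01; apply: interp_nat. Qed.
Lemma pyE j s : (j < 52)%N -> 0 <= s <= 1 -> py (j%:R + s) = r (gy j) + s * r (gdy j).
Proof. by move=> j52 s01; apply: interp_nat => //; case: grid_periodP. Qed.
Lemma pzE j s : (j < 52)%N -> 0 <= s <= 1 ->
  pz (j%:R + s) = r (gz j) + s * r (gz j.+1 - gz j).
Proof. by move=> j52 s01; apply: interp_nat => //; case: grid_periodP. Qed.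
Lemma po_nat j : (j < 52)%N -> po j%:R = r (go j).
Proof.
have e : go 52 = go 0 + 0 by case: grid_periodP.
by move=> j52; rewrite -[j%:R]addr0 /po (interp_nat e) ?lexx ?ler01 // mul0r addr0.
Qed.

Lemma grid_decomp u : 0 <= u < 52 ->
  exists j s, [/\ (j < 52)%N, 0 <= s, s < 1 & u = j%:R + s].
Proof.
move=> /andP[u0 u52]; have [n [s [s0 s1 uE]]] := interp_decomp u.
have n0 : (-1 < n)%R by rewrite -(ltr_int R); rewrite uE in u0; lra.
have n52 : (n < 52)%R by rewrite -(ltr_int R); rewrite uE in u52; lra.
case: n n0 n52 uE => // j _ j52 ->; exists j, s; split=> //.
Qed.

Lemma py_bound u : -5 <= py u <= 5.
Proof.
have b j : (j < 53)%N -> -5 <= gy j <= 5.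
  rewrite ltnS leq_eqVlt => /orP[/eqP ->|/grid_stepP[] //].
  by have [-> _ _ _] := grid_periodP; rewrite addr0; have [] := @grid_stepP 0%N isT.
have eb n : -5 <= ext 52 0 ys n <= 5.
  rewrite /ext mul0r addr0; apply: b; rewrite -ltz_nat.
  by rewrite gez0_abs ?modz_ge0 // (lt_trans (ltz_pmod _ _)).
apply/andP; split; [apply: interp_ge => n|apply: interp_le => n];
  by have /andP[h1 h2] := eb n; rewrite /r ?(ler_int _ (-5)) ?(ler_int _ _ 5).
Qed.

Lemma pz_bound u : -2 <= pz u <= 2.
Proof.
have b j : (j < 53)%N -> -2 <= gz j <= 2.
  rewrite ltnS leq_eqVlt => /orP[/eqP ->|/grid_stepP[] //].
  by have [_ _ -> _] := grid_periodP; rewrite addr0; have [] := @grid_stepP 0%N isT.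
have eb n : -2 <= ext 52 0 zs n <= 2.
  rewrite /ext mul0r addr0; apply: b; rewrite -ltz_nat.
  by rewrite gez0_abs ?modz_ge0 // (lt_trans (ltz_pmod _ _)).
apply/andP; split; [apply: interp_ge => n|apply: interp_le => n];
  by have /andP[h1 h2] := eb n; rewrite /r ?(ler_int _ (-2)) ?(ler_int _ _ 2).
Qed.

(** Around the circle there are 17 columns, and the rows go from -6 to 6; heights
    are in half rows. *)
Definition gcurve (i : 'I_1) t : Apt R := (circle_pt (px (52 * t) / 17), py (52 * t) / 6).
Definition gheight (i : 'I_1) t : R := pz (52 * t) / 12.
Definition gover (i : 'I_1) t : bool := 0 < po (52 * t).
Definition gpt j : Apt R := gcurve ord0 (j%:R / 52).
Definition gcross : seq (Apt R) := [seq gpt j | j <- [seq j <- idx | go j == 1]].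

Lemma gcurve_closed i : closed_curve annulus_int (gcurve i).
Proof.
split.
- apply: ctsT; rewrite /gcurve; apply: cts_pair.
    apply: (cts_comp_cont (@circle_pt_continuous R)); apply: cts_mul; last exact: cts_cst.
    by apply: (cts_comp_cont (@interp_continuous R _)); cts_tac.
  apply: cts_mul; last exact: cts_cst.
  by apply: (cts_comp_cont (@interp_continuous R _)); cts_tac.
- move=> t; rewrite /gcurve mulrDr mulr1 /px /py !interp_period52 /r addr0.
  by congr (_, _); rewrite mulrDl -[X in circle_pt (_ + X)](_ : 2%:R = _) ?circle_ptDn //; field.
- move=> t; split; first exact: circle_pt_circle.
  have /andP[h1 h2] := py_bound (52 * t).
  by rewrite /= in_itv /=; apply/andP; split; lra.
Qed.

Lemma gheight_closed i : closed_curve (`]-1, 1[ : set R) (gheight i).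
Proof.
split.
- apply: ctsT; rewrite /gheight; apply: cts_mul; last exact: cts_cst.
  by apply: (cts_comp_cont (@interp_continuous R _)); cts_tac.
- by move=> t; rewrite /gheight mulrDr mulr1 /pz !interp_period52 /r addr0.
- move=> t; have /andP[h1 h2] := pz_bound (52 * t).
  by rewrite /= in_itv /= /gheight; apply/andP; split; lra.
Qed.

Lemma circle_pt17 (a b : R) : circle_pt (a / 17) = circle_pt (b / 17) ->
  exists n : int, b = a + r (n * 17).
Proof.
move=> /circle_pt_eq[n e]; exists n; rewrite /r intrM -[b](@divfK _ 17) // e.
by rewrite mulrDl divfK.
Qed.

Lemma mod17_eq (a b n : int) : b = a + n * 17 -> (a = b %[mod 17])%Z.
Proof. by move=> ->; rewrite addrC modzMDl. Qed.

(** Position of a point of the edge [j] relatively to the column of the edge. *)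
Definition frac j s : R := if gup j then s else 1 - s.

Lemma px_frac j s : (j < 52)%N -> 0 <= s <= 1 -> px (j%:R + s) = r (gcol j) + frac j s.
Proof.
move=> j52 s01; rewrite pxE // /gcol /frac; have [dxj _ _ _] := grid_stepP j52.
rewrite /gup; case: dxj => e; rewrite e; first by rewrite eqxx /r; ring.
by rewrite /= (_ : gx j.+1 = gx j - 1) /r ?intrB; [ring|rewrite -e gdxE; ring].
Qed.

Lemma py_frac j s : (j < 52)%N -> 0 <= s <= 1 ->
  py (j%:R + s) = r (gyl ys j) + frac j s * (r (gyr ys j) - r (gyl ys j)).
Proof.
move=> j52 s01; rewrite pyE // /gyl /gyr /frac gdyE /r intrB.
by case: (gup j); ring.
Qed.

Lemma frac_open j s : 0 < s < 1 -> 0 < frac j s < 1.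
Proof. by move=> /andP[h1 h2]; rewrite /frac; case: gup; apply/andP; split; lra. Qed.

Lemma frac_inj j s t : frac j s = frac j t -> s = t.
Proof. by rewrite /frac; case: gup => // h; lra. Qed.

Lemma below_lt j k (f : R) : 0 < f < 1 -> below ys j k ->
  r (gyl ys j) + f * (r (gyr ys j) - r (gyl ys j)) <
  r (gyl ys k) + f * (r (gyr ys k) - r (gyl ys k)).
Proof.
move=> /andP[f0 f1] /and3P[h1 h2 h3]; rewrite -subr_gt0.
rewrite (_ : _ - _ = (1 - f) * (r (gyl ys k) - r (gyl ys j)) +
   f * (r (gyr ys k) - r (gyr ys j))); last by ring.
have g1 : 0 <= r (gyl ys k) - r (gyl ys j) by rewrite subr_ge0 ler_int.
have g2 : 0 <= r (gyr ys k) - r (gyr ys j) by rewrite subr_ge0 ler_int.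
case/orP: h3 => h3.
  have : 0 < r (gyl ys k) - r (gyl ys j) by rewrite subr_gt0 ltr_int lt_neqAle h3.
  by move=> g3; apply: ltr_pwDl; [apply: mulr_gt0 => //; lra|apply: mulr_ge0 => //; lra].
have : 0 < r (gyr ys k) - r (gyr ys j) by rewrite subr_gt0 ltr_int lt_neqAle h3.
by move=> g3; apply: ltr_wpDl; [apply: mulr_ge0 => //; lra|exact: mulr_gt0].
Qed.

Lemma meetP j k : (j < 52)%N -> (k < 52)%N -> j != k -> gpt j = gpt k -> meet j k.
Proof.
move=> j52 k52 jk; rewrite /gpt /gcurve => -[/= e1 e2 e3].
have m l : 52 * (l%:R / 52) = l%:R + 0 :> R by rewrite mulrC divfK // addr0.
have s01 : 0 <= (0 : R) <= 1 by rewrite lexx ler01.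
have {e1 e2} : circle_pt (px (52 * (j%:R / 52)) / 17) = circle_pt (px (52 * (k%:R / 52)) / 17).
  by congr (_, _).
rewrite !m !pxE // !mul0r !addr0 => /circle_pt17[n].
rewrite -intrD => /intr_inj e1.
move: e3; rewrite !m !pyE // !mul0r !addr0 => e3.
have {}e3 : gy j = gy k.
  by apply: (@intr_inj R); apply: (mulIf _ e3); rewrite invr_neq0.
by rewrite /meet jk e3 eqxx andbT; apply/eqP; exact: mod17_eq e1.
Qed.

(** Two edges of the same column do not meet inside it, so that the curve passes
    twice through the same point of the annulus only at vertices. *)
Lemma double_point u w : 0 <= u < 52 -> 0 <= w < 52 -> u != w ->
  circle_pt (px u / 17) = circle_pt (px w / 17) -> py u = py w ->
  exists j k, [/\ (j < 52)%N, (k < 52)%N, u = j%:R, w = k%:R & meet j k].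
Proof.
move=> /grid_decomp[j [s [j52 s0 s1 uE]]] /grid_decomp[k [t [k52 t0 t1 wE]]].
move=> uw ex ey; have s01 : 0 <= s <= 1 by rewrite s0 ltW.
have t01 : 0 <= t <= 1 by rewrite t0 ltW.
have [n en] := circle_pt17 ex.
have dxj := grid_stepP j52; have dxk := grid_stepP k52.
have vert : s = 0 -> t = 0 -> exists j k, [/\ (j < 52)%N, (k < 52)%N, u = j%:R, w = k%:R & meet j k].
  move=> s00 t00; exists j, k; rewrite uE wE s00 t00 !addr0; split=> //.
  apply: meetP => //; first by apply: contra uw => /eqP jk; rewrite uE wE jk s00 t00.
  by rewrite /gpt /gcurve !(mulrC 52) !divfK //; congr (_, _); move: ex ey;
    rewrite uE wE s00 t00 !addr0 => // _ ->.
have fin (a : R) : 0 <= a -> a < 1 -> 0 < a \/ a = 0.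
  by rewrite le_eqVlt => /orP[/eqP <-|]; auto.
have intpt i (a : R) (m : int) : (i < 52)%N -> 0 <= a -> a < 1 ->
    r (gx i) + a * r (gdx i) = r m -> a = 0.
  move=> i52 a0 a1 e; have [[d|d] _ _ _] := grid_stepP i52.
    move: e; rewrite d /r mulr1 => e; have : r (m - gx i) = a by rewrite /r intrB -e; ring.
    by move=> ea; rewrite -ea (@int0_of_small R (m - gx i)) ?ea //; apply/andP; split; lra.
  move: e; rewrite d /r mulrN1 => e; have : r (gx i - m) = a by rewrite /r intrB -e; ring.
  by move=> ea; rewrite -ea (@int0_of_small R (gx i - m)) ?ea //; apply/andP; split; lra.
have [s2|s2] := fin s s0 s1; last first.
  apply: vert => //; apply: (@intpt k t (gx j + n * 17)) => //.
  by rewrite -pxE // -wE en uE pxE // s2 mul0r addr0 /r intrD.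
have [t2|t2] := fin t t0 t1; last first.
  apply: vert => //; apply: (@intpt j s (gx k - n * 17)) => //.
  rewrite -pxE // -uE; move: en; rewrite wE pxE // t2 mul0r addr0 /r intrB => ->.
  by ring.
have fj : 0 < frac j s < 1 by apply: frac_open; rewrite s2.
have fk : 0 < frac k t < 1 by apply: frac_open; rewrite t2.
move: en ey; rewrite uE wE !px_frac // !py_frac // => en ey.
have cn : gcol k - gcol j - n * 17 = 0.
  apply: (@int0_of_small R); rewrite /r intrB intrB; rewrite /r in en.
  by move: fj fk => /andP[? ?] /andP[? ?]; apply/andP; split; lra.
have ff : frac j s = frac k t.
  have : r (gcol k - gcol j - n * 17) = 0 by rewrite cn.
  by rewrite /r intrB intrB; rewrite /r in en; lra.
have [jk|jk] := eqVneq j k.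
  by move: uw; rewrite uE wE -jk; move: ff; rewrite -jk => /frac_inj ->; rewrite eqxx.
have cc : (gcol j = gcol k %[mod 17])%Z.
  apply: (@mod17_eq _ _ n); move/eqP: cn; rewrite subr_eq0 subr_eq => /eqP ->.
  exact: addrC.
by rewrite -ff in ey; case: (grid_edgeP j52 k52 jk cc) => /(below_lt fj); rewrite ey ltxx.
Qed.

Lemma param52 (p : 'I_1 * R) : param p -> 0 <= 52 * p.2 < 52.
Proof. by rewrite /param /= => /andP[h1 h2]; apply/andP; split; lra. Qed.

Lemma param_neq (p q : 'I_1 * R) : p != q -> 52 * p.2 != 52 * q.2.
Proof.
move=> pq; apply: contra pq => /eqP e; case: p q e => [i a] [j b] /= e.
by rewrite (ord1 i) (ord1 j); have -> : a = b by lra.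
Qed.

Lemma gcurve_double (p q : 'I_1 * R) : param p -> param q -> p != q ->
  gcurve p.1 p.2 = gcurve q.1 q.2 ->
  exists j k, [/\ (j < 52)%N, (k < 52)%N, 52 * p.2 = j%:R, 52 * q.2 = k%:R & meet j k].
Proof.
move=> Pp Pq pq; rewrite /gcurve => -[e1 e2 e3].
apply: double_point; [exact: param52|exact: param52|exact: param_neq|by congr (_, _)|].
by apply: (mulIf _ e3); rewrite invr_neq0.
Qed.

Lemma gptE t j : 52 * t = j%:R -> gcurve ord0 t = gpt j.
Proof. by move=> e; rewrite /gpt /gcurve e (mulrC 52 (j%:R / 52)) divfK. Qed.

Lemma meet_gpt j k : (j < 52)%N -> (k < 52)%N -> meet j k -> gpt j = gpt k.
Proof.
move=> j52 k52 /and3P[_ /eqP e1 /eqP e2].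
have m l : 52 * (l%:R / 52) = l%:R + 0 :> R by rewrite mulrC divfK // addr0.
have s01 : 0 <= (0 : R) <= 1 by rewrite lexx ler01.
rewrite /gpt /gcurve !m !pxE // !pyE // !mul0r !addr0 e2; congr (_, _).
have cm (a : int) : circle_pt (r a / 17) = circle_pt (r (a %% 17)%Z / 17).
  by rewrite {1}(divz_eq a 17) /r intrD intrM mulrDl mulfK // addrC circle_ptDz.
by rewrite (cm (gx j)) e1 -(cm (gx k)).
Qed.

Lemma gcrossE c : c \in gcross -> exists j, [/\ (j < 52)%N, go j = 1 & c = gpt j].
Proof.
rewrite /gcross => /mapP[j]; rewrite mem_filter => /andP[/eqP oj].
by rewrite mem_iota => /andP[_ j52] ->; exists j.
Qed.

Lemma mem_gcross j : (j < 52)%N -> (gpt j \in gcross) = (go j != 0).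
Proof.
move=> j52; apply/idP/idP.
  move=> /gcrossE[k [k52 ok1 e]].
  have [<-|jk] := eqVneq k j; first by rewrite ok1.
  have := grid_meetP k52 j52 (meetP k52 j52 jk (esym e)).
  by rewrite ok1 => -[[/eqP]]; rewrite eq_sym eqr_oppLR => /eqP ->.
move=> o0; have [k k52 jk] := grid_overP j52 o0.
have [[e1 e2 _ _ _] _] := grid_meetP j52 k52 jk.
have mem l : (l < 52)%N -> go l = 1 -> gpt l \in gcross.
  move=> l52 ol; rewrite /gcross; apply/mapP; exists l => //.
  by rewrite mem_filter ol eqxx mem_iota.
case: e2 => oj; first exact: mem.
rewrite (meet_gpt j52 k52 jk); apply: mem => //; apply: oppr_inj.
by rewrite -e1 oj.
Qed.

Lemma gcross_uniq : uniq gcross.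
Proof.
rewrite /gcross map_inj_in_uniq ?filter_uniq ?iota_uniq // => j k.
rewrite !mem_filter !mem_iota => /andP[/eqP oj j52] /andP[/eqP ok1 k52] e.
apply: contrapT => /eqP jk.
have [[]] := grid_meetP j52 k52 (meetP j52 k52 jk e).
by rewrite oj ok1.
Qed.

Lemma param_nat j : (j < 52)%N -> param ((ord0, j%:R / 52) : 'I_1 * R).
Proof.
move=> j52; rewrite /param /=; apply/andP; split; first by rewrite divr_ge0.
by rewrite ltr_pdivrMr // mul1r ltr_nat.
Qed.

Lemma gcrossP c : c \in gcross <-> exists p q : 'I_1 * R, [/\ param p, param q, p != q,
  gcurve p.1 p.2 = c & gcurve q.1 q.2 = c].
Proof.
split=> [/gcrossE[j [j52 oj ->]]|[p [q [Pp Pq pq pc qc]]]].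
  have [|k k52 jk] := grid_overP j52; first by rewrite oj.
  exists (ord0, j%:R / 52), (ord0, k%:R / 52); split.
  - exact: param_nat.
  - exact: param_nat.
  - case/and3P: (jk) => + _ _; apply: contra => /eqP[/(congr1 (fun a => a * 52))].
    by rewrite !divfK // => /eqP; rewrite eqr_nat.
  - by [].
  - exact/esym/meet_gpt.
have [|j [k [j52 k52 pj qk jk]]] := gcurve_double Pp Pq pq; first by rewrite pc qc.
rewrite -pc (ord1 p.1) (gptE pj) mem_gcross //.
have [[_ [->|->] _ _ _] _] // := grid_meetP j52 k52 jk.
Qed.

Lemma gcross_double (p q s : 'I_1 * R) : param p -> param q -> param s ->
  gcurve p.1 p.2 = gcurve q.1 q.2 -> gcurve p.1 p.2 = gcurve s.1 s.2 ->
  [\/ p = q, p = s | q = s].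
Proof.
move=> Pp Pq Ps pq ps.
have [->|npq] := eqVneq p q; first by constructor 1.
have [->|nps] := eqVneq p s; first by constructor 2.
have [j [k [j52 k52 pj qk jk]]] := gcurve_double Pp Pq npq pq.
have [j' [l [j'52 l52 pj' sl jl]]] := gcurve_double Pp Ps nps ps.
move: pj'; rewrite pj => /eqP; rewrite eqr_nat => /eqP jj; rewrite -jj in jl.
have [_ uni] := grid_meetP j52 k52 jk; have lk := uni l l52 jl.
constructor 3; case: q s qk sl {Pq Ps pq ps npq nps} => [a b] [c d] /= qk sl.
by rewrite (ord1 a) (ord1 c); congr (_, _); rewrite lk -qk in sl; lra.
Qed.

Lemma goverP (p q : 'I_1 * R) : param p -> param q -> p != q ->
  gcurve p.1 p.2 = gcurve q.1 q.2 -> gover p.1 p.2 = ~~ gover q.1 q.2.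
Proof.
move=> Pp Pq pq e; have [j [k [j52 k52 pj qk jk]]] := gcurve_double Pp Pq pq e.
rewrite /gover pj qk !po_nat //.
have [[e1 e2 _ _ _] _] := grid_meetP j52 k52 jk.
have -> : go k = - go j by rewrite e1 opprK.
by case: e2 => ->; rewrite /r ?opprK /= ?intrN ?ltr01 ?oppr_gt0 ?ltr10.
Qed.

Lemma gover_periodic i t : gover i (t + 1) = gover i t.
Proof. by rewrite /gover mulrDr mulr1 /po interp_period52 /r addr0. Qed.

Lemma gcurve_periodz i t (m : int) : gcurve i (t + m%:~R) = gcurve i t.
Proof.
have [_ p1 _] := gcurve_closed i.
have pn (n : nat) t0 : gcurve i (t0 + n%:R) = gcurve i t0.
  by elim: n => [|n IH]; rewrite ?addr0 // -natr1 addrA p1.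
case: m => n; first exact: pn.
by rewrite -[LHS](pn n.+1) NegzE mulrNz subrK.
Qed.

Lemma extM n c (a : seq int) (j m : int) : (0 < n)%N ->
  ext n c a (m * n%:Z + j) = ext n c a j + c * m.
Proof.
move=> n0; have nz : n%:Z != 0 by rewrite eqz_nat -lt0n.
by rewrite /ext modzMDl divzMDl // mulrDr [c * m + _]addrC addrA.
Qed.

Lemma ext_go j : (j < 52)%N -> ext 52 0 os j = go j.
Proof. by move=> j52; rewrite /ext mul0r addr0 modz_nat /= modn_small. Qed.

Lemma gcross_time t : gcurve ord0 t \in gcross ->
  exists n : int, 52 * t = r n /\ ext 52 0 os n != 0.
Proof.
set m := Num.floor t; have /andP[m1 m2] := floor_itv t.
rewrite intrD -/m in m1 m2; pose t0 := t - r m.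
have -> : t = t0 + m%:~R by rewrite /t0 /r subrK.
have P0 : param ((ord0, t0) : 'I_1 * R).
  by rewrite /param /t0 /r /=; apply/andP; split; lra.
rewrite gcurve_periodz => ht0.
suff [k [k52 tk]] : exists k, (k < 52)%N /\ 52 * t0 = k%:R.
  exists (m * 52 + k); split; first by rewrite /r intrD intrM mulrDr tk; ring.
  by rewrite extM // mul0r addr0 ext_go // -mem_gcross // -(gptE tk).
have [j [j52 _ e]] := gcrossE ht0.
have [tj|tj] := eqVneq (ord0, t0) ((ord0, j%:R / 52) : 'I_1 * R).
  by exists j; case: tj => ->; split=> //; rewrite mulrC divfK.
by have [k [_ [k52 _ tk _ _]]] := gcurve_double P0 (param_nat j52) tj e; exists k.
Qed.

Lemma time_gcross t (n : int) : 52 * t = r n -> ext 52 0 os n != 0 ->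
  gcurve ord0 t \in gcross.
Proof.
move=> tn en; set m := (n %/ 52)%Z; set j := `|(n %% 52)%Z|%N.
have jE : j%:Z = (n %% 52)%Z by rewrite gez0_abs // modz_ge0.
have nE : n = m * 52 + j%:Z by rewrite jE; exact: divz_eq.
have j52 : (j < 52)%N by rewrite -ltz_nat jE ltz_pmod.
have -> : t = j%:R / 52 + m%:~R.
  have : 52 * t = j%:R + m%:~R * 52 by rewrite tn nE /r intrD intrM addrC.
  by lra.
rewrite gcurve_periodz -/(gpt j) mem_gcross // -ext_go //.
by move: en; rewrite nE extM // mul0r addr0.
Qed.

Lemma ext_sign n : ext 52 0 os n != 0 -> ext 52 0 os n = 1 \/ ext 52 0 os n = -1.
Proof.
set j := `|(n %% 52)%Z|%N.
have jE : j%:Z = (n %% 52)%Z by rewrite gez0_abs // modz_ge0.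
have j52 : (j < 52)%N by rewrite -ltz_nat jE ltz_pmod.
have -> : ext 52 0 os n = go j by rewrite /ext mul0r addr0.
by move=> o0; have [k k52 jk] := grid_overP j52 o0; case: (grid_meetP j52 k52 jk) => [[]].
Qed.

(** Between successive crossings there are at most 52 edges, because the curve
    is back at the first crossing after 52 edges. *)
Lemma galternating (i : 'I_1) s t : s < t -> gcurve i s \in gcross -> gcurve i t \in gcross ->
  (forall u, s < u < t -> gcurve i u \notin gcross) -> gover i s = ~~ gover i t.
Proof.
rewrite (ord1 i) => st /gcross_time[n [sn en]] /gcross_time[n' [tn' en']] none.
have nn' : (n < n')%R by rewrite -(ltr_int R) -/(r n) -/(r n') -sn -tn'; lra.
have zero (q : int) : n < q < n' -> ext 52 0 os q = 0.
  move=> /andP[q1 q2]; apply/eqP/negPn/negP => eq0.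
  apply: (negP (none (r q / 52) _)).
    rewrite -(ltr_int R) -/(r n) -/(r q) -sn in q1.
    rewrite -(ltr_int R) -/(r n') -/(r q) -tn' in q2.
    by apply/andP; split; lra.
  by apply: (time_gcross _ eq0); rewrite mulrC divfK.
have [d d1 dE] : exists2 d : nat, (0 < d)%N & n' = n + d%:Z.
  exists `|n' - n|%N; first by rewrite absz_gt0 subr_eq0 gt_eqF.
  by rewrite gez0_abs ?subr_ge0 ?(ltW nn') //; ring.
set m := (n %/ 52)%Z; set j := `|(n %% 52)%Z|%N.
have jE : j%:Z = (n %% 52)%Z by rewrite gez0_abs // modz_ge0.
have nE : n = m * 52 + j%:Z by rewrite jE; exact: divz_eq.
have j52 : (j < 52)%N by rewrite -ltz_nat jE ltz_pmod.
have cycE e : ext 52 0 os (n + e%:Z) = cyc os (j + e).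
  by rewrite nE -addrA -PoszD extM // mul0r addr0 /ext mul0r addr0 modz_nat.
have d52 : (d <= 52)%N.
  rewrite leqNgt; apply/negP => d52; move: en.
  have -> : ext 52 0 os n = ext 52 0 os (n + 52%:Z) by rewrite extD // addr0.
  rewrite zero ?eqxx // dE; apply/andP; split; first by rewrite ltrDl.
  by rewrite ltrD2l.
have alt : ext 52 0 os n' = - ext 52 0 os n.
  case/and5P: ok => _ _ _ _ /andP[_ h].
  have dI : d \in iota 1 52 by rewrite mem_iota d1.
  have := allP (allP h j (idxP j52)) d dI.
  have c0 : cyc os j = ext 52 0 os n by rewrite -[n]addr0 (cycE 0%N) addn0.
  rewrite c0 -cycE -dE en en' /= => /implyP h52; apply/eqP/h52.
  apply/allP => e; rewrite mem_iota => /andP[e1 e2].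
  rewrite -cycE zero // dE ltrDl ltrD2l !ltz_nat e1 /=.
  by move: e2; rewrite add1n prednK.
rewrite /gover sn tn' /po !interp_int alt.
by case: (ext_sign en) => ->; rewrite /r ?opprK /= ?intrN ?ltr01 ?oppr_gt0 ?ltr10.
Qed.

Lemma passage j (a : R) : (j < 52)%N -> straight ys j -> -1 <= a <= 1 ->
  px (j%:R + a) = r (gx j) + a * r (gdx j) /\ py (j%:R + a) = r (gy j) + a * r (gdy j).
Proof.
move=> j52 /and3P[j0 /eqP ex /eqP ey] /andP[a1 a2]; have [a0|a0] := leP 0 a.
  by rewrite pxE ?pyE // a0 a2.
have jE : j%:R + a = j.-1%:R + (1 + a) by rewrite -{1}(prednK j0) -natr1; ring.
have a01 : 0 <= 1 + a <= 1 by apply/andP; split; lra.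
have j52' : (j.-1 < 52)%N by rewrite (leq_ltn_trans (leq_pred _)).
rewrite jE pxE // pyE // ex ey; split.
  have -> : gx j.-1 = gx j - gdx j by rewrite -ex gdxE prednK //; ring.
  by rewrite /r intrB; ring.
have -> : gy j.-1 = gy j - gdy j by rewrite -ey gdyE prednK //; ring.
by rewrite /r intrB; ring.
Qed.

Lemma grid_dxy j : (j < 52)%N ->
  -1 <= r (gdx j) <= 1 /\ -1 <= r (gdy j) <= 1.
Proof.
move=> j52; have [dx /andP[h1 h2] _ _] := grid_stepP j52; split.
  by case: dx => ->; rewrite /r ?intrN; apply/andP; split; lra.
by rewrite (ler_int R (-1)) h1 /r (ler_int _ _ 1).
Qed.

(** As the vertices are the only grid points on the curve, it comes near a grid
    point only along the edges that end there. *)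
Lemma near_vertex u (m n : int) : 0 <= u < 52 ->
  - 4^-1 <= px u - r m <= 4^-1 -> - 4^-1 <= py u - r n <= 4^-1 ->
  exists i a, [/\ (i <= 52)%N, - 4^-1 <= a <= 4^-1, u = i%:R + a, gx i = m & gy i = n].
Proof.
move=> /grid_decomp[l [s [l52 s0 s1 ->]]].
have s01 : 0 <= s <= 1 by rewrite s0 ltW.
rewrite pxE // pyE // => /andP[ex1 ex2] /andP[ey1 ey2].
have [_ /andP[dy1 dy2]] := grid_dxy l52; have [dx _ _ _] := grid_stepP l52.
have dxx : gx l.+1 = gx l + gdx l by rewrite gdxE; ring.
have dyy : gy l.+1 = gy l + gdy l by rewrite gdyE; ring.
have zero (p q : int) : -1 < r p - r q < 1 -> p = q.
  by move=> h; apply/eqP; rewrite -subr_eq0; apply/eqP/(@int0_of_small R); rewrite /r intrB.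
have dxr : r (gdx l) = 1 \/ r (gdx l) = -1 by case: dx => ->; [left|right]; rewrite /r ?intrN.
have [sl|sl] := leP s 2^-1.
  have gm : gx l = m by apply: zero; case: dxr => d; rewrite d in ex1 ex2; apply/andP; split; lra.
  have s4 : s <= 4^-1 by move: ex1 ex2; rewrite gm; case: dxr => -> ? ?; lra.
  exists l, s; split=> //; first exact: ltnW.
    by apply/andP; split; lra.
  apply: zero; have : - 4^-1 <= s * r (gdy l) <= 4^-1 by apply/andP; split; nra.
  by move=> /andP[? ?]; apply/andP; split; lra.
have gm : gx l.+1 = m.
  apply: zero; rewrite dxx /r intrD -/(r (gx l)) -/(r (gdx l)) -/(r m).
  by case: dxr => d; rewrite d in ex1 ex2 *; apply/andP; split; lra.
have s4 : 1 - s <= 4^-1.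
  move: ex1 ex2; rewrite -gm dxx /r intrD -/(r (gx l)) -/(r (gdx l)).
  by case: dxr => -> ? ?; lra.
exists l.+1, (s - 1); split=> //.
- by apply/andP; split; lra.
- by rewrite -natr1; ring.
apply: zero; rewrite dyy /r intrD -/(r (gy l)) -/(r (gdy l)) -/(r n).
have : - 4^-1 <= (1 - s) * r (gdy l) <= 4^-1 by apply/andP; split; nra.
by move=> /andP[? ?]; apply/andP; split; lra.
Qed.

(** The directions of the two passages are the axes of an affine chart. *)
Lemma gchart j k : (j < 52)%N -> (k < 52)%N -> meet j k ->
  exists f, crossing_chart gcurve (gpt j) f.
Proof.
move=> j52 k52 jk; have [[_ _ _ sj ndet] uni] := grid_meetP j52 k52 jk.
have kj : meet k j by rewrite meet_sym.
have [[_ _ _ sk _] _] := grid_meetP k52 j52 kj.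
have /and3P[njk mjk /eqP yjk] := jk.
have [bA bB] := grid_dxy j52; have [bA' bB'] := grid_dxy k52.
pose A := r (gdx j); pose B := r (gdy j); pose A' := r (gdx k); pose B' := r (gdy k).
rewrite -/A -/B -/A' -/B' in bA bB bA' bB'.
pose x0 := r (gx j); pose y0 := r (gy j).
have dt0 : A * B' - B * A' != 0.
  by rewrite /A /B /A' /B' /r -!intrM -intrB intr_eq0 subr_eq0.
have xk : exists n : int, r (gx k) = x0 + r (n * 17).
  exists ((gx k %/ 17)%Z - (gx j %/ 17)%Z); rewrite -[LHS]addr0.
  rewrite /x0 {1}(divz_eq (gx k) 17) {1}(divz_eq (gx j) 17) -(eqP mjk) /r.
  by rewrite !(intrD, intrM, intrB); ring.
have [n0 en0] := xk.
(* The scale 1/8 keeps the chart within a quarter of the grid from the vertex. *)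
pose K (z : R * R) : Apt R :=
  (circle_pt ((x0 + (z.1 * A + z.2 * A') / 8) / 17), (y0 + (z.1 * B + z.2 * B') / 8) / 6).
pose c0 := circle_pt (x0 / 17).
pose I (p : Apt R) : R * R :=
  (((17 * angle c0 p.1) * B' - (6 * p.2 - y0) * A') * 8 / (A * B' - B * A'),
   (A * (6 * p.2 - y0) - B * (17 * angle c0 p.1)) * 8 / (A * B' - B * A')).
have comb (z : R * R) (a b : R) : -1 < z.1 < 1 -> -1 < z.2 < 1 -> -1 <= a <= 1 ->
    -1 <= b <= 1 -> - 4^-1 <= (z.1 * a + z.2 * b) / 8 <= 4^-1.
  have pr (p q : R) : -1 < p < 1 -> -1 <= q <= 1 -> -1 <= p * q <= 1.
    by move=> /andP[? ?] /andP[? ?]; apply/andP; split; nra.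
  move=> z1 z2 a1 b1; have /andP[? ?] := pr _ _ z1 a1; have /andP[? ?] := pr _ _ z2 b1.
  by apply/andP; split; lra.
have sqP (z : R * R) : square z <-> (-1 < z.1 < 1 /\ -1 < z.2 < 1).
  by rewrite /square; split; case; rewrite /= !in_itv.
have ang z : square z -> angle c0 (K z).1 = (z.1 * A + z.2 * A') / 8 / 17.
  move=> /sqP[z1 z2]; rewrite /c0 /K /= [(x0 + _) / 17]mulrDl angleE //.
  have /andP[? ?] := comb z A A' z1 z2 bA bA'.
  by rewrite ltr_norml; apply/andP; split; lra.
have dotK z : square z -> 0 < dot c0 (K z).1.
  move=> /sqP[z1 z2]; rewrite /c0 /K /= [(x0 + _) / 17]mulrDl dot_circle_pt addrC addKr.
  have /andP[? ?] := comb z A A' z1 z2 bA bA'; have p0 := pi_gt0 R.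
  by apply: cos_gt0_pihalf; apply/andP; split; nra.
have IK z : square z -> I (K z) = z.
  move=> Sz; rewrite /I ang //; case: z Sz => z1 z2 Sz /=; congr (_, _); field.
    by [].
  by [].
have cI (O : set (Apt R)) : (forall p, O p -> 0 < dot c0 p.1) -> cts O I.
  move=> Od; have ca : cts O (fun p => angle c0 p.1).
    by apply: cts_angle => //; [exact: cts_cst|cts_tac].
  by rewrite /I; cts_tac.
have cK : continuous K.
  apply: ctsT; rewrite /K; apply: cts_pair; last by cts_tac.
  by apply: (cts_comp_cont (@circle_pt_continuous R)); cts_tac.
have unit1 (a : R) : -1 < a < 1 -> -1 <= a / 8 <= 1.
  by move=> /andP[? ?]; apply/andP; split; lra.
have F1 (a : R) : -1 < a < 1 -> K (a, 0) = gcurve ord0 (j%:R / 52 + (52 * 8)^-1 * a).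
  move=> /unit1/(passage j52 sj)[e1 e2]; rewrite /gcurve.
  have -> : 52 * (j%:R / 52 + (52 * 8)^-1 * a) = j%:R + a / 8 by field.
  rewrite e1 e2 /K /= -/x0 -/y0 -/A -/B.
  by congr (_, _); [congr circle_pt|]; field.
have F2 (a : R) : -1 < a < 1 -> K (0, a) = gcurve ord0 (k%:R / 52 + (52 * 8)^-1 * a).
  move=> /unit1/(passage k52 sk)[e1 e2]; rewrite /gcurve.
  have -> : 52 * (k%:R / 52 + (52 * 8)^-1 * a) = k%:R + a / 8 by field.
  rewrite e1 e2 /K /= en0 -yjk -/y0 -/A' -/B' /r intrM; congr (_, _); last by field.
  rewrite (_ : (x0 + n0%:~R * 17%:~R + a / 8 * A') / 17 =
    (x0 + (0 * A + a * A') / 8) / 17 + n0%:~R); last by field.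
  by rewrite circle_ptDz.
exists K; split.
- exists I; split.
  + exact: continuous_subspaceT.
  + by apply/ctsP; apply: cI => _ [z Sz <-]; exact: dotK.
  + by move=> z Sz; split; [exists z|exact: IK].
  + by move=> _ [z Sz <-]; split; rewrite IK //; exact: Sz.
- pose O0 := [set p : Apt R | 0 < dot c0 p.1].
  have oO0 : open O0.
    apply: open_lt_fun; first exact: cst_continuous.
    by apply: ctsT; apply: cts_dot; [exact: cts_cst|cts_tac].
  have cI1 := cts_fst (cI O0 (fun p h => h)).
  have cI2 := cts_snd (cI O0 (fun p h => h)).
  pose O1 := O0 `&` [set p | -1 < (I p).1]; pose O2 := O1 `&` [set p | (I p).1 < 1].
  pose O3 := O2 `&` [set p | -1 < (I p).2]; pose O4 := O3 `&` [set p | (I p).2 < 1].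
  have s1 : O1 `<=` O0 by move=> ? [].
  have s2 : O2 `<=` O0 by move=> ? [/s1].
  have s3 : O3 `<=` O0 by move=> ? [/s2].
  have o1 : open O1 by apply: open_cts_lt => //; exact: cts_cst.
  have o2 : open O2 by apply: open_cts_lt => //; [exact: cts_subset cI1|exact: cts_cst].
  have o3 : open O3 by apply: open_cts_lt => //; [exact: cts_cst|exact: cts_subset cI2].
  have o4 : open O4 by apply: open_cts_lt => //; [exact: cts_subset cI2|exact: cts_cst].
  exists O4 => //; apply/seteqP; split=> [_ [z Sz <-]|p [[[[[p0 p1] p2] p3] p4] [/= Cp p5]]].
    have [/andP[h1 h2] /andP[h3 h4]] := (sqP z).1 Sz; split.
      have I0 := IK z Sz.
      have [j1 j2 j3 j4] : [/\ -1 < (I (K z)).1, (I (K z)).1 < 1,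
          -1 < (I (K z)).2 & (I (K z)).2 < 1] by rewrite I0; split.
      by split; [split; [split; [split; [exact: dotK|]|]|]|].
    split; first exact: circle_pt_circle.
    have /andP[? ?] := comb z B B' ((sqP z).1 Sz).1 ((sqP z).1 Sz).2 bB bB'.
    have [_ _ /andP[g1 g2] _] := grid_stepP j52.
    have {}g1 : -5 <= y0 by rewrite /y0 /r (ler_int R (-5)).
    have {}g2 : y0 <= 5 by rewrite /y0 /r (ler_int R _ 5).
    by rewrite /= in_itv /=; apply/andP; split; lra.
  exists (I p); first by apply/sqP; rewrite /= in p1 p2 p3 p4; split; apply/andP; split.
  have [_ pE] := angleP Cp p0; rewrite -/c0 in pE.
  have e1 : ((I p).1 * A + (I p).2 * A') / 8 = 17 * angle c0 p.1.
    by rewrite /I /=; field.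
  have e2 : ((I p).1 * B + (I p).2 * B') / 8 = 6 * p.2 - y0.
    by rewrite /I /=; field.
  rewrite /K e1 e2; have -> : (x0 + 17 * angle c0 p.1) / 17 = x0 / 17 + angle c0 p.1 by field.
  rewrite pE; have -> : (y0 + (6 * p.2 - y0)) / 6 = p.2 by field.
  by case: (p).
- rewrite /K /gpt /gcurve (mulrC 52) divfK // -[j%:R]addr0 pxE ?pyE ?lexx ?ler01 //.
  by rewrite !(mul0r, addr0).
- apply/seteqP; split.
    move=> p [[i [t pt]] [z Sz zp]]; exists z => //; split=> //.
    set m := Num.floor t; have /andP[m1 m2] := floor_itv t.
    rewrite intrD -/m in m1 m2.
    have tE : t = (t - r m) + m%:~R by rewrite /r subrK.
    rewrite tE gcurve_periodz in pt; set t0 := t - r m in pt.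
    have u01 : 0 <= 52 * t0 < 52 by rewrite /t0 /r; apply/andP; split; lra.
    move: pt; rewrite -zp /gcurve => -[e1 e2 e3].
    have {e1 e2} : circle_pt ((x0 + (z.1 * A + z.2 * A') / 8) / 17) =
       circle_pt (px (52 * t0) / 17) by congr (_, _).
    move=> /circle_pt17[n en].
    have {}e3 : y0 + (z.1 * B + z.2 * B') / 8 = py (52 * t0).
      by apply: (mulIf _ e3); rewrite invr_neq0.
    have bx := comb z A A' ((sqP z).1 Sz).1 ((sqP z).1 Sz).2 bA bA'.
    have bY := comb z B B' ((sqP z).1 Sz).1 ((sqP z).1 Sz).2 bB bB'.
    have [||i0 [a [i52 a4 uE gm gn]]] := @near_vertex (52 * t0) (gx j + n * 17) (gy j) u01.
    - rewrite (_ : _ - _ = (z.1 * A + z.2 * A') / 8) // en /r intrD -[(gx j)%:~R]/x0.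
      by ring.
    - by rewrite (_ : _ - _ = (z.1 * B + z.2 * B') / 8) // -e3 -/y0; ring.
    have a1 : -1 <= a <= 1 by move/andP: a4 => [? ?]; apply/andP; split; lra.
    have i00 : (i0 < 52)%N.
      rewrite ltn_neqAle i52 andbT; apply/eqP => i0E; move: gm gn; rewrite i0E.
      have [-> _ _ ->] := grid_periodP; rewrite addr0 => gm gn.
      have m0j : meet 0 j.
        rewrite /meet gn eqxx andbT eq_sym -lt0n; case/and3P: sj => -> _ _ /=.
        apply/eqP; apply: (@mod17_eq _ _ (2 - n)).
        by rewrite mulrBl -[gx j](addrK (n * 17)) -gm; ring.
      by have [[_ _ _ + _] _] := grid_meetP (isT : 0 < 52)%N j52 m0j; rewrite /straight.
    have [ij|ij] := eqVneq i0 j.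
      right; rewrite ij in uE gm i00.
      have n00 : n = 0.
        by apply: (@mulIf _ 17) => //; apply: (addrI (gx j)); rewrite -gm mul0r addr0.
      have [q1 q2] := passage j52 sj a1.
      have h1 : (z.1 * A + z.2 * A') / 8 = a * A.
        move: en; rewrite uE q1 n00 mul0r /r addr0 -/(r (gx j)) -/(r (gdx j)) -/x0 -/A.
        by move=> /addrI.
      have h2 : (z.1 * B + z.2 * B') / 8 = a * B.
        by move: e3; rewrite uE q2 -/y0 -/B => /addrI.
      apply/eqP; rewrite -(mulIr_eq0 _ (mulIf dt0)).
      have -> : z.2 * (A * B' - B * A') =
        8 * (A * ((z.1 * B + z.2 * B') / 8) - B * ((z.1 * A + z.2 * A') / 8)) by field.
      by rewrite h1 h2; apply/eqP; ring.
    have mji : meet j i0.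
      rewrite /meet eq_sym ij gn eqxx andbT; apply/eqP; exact: mod17_eq gm.
    have ik := uni i0 i00 mji; rewrite ik in uE gm.
    left; have [q1 q2] := passage k52 sk a1.
    have h1 : (z.1 * A + z.2 * A') / 8 = a * A'.
      move: en; rewrite uE q1 gm /r intrD -/(r (gx j)) -/(r (n * 17)) -/(r (gdx k)) -/x0 -/A'.
      by rewrite [x0 + _ + r _]addrAC => /addrI.
    have h2 : (z.1 * B + z.2 * B') / 8 = a * B'.
      by move: e3; rewrite uE q2 -yjk -/y0 -/B' => /addrI.
    apply/eqP; rewrite -(mulIr_eq0 _ (mulIf dt0)).
    have -> : z.1 * (A * B' - B * A') =
      8 * (B' * ((z.1 * A + z.2 * A') / 8) - A' * ((z.1 * B + z.2 * B') / 8)) by field.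
    by rewrite h1 h2; apply/eqP; ring.
  move=> _ [z [Sz az] <-]; split; last by exists z.
  have [z1 z2] := (sqP z).1 Sz; case: z Sz az z1 z2 => z1 z2 Sz /= [->|->] b1 b2.
    by rewrite F2 //; eexists; eexists.
  by rewrite F1 //; eexists; eexists.
- exists (ord0, j%:R / 52), (ord0, k%:R / 52), (52 * 8)^-1; split.
  + exact: param_nat.
  + exact: param_nat.
  + apply: contra njk => /eqP[/(congr1 (fun a => a * 52))].
    by rewrite !divfK // => /eqP; rewrite eqr_nat.
  + by rewrite invr_gt0.
  + by move=> a a1; split; [exact: F1|exact: F2].
Qed.

Lemma gcross_chart c : c \in gcross -> exists f, crossing_chart gcurve c f.
Proof.
move=> /gcrossE[j [j52 oj ->]]; have [|k k52 jk] := grid_overP j52; first by rewrite oj.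
exact: gchart jk.
Qed.

Definition gdiagram : diagram R := @Diagram R 1 gcurve gcross gover isT gcurve_closed
  gcross_uniq gcrossP gcross_double gcross_chart gover_periodic goverP.

Lemma gdiagram_alternating : alternating_diagram gdiagram.
Proof. exact: galternating. Qed.

(** The heights separate the two passages through each crossing. *)
Lemma gheight_over (p q : 'I_1 * R) : param p -> param q -> p != q ->
  gcurve p.1 p.2 = gcurve q.1 q.2 -> gover p.1 p.2 ->
  gheight q.1 q.2 < gheight p.1 p.2.
Proof.
move=> Pp Pq pq e; have [j [k [j52 k52 pj qk jk]]] := gcurve_double Pp Pq pq e.
rewrite /gover /gheight pj qk po_nat // => o0.
have [[_ oj hz _ _] _] := grid_meetP j52 k52 jk.
have {}oj : go j = 1.
  by case: oj o0 => [//|->]; rewrite /r intrN oppr_gt0 ltr10.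
have s01 : 0 <= (0 : R) <= 1 by rewrite lexx ler01.
rewrite -[j%:R]addr0 -[k%:R]addr0 !pzE // !mul0r !addr0.
by rewrite ltr_pM2r ?invr_gt0 // ltr_int hz.
Qed.

End GridDiagram.

(** * Regions of a grid diagram *)

Section RegionChecks.
Variable ys : seq int.
Implicit Types (i m : int) (j k e c : nat).

(** The edge [j], lifted suitably, lies over the column [i] of the cover. *)
Definition in_col i j : bool := (gcol j %% 17)%Z == (i %% 17)%Z.
(** These count the edges over the column [i] whose left end, or right end, is in
    the row [m] or lower, and all of its edges. *)
Definition cntL i m : nat := count (fun j => in_col i j && (gyl ys j <= m)) idx.
Definition cntR i m : nat := count (fun j => in_col i j && (gyr ys j <= m)) idx.
Definition tot i : nat := count (in_col i) idx.
(** The number of edges below [e] in its column. *)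
Definition rank e : nat := count (fun k => in_col (gcol e) k && below ys k e) idx.

(** A region of the universal cover is given by its cells, the cell [(i, c)]
    lying in the column [i] above [c] edges; the region above the diagram, which
    is unbounded, is added on request. *)
Variables (cells : seq (int * nat)) (top : bool).
Definition lab i c : bool := ((i, c) \in cells) || (top && (c == tot i)).

Lemma labE i c : lab i c = ((i, c) \in cells) || (top && (c == tot i)). Proof. by []. Qed.

Definition rows : seq int := [seq n%:Z - 6 | n <- iota 0 12].
Definition columns : seq int := [seq n%:Z - 5 | n <- iota 0 40].

(** Across each unit segment of a vertical grid line, the cells on both sides
    have the same label; the edges meet such a line only at its integral points.
    Far from the listed cells only the upper region has to be compared. *)
Definition lab_ok : bool :=
  [&& all (fun x : int * nat => (-5 <= x.1) && (x.1 <= 33)) cells,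
      all (fun i => all (fun m => lab (i - 1) (cntR (i - 1) m) == lab i (cntL i m)) rows)
        columns
    & top ==> all (fun i => all (fun m =>
        (cntR (i - 1) m == tot (i - 1)) == (cntL i m == tot i)) rows)
        [seq n%:Z | n <- iota 0 17]].

(** Both cells along the edge ahead of the vertex [j] are labelled true, and both
    along the edge behind it false, or the other way round. *)
Definition separated j (fwd : bool) : bool :=
  let a := if fwd then j else j.-1 in let b := if fwd then j.-1 else j in
  [&& lab (gcol a) (rank a), lab (gcol a) (rank a).+1,
      ~~ lab (gcol b) (rank b) & ~~ lab (gcol b) (rank b).+1].

(** No cell of an outer region is labelled true. *)
Definition inner : bool :=
  ~~ top && all (fun x : int * nat => (x.2 != 0%N) && (x.2 != tot x.1)) cells.

End RegionChecks.

Definition run (i : int) (n c : nat) : seq (int * nat) := [seq (i + k%:Z, c) | k <- iota 0 n].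

(** Each list separates one or two crossings. *)
Definition cells1a : seq (int * nat) :=
  run 13 2 4 ++ run 14 17 1 ++ run 14 1 3 ++ run 25 6 3 ++ run 14 1 5 ++ run 30 1 5.
Definition cells1b : seq (int * nat) :=
  run (-3) 17 1 ++ run (-3) 1 3 ++ run 8 6 3 ++ run (-3) 1 5 ++ run 13 1 5 ++ run 8 7 2.
Definition cells2a : seq (int * nat) :=
  run 8 6 2 ++ run 13 1 4 ++ run 12 1 3 ++ run 13 2 5 ++ run 15 5 1.
Definition cells2b : seq (int * nat) := run 30 2 3 ++ run 25 6 2 ++ run 30 1 4.
Definition cells2c : seq (int * nat) := run 12 1 3 ++ run 13 2 5 ++ run 15 5 1.

Lemma lab_ok1a : lab_ok ys1 cells1a false. Proof. by vm_compute. Qed.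
Lemma lab_ok1b : lab_ok ys1 cells1b false. Proof. by vm_compute. Qed.
Lemma lab_ok2a : lab_ok ys2 cells2a false. Proof. by vm_compute. Qed.
Lemma lab_ok2b : lab_ok ys2 cells2b false. Proof. by vm_compute. Qed.
Lemma lab_ok2c : lab_ok ys2 cells2c true. Proof. by vm_compute. Qed.
Lemma separated1 : [&& separated ys1 cells1a false 9 true, separated ys1 cells1a false 11 false
  & separated ys1 cells1b false 23 false]. Proof. by vm_compute. Qed.
Lemma separated2 : [&& separated ys2 cells2a false 7 true, separated ys2 cells2b false 44 false,
  separated ys2 cells2b false 42 true & separated ys2 cells2c true 29 false].
Proof. by vm_compute. Qed.
Lemma inner_cells : [&& inner cells1a false, inner cells1b false, inner cells2a false
  & inner cells2b false]. Proof. by vm_compute. Qed.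

Section Regions.
Variable R : realType.
Variables ys os zs : seq int.
Hypothesis ok : grid_ok ys os zs.
Variables (cells : seq (int * nat)) (top : bool).
Hypothesis lok : lab_ok ys cells top.
Implicit Types (q : R * R) (j k e : nat) (i m : int) (f s t u Y : R).

Local Notation r := (@rint R).
Local Notation lab := (lab cells top).
Local Notation gcurve := (@gcurve R ys).
Local Notation straight := (straight ys).

(** The universal cover of the annulus. *)
Definition cov q : Apt R := (circle_pt (q.1 / 17), q.2 / 6).
Definition edgeY j f : R := r (gyl ys j) + f * (r (gyr ys j) - r (gyl ys j)).
(** The number of edges below a point, and the label of its cell. *)
Definition cnt i f Y : nat := count (fun j => in_col i j && (edgeY j f < Y)) idx.
Definition inside q : bool :=
  lab (Num.floor q.1) (cnt (Num.floor q.1) (q.1 - r (Num.floor q.1)) q.2).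

Lemma idx_lt j : j \in idx -> (j < 52)%N. Proof. by rewrite mem_iota. Qed.

Lemma gy_bounds j : (j < 52)%N -> (-5 <= gyl ys j <= 5) && (-5 <= gyr ys j <= 5).
Proof.
move=> j52; have [_ _ h1 _] := grid_stepP ok j52.
have h2 : -5 <= gy ys j.+1 <= 5.
  have [j1|j1] := leqP 51 j; last by have [] := grid_stepP ok (j1 : (j.+1 < 52)%N).
  have -> : j.+1 = 52%N by apply/eqP; rewrite eqn_leq j52.
  have [-> _ _ _] := grid_periodP ok; rewrite addr0.
  by have [] := grid_stepP ok (isT : 0 < 52)%N.
by rewrite /gyl /gyr; case: gup; rewrite h1 h2.
Qed.

Lemma edge_curve i j f : (j < 52)%N -> in_col i j -> 0 <= f <= 1 ->
  curves_set gcurve (cov (r i + f, edgeY j f)).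
Proof.
move=> j52 /eqP ij f01; pose s := if gup j then f else 1 - f.
have s01 : 0 <= s <= 1 by move/andP: f01 => [? ?]; rewrite /s; case: gup; apply/andP; split; lra.
have fs : frac j s = f by rewrite /frac /s; case: gup => //; ring.
exists ord0, ((j%:R + s) / 52); rewrite /gcurve /cov (mulrC 52) divfK // (px_frac ok) // (py_frac ok) // fs.
congr (_, _); rewrite [in LHS](divz_eq i 17) [in RHS](divz_eq (gcol j) 17) ij /r !intrD !intrM.
have E (a b : R) (p : int) : (p%:~R * 17 + a + b) / 17 = (a + b) / 17 + p%:~R.
  by field.
by rewrite !E !circle_ptDz.
Qed.

Lemma near_all (T : topologicalType) (x : T) (I : eqType) (S : seq I) (P : I -> T -> Prop) :
  (forall a, a \in S -> \forall y \near x, P a y) ->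
  \forall y \near x, forall a, a \in S -> P a y.
Proof.
elim: S => [|a S IH] h; first by apply: filterS filterT => y _ a.
have h1 := h a (mem_head _ _).
have h2 : \forall y \near x, forall b, b \in S -> P b y.
  by apply: IH => b bS; apply: h; rewrite inE bS orbT.
apply: filterS2 h1 h2 => y Pa PS b; rewrite inE => /orP[/eqP ->|] //; exact: PS.
Qed.

Lemma near_lt (T : topologicalType) (x : T) (g h : T -> R) :
  continuous g -> continuous h -> g x < h x -> \forall y \near x, g y < h y.
Proof.
by move=> cg ch gh; apply: (open_nbhs_nbhs (conj (open_lt_fun cg ch) gh)).
Qed.

Lemma edgeY_continuous i j : continuous (fun q => edgeY j (q.1 - r i)).
Proof. by apply: ctsT; rewrite /edgeY; cts_tac. Qed.

Lemma snd_continuous : continuous (fun q => q.2).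
Proof. by apply: ctsT; cts_tac. Qed.

Lemma near_cnt i q :
  (forall j, (j < 52)%N -> in_col i j -> edgeY j (q.1 - r i) != q.2) ->
  \forall p \near q, cnt i (p.1 - r i) p.2 = cnt i (q.1 - r i) q.2.
Proof.
move=> off.
have : \forall p \near q, forall j, j \in idx ->
    in_col i j -> (edgeY j (p.1 - r i) < p.2) = (edgeY j (q.1 - r i) < q.2).
  apply: near_all => j /idx_lt j52; have [ij|] := boolP (in_col i j); last first.
    by move=> _; apply: filterS filterT.
  have [lt|gt|e] := ltgtP (edgeY j (q.1 - r i)) q.2.
  - apply: filterS (near_lt (@edgeY_continuous i j) snd_continuous lt) => p h _.
    exact: h.
  - apply: filterS (near_lt snd_continuous (@edgeY_continuous i j) gt) => p h _.
    by rewrite ltNge ltW.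
  - by have := off j j52 ij; rewrite e eqxx.
apply: filterS => p h; apply: eq_in_count => j jI.
by case: (boolP (in_col i j)) => //= ij; rewrite h.
Qed.

Lemma edgeY0 j : edgeY j 0 = r (gyl ys j). Proof. by rewrite /edgeY mul0r addr0. Qed.
Lemma edgeY1 j : edgeY j 1 = r (gyr ys j). Proof. by rewrite /edgeY; ring. Qed.

Lemma lt_floor (n : int) Y : r n != Y -> (r n < Y) = (n <= Num.floor Y).
Proof. by move=> nY; rewrite lt_neqAle nY /= floor_ge_int. Qed.

(** Beyond the rows of the diagram nothing changes. *)
Definition clamp m : int := Num.max (-6) (Num.min m 5).

Lemma clampE m (n : int) : -5 <= n <= 5 -> (n <= clamp m) = (n <= m).
Proof. by rewrite /clamp => /andP[h1 h2]; lia. Qed.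

Lemma clamp_rows m : clamp m \in rows.
Proof.
apply/mapP; exists (absz (clamp m + 6)); last by rewrite /clamp; lia.
by rewrite mem_iota /clamp; lia.
Qed.

(** The check of finitely many columns is enough: the cells which are listed lie
    in these columns, and the upper region is periodic. *)
Lemma lab_consistent i m : lab (i - 1) (cntR ys (i - 1) m) = lab i (cntL ys i m).
Proof.
have -> : cntR ys (i - 1) m = cntR ys (i - 1) (clamp m).
  by apply: eq_in_count => j /idx_lt/gy_bounds/andP[_ h]; rewrite clampE.
have -> : cntL ys i m = cntL ys i (clamp m).
  by apply: eq_in_count => j /idx_lt/gy_bounds/andP[h _]; rewrite clampE.
have := clamp_rows m; move: (clamp m) => {}m mI.
case/and3P: lok => /allP hc /allP hi ht.
have [iI|iI] := boolP (-5 <= i <= 34).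
  have /hi/allP/(_ m mI)/eqP : i \in columns by
    apply/mapP; exists (absz (i + 5)); [rewrite mem_iota|]; lia.
  by [].
have nc (a : int) c : (a == i) || (a == i - 1) -> (a, c) \in cells = false.
  by move=> h; apply/negP => /hc /=; move: h iI => /orP[] /eqP ->; lia.
rewrite !labE !nc ?eqxx ?orbT // !orFb.
have [tp|_] := boolP top; last by [].
rewrite tp implyTb in ht; rewrite !andTb; move/allP: ht => ht.
have iE : (i %% 17)%Z \in [seq n%:Z | n <- iota 0 17].
  apply/mapP; exists `|(i %% 17)%Z|%N; last by rewrite gez0_abs // modz_ge0.
  by rewrite mem_iota /= add0n -ltz_nat gez0_abs ?modz_ge0 // ltz_pmod.
have := allP (ht _ iE) m mI => /eqP.
have c1 : in_col (i %% 17)%Z =1 in_col i by move=> j; rewrite /in_col modz_mod.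
have c2 : in_col ((i %% 17)%Z - 1) =1 in_col (i - 1).
  by move=> j; rewrite /in_col modzDml.
rewrite /cntR /cntL /tot (eq_count c1) (eq_count c2).
rewrite (@eq_count _ _ (fun j => in_col (i - 1) j && (gyr ys j <= m))); last first.
  by move=> j; rewrite c2.
by rewrite (@eq_count _ (fun j => in_col (i %% 17)%Z j && _)
  (fun j => in_col i j && (gyl ys j <= m))) // => j; rewrite c1.
Qed.

Lemma cnt_left i Y : (forall j, (j < 52)%N -> in_col i j -> edgeY j 0 != Y) ->
  cnt i 0 Y = cntL ys i (Num.floor Y).
Proof.
move=> off; apply: eq_in_count => j /idx_lt j52.
have [ij|//] := boolP (in_col i j); have := off j j52 ij.
by rewrite edgeY0 /= => h; rewrite lt_floor.
Qed.

Lemma cnt_right i Y : (forall j, (j < 52)%N -> in_col i j -> edgeY j 1 != Y) ->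
  cnt i 1 Y = cntR ys i (Num.floor Y).
Proof.
move=> off; apply: eq_in_count => j /idx_lt j52.
have [ij|//] := boolP (in_col i j); have := off j j52 ij.
by rewrite edgeY1 /= => h; rewrite lt_floor.
Qed.

Lemma near_floor q (a b : R) : a < q.1 < b -> \forall p \near q, a < p.1 < b.
Proof.
have c1 : continuous (fun q => q.1) by apply: ctsT; cts_tac.
have cc (c : R) : continuous (fun _ : R * R => c) by apply: ctsT; exact: cts_cst.
move=> /andP[h1 h2]; have n1 := near_lt (cc a) c1 h1; have n2 := near_lt c1 (cc b) h2.
by apply: filterS2 n1 n2 => p ? ?; apply/andP; split.
Qed.

(** The side of a grid line on which a point lies is irrelevant to the cell
    labels, by their consistency; hence the labelled set is open and closed off
    the diagram. *)
Lemma inside_near q : ~ curves_set gcurve (cov q) -> \forall p \near q, inside p = inside q.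
Proof.
move=> off; set i := Num.floor q.1; have /andP[i1 i2] := floor_itv q.1.
rewrite intrD -/i in i1 i2; have qE : q = (r i + (q.1 - r i), q.2).
  by rewrite /r addrC subrK; case: (q).
have offi (i' : int) f : 0 <= f <= 1 -> q.1 = r i' + f -> forall j, (j < 52)%N -> in_col i' j ->
    edgeY j f != q.2.
  move=> f01 e j j52 ij; apply/eqP => e2; apply: off.
  by have := edge_curve j52 ij f01; rewrite e2 -e; case: (q).
have off_i : forall j, (j < 52)%N -> in_col i j -> edgeY j (q.1 - r i) != q.2.
  apply: offi; first by rewrite /r; apply/andP; split; lra.
  by rewrite /r addrC subrK.
have nc := near_cnt off_i.
have [f0|f0] := ltP (r i) q.1.
  have : r i < q.1 < r i + 1 by rewrite f0 /r; lra.
  move=> /near_floor nf; apply: filterS2 nc nf => p hc /andP[p1 p2].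
  have fp : Num.floor p.1 = i.
    by apply/floor_def/andP; split; [exact: ltW|rewrite intrD].
  by rewrite /inside fp hc.
have q1i : q.1 = r i by apply/eqP; rewrite eq_le f0 /r.
have off_i1 : forall j, (j < 52)%N -> in_col (i - 1) j -> edgeY j (q.1 - r (i - 1)) != q.2.
  apply: offi; first by rewrite q1i /r intrB; apply/andP; split; lra.
  by rewrite /r addrC subrK.
have nc1 := near_cnt off_i1.
have : r i - 1 < q.1 < r i + 1 by rewrite q1i; apply/andP; split; lra.
move=> /near_floor nf; apply: filterS3 nc nc1 nf => p hc hc1 /andP[p1 p2].
rewrite /inside -/i; have [h|h] := leP (r i) p.1.
  have fp : Num.floor p.1 = i by apply/floor_def/andP; split; rewrite ?intrD.
  by rewrite fp hc.
have fp : Num.floor p.1 = i - 1.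
  by apply/floor_def/andP; rewrite subrK intrB; split=> //; exact: ltW.
rewrite fp hc1.
have z1 : q.1 - r (i - 1) = 1 by rewrite q1i /r intrB; ring.
have z0 : q.1 - r i = 0 by rewrite q1i subrr.
rewrite z1 z0; rewrite z1 in off_i1; rewrite z0 in off_i.
by rewrite cnt_left // cnt_right // lab_consistent.
Qed.

(** The label is locally constant off the diagram. *)
Lemma inside_path (g : R -> R * R) (a b : R) : a <= b ->
  cts (`[a, b] : set R) g -> (forall t, a <= t <= b -> ~ curves_set gcurve (cov (g t))) ->
  inside (g a) = inside (g b).
Proof.
move=> ab cg off; pose f t : R := (inside (g t))%:R.
have cf : cts (`[a, b] : set R) f.
  move=> t tI W Wt; have t01 : a <= t <= b by move: tI; rewrite /= in_itv.
  have n1 := cg t tI _ (inside_near (off t t01)).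
  have {}n1 : \forall u \near t, `[a, b]%classic u -> inside (g u) = inside (g t) := n1.
  suff : \forall u \near t, `[a, b]%classic u -> W (f u) by [].
  apply: filterS n1 => u h uI; rewrite /f h //; exact: nbhs_singleton.
have /ctsP cf' := cf.
apply: contrapT => nab.
have [|c _] := IVT ab cf' (v := 2^-1).
  rewrite /f ge_min le_max; case: (inside (g a)) (inside (g b)) nab => [] [] //= _.
    by apply/andP; split; apply/orP; [right|left]; lra.
  by apply/andP; split; apply/orP; [left|right]; lra.
by rewrite /f; case: inside => /=; lra.
Qed.

Lemma count_edge e f Y : (e < 52)%N -> 0 < f < 1 ->
  (forall k, k \in idx -> in_col (gcol e) k -> k != e ->
     (edgeY k f < Y) = (edgeY k f < edgeY e f)) ->
  cnt (gcol e) f Y = (rank ys e + (edgeY e f < Y)%R)%N.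
Proof.
move=> e52 f01 h; have ee : in_col (gcol e) e by rewrite /in_col.
have nb : below ys e e = false by rewrite /below !lexx !eqxx.
pose a k := in_col (gcol e) k && below ys k e.
pose b k := (k == e) && (edgeY e f < Y).
rewrite /cnt /rank (@eq_in_count _ _ (predU a b)).
  have := count_predUI a b idx; rewrite (@eq_in_count _ (predI a b) pred0) => [|k _ /=].
    rewrite count_pred0 addn0 => ->; congr (_ + _)%N; rewrite /b.
    case: (edgeY e f < Y); last first.
      by rewrite (@eq_count _ _ pred0) ?count_pred0 // => k; rewrite andbF.
    rewrite (@eq_count _ _ (pred1 e)); last by move=> k; rewrite andbT.
    by rewrite count_uniq_mem ?iota_uniq // mem_iota e52.
  by apply/negP => /andP[/andP[_ h1] /andP[/eqP ke _]]; rewrite ke nb in h1.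
rewrite /a /b {a b}.
move=> k kI /=; have [->|ke] := eqVneq k e; first by rewrite ee nb.
rewrite orbF; have [ck|//] := boolP (in_col (gcol e) k).
rewrite /= h //; have k52 := idx_lt kI.
case: (grid_edgeP ok k52 e52 ke (eqP ck)) => b.
  by rewrite b; exact: below_lt f01 b.
apply/idP/idP => [lt|b']; last exact: below_lt f01 b'.
by have := lt_trans lt (below_lt f01 b); rewrite ltxx.
Qed.

(** Near an edge there are only its two adjacent cells. *)
Lemma near_edge e f (v : bool) : (e < 52)%N -> 0 < f < 1 ->
  lab (gcol e) (rank ys e) = v -> lab (gcol e) (rank ys e).+1 = v ->
  \forall q \near ((r (gcol e) + f, edgeY e f) : R * R), inside q = v.
Proof.
move=> e52 f01 l0 l1; set i := gcol e; set p0 := (_, _) : R * R.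
have f0 : p0.1 - r i = f by rewrite /p0 /= addrC addKr.
have n1 : \forall q \near p0, forall k, k \in idx -> in_col i k -> k != e ->
     (edgeY k (q.1 - r i) < q.2) = (edgeY k (q.1 - r i) < edgeY e (q.1 - r i)).
  apply: near_all => k /idx_lt k52; have [ck|] := boolP (in_col i k); last first.
    by move=> _; apply: filterS filterT.
  have [->|ke] := eqVneq k e; first by apply: filterS filterT.
  have cE := @edgeY_continuous i.
  case: (grid_edgeP ok k52 e52 ke (eqP ck)) => /(below_lt (R := R) f01) b.
    have b1 : edgeY k (p0.1 - r i) < p0.2 by rewrite f0.
    have b2 : edgeY k (p0.1 - r i) < edgeY e (p0.1 - r i) by rewrite f0.
    have m1 := near_lt (cE k) snd_continuous b1; have m2 := near_lt (cE k) (cE e) b2.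
    by apply: filterS2 m1 m2 => q h1 h2 _ _; rewrite h1 h2.
  have b1 : p0.2 < edgeY k (p0.1 - r i) by rewrite f0.
  have b2 : edgeY e (p0.1 - r i) < edgeY k (p0.1 - r i) by rewrite f0.
  have m1 := near_lt snd_continuous (cE k) b1; have m2 := near_lt (cE e) (cE k) b2.
  by apply: filterS2 m1 m2 => q h1 h2 _ _; rewrite !ltNge (ltW h1) (ltW h2).
have : r i < p0.1 < r i + 1 by move/andP: f01 => [? ?]; apply/andP; split; rewrite /=; lra.
move=> /near_floor nf; apply: filterS2 n1 nf => q h /andP[q1 q2].
have fq : Num.floor q.1 = i by apply/floor_def/andP; split; [exact: ltW|rewrite intrD].
rewrite /inside fq count_edge //; first by case: (_ < _); rewrite ?addn1 ?addn0.
by apply/andP; split; lra.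
Qed.

End Regions.

(** * Crossings that are not of type I or II *)

Lemma mix_gt0 (R : realFieldType) (t a b : R) : 0 <= t <= 1 -> 0 < a -> 0 < b ->
  0 < (1 - t) * a + t * b.
Proof.
move=> /andP[t0 t1] a0 b0; have [->|tn] := eqVneq t 0; first by rewrite subr0 mul1r mul0r addr0.
have tp : 0 < t by rewrite lt_neqAle eq_sym tn.
by rewrite ltr_wpDl // ?mulr_gt0 // mulr_ge0 ?subr_ge0 // ltW.
Qed.

Section Corners.
Variable R : realType.
Variables ys os zs : seq int.
Hypothesis ok : grid_ok ys os zs.
Variables (cells : seq (int * nat)) (top : bool).
Hypothesis lok : lab_ok ys cells top.
Variables (j j' : nat) (fwd : bool).
Hypothesis (j52 : (j < 52)%N) (j'52 : (j' < 52)%N) (jj' : meet ys j j').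
Hypothesis sep : separated ys cells top j fwd.

Local Notation r := (@rint R).
Local Notation gcurve := (@gcurve R ys).
Local Notation inside := (@inside R ys cells top).
Local Notation gpt := (@gpt R ys).
Local Notation px := (@px R).
Local Notation py := (@py R ys).

(** The label on both sides of the branch through the vertex [j], before and after
    it. *)
Definition side (s : R) : bool := if fwd then 0 < s else s < 0.

Lemma straight_j : straight ys j.
Proof. by case: (grid_meetP ok j52 j'52 jj') => [[]]. Qed.

Lemma near_branch (s : R) : 0 < `|s| < 1 ->
  \forall q \near ((px (j%:R + s), py (j%:R + s)) : R * R), inside q = side s.
Proof.
have /and3P[j0 _ _] := straight_j.
have e1 e (a : R) : (e < 52)%N -> 0 < a < 1 ->
    ((px (e%:R + a), py (e%:R + a)) : R * R) = (r (gcol e) + frac e a, edgeY ys e (frac e a)).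
  move=> e52 /andP[a0 a1]; have a01 : 0 <= a <= 1 by rewrite !ltW.
  by rewrite (px_frac ok) // (py_frac ok).
case/and4P: sep => s1 s2 /negbTE s3 /negbTE s4.
have [s0|s0|s0] := ltgtP 0 s; last by rewrite -s0 normr0 ltxx.
  rewrite gtr0_norm // => s01; rewrite e1 // /side s0 ltNge (ltW s0) /=.
  have fr := frac_open j s01.
  by case: (fwd) s1 s2 s3 s4 => s1 s2 s3 s4; exact: (near_edge ok).
rewrite ltr0_norm // => s01; rewrite /side s0 ltNge (ltW s0) /=.
have jE : j%:R + s = j.-1%:R + (1 + s) by rewrite -{1}(prednK j0) -natr1; ring.
have s01' : 0 < 1 + s < 1 by move/andP: s01 => [? ?]; apply/andP; split; lra.
have j52' : (j.-1 < 52)%N by rewrite (leq_ltn_trans (leq_pred _)).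
rewrite jE e1 //; have fr := frac_open j.-1 s01'.
by case: (fwd) s1 s2 s3 s4 => s1 s2 s3 s4; exact: (near_edge ok).
Qed.

Let c0 : R * R := circle_pt (r (gx j) / 17).
(** A local inverse of the covering near the crossing. *)
Definition section (p : Apt R) : R * R := (r (gx j) + 17 * angle c0 p.1, 6 * p.2).

Lemma gpt_cov : gpt j = cov (r (gx j), r (gy ys j)).
Proof.
rewrite /gpt /gcurve /cov (mulrC 52) divfK // -[j%:R]addr0 (pxE) // ?(pyE ok) //;
  rewrite ?lexx ?ler01 //.
by rewrite !mul0r !addr0.
Qed.

Lemma section_cov (q : R * R) : `|q.1 - r (gx j)| < 17 / 4 -> section (cov q) = q.
Proof.
move=> h; rewrite /section /cov.
have qE : q.1 / 17 = r (gx j) / 17 + (q.1 - r (gx j)) / 17 :> R by field.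
rewrite [(_, _).1]/= [(_, _).2]/= qE /c0 angleE {qE}; first by case: q h => a b /= _; congr (_, _); field.
by rewrite normrM normfV (gtr0_norm (ltr0n _ 17)) ltr_pdivrMr ?ltr0n //; lra.
Qed.

Lemma cov_section (p : Apt R) : circle p.1 -> 0 < dot c0 p.1 -> cov (section p) = p.
Proof.
move=> Cp p0; have [_ e] := angleP Cp p0.
rewrite /cov /section /= (_ : (_ + _) / 17 = r (gx j) / 17 + angle c0 p.1); last by field.
by rewrite e; case: (p) => a b /=; congr (_, _); field.
Qed.

Lemma cts_section (T : topologicalType) (A : set T) (f : T -> Apt R) :
  cts A f -> (forall x, A x -> 0 < dot c0 (f x).1) -> cts A (fun x => section (f x)).
Proof.
move=> cf h; have ca : cts A (fun x => angle c0 (f x).1).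
  by apply: cts_angle => //; [exact: cts_cst|exact: cts_fst].
by rewrite /section; cts_tac.
Qed.

Section Axis.
Variables (K : R * R -> Apt R) (eps : R).
Hypothesis cK : cts (@square R) K.
Hypothesis circK : forall z, square z -> circle (K z).1.
Hypothesis K0 : K (0, 0) = gpt j.
Hypothesis offK : forall z, square z -> z.1 != 0 -> z.2 != 0 -> ~ curves_set gcurve (K z).
Hypothesis eps0 : 0 < eps.
Hypothesis axK : forall s : R, -1 < s < 1 -> K (s, 0) = gcurve ord0 (j%:R / 52 + eps * s).

(** Along an axis of a chart, the labels of the two adjacent quadrants are the
    label next to the branch of the curve which is that half-axis. *)
Lemma quadrant_side : exists2 rho : R, 0 < rho & forall z : R * R,
  0 < `|z.1| < rho -> 0 < `|z.2| < rho -> inside (section (K z)) = side z.1.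
Proof.
have sqP (z : R * R) : square z <-> (`|z.1| < 1 /\ `|z.2| < 1).
  by rewrite /square !ltr_norml; split; case; rewrite /= !in_itv.
have S0 : square ((0, 0) : R * R) by apply/sqP; rewrite /= normr0.
have [rho [rho0 rho1 dotK]] : exists rho : R, [/\ 0 < rho, rho <= 1 &
    forall z : R * R, `|z.1| < rho -> `|z.2| < rho -> 0 < dot c0 (K z).1].
  have cd : cts (@square R) (fun z => dot c0 (K z).1).
    by apply: cts_dot; [exact: cts_cst|exact: cts_fst].
  have d0 : 0 < dot c0 (K (0, 0)).1.
    by rewrite K0 gpt_cov /= dot_circle //; exact: circle_pt_circle.
  have n1 : \forall z \near ((0, 0) : R * R), square z -> 0 < dot c0 (K z).1.
    exact: cd _ S0 _ (open_nbhs_nbhs (conj (@open_gt R 0) d0)).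
  have /nbhs_ballP[e /= e0 he] := n1.
  exists (Num.min e 1); split; [by rewrite lt_min e0 ltr01|by rewrite ge_min lexx orbT|].
  move=> z; rewrite !lt_min => /andP[a1 a2] /andP[b1 b2]; apply: he; last exact/sqP.
  by split; rewrite /ball /= sub0r normrN.
have cSK (T : topologicalType) (A : set T) (f : T -> R * R) : cts A f ->
    (forall x, A x -> `|(f x).1| < rho /\ `|(f x).2| < rho) ->
    cts A (fun x => section (K (f x))).
  move=> cf h; apply: cts_section; last by move=> x /h[]; exact: dotK.
  apply: (cts_comp cK) => // x /h[h1 h2]; apply/sqP.
  by rewrite (lt_le_trans h1) // (lt_le_trans h2).
have const (z w : R * R) : 0 < `|z.1| < rho -> 0 < `|z.2| < rho ->
    0 < `|w.1| < rho -> 0 < `|w.2| < rho -> 0 < z.1 * w.1 -> 0 < z.2 * w.2 ->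
    inside (section (K z)) = inside (section (K w)).
  move=> /andP[z10 z1] /andP[z20 z2] /andP[w10 w1] /andP[w20 w2] zw1 zw2.
  pose f (t : R) : R * R := (z.1 + t * (w.1 - z.1), z.2 + t * (w.2 - z.2)).
  have mid (x y t : R) : 0 <= t <= 1 -> `|x| < rho -> `|y| < rho -> 0 < x * y ->
      `|x + t * (y - x)| < rho /\ x + t * (y - x) != 0.
    move=> /andP[t0 t1]; rewrite !ltr_norml => /andP[x1 x2] /andP[y1 y2] xy.
    have -> : x + t * (y - x) = (1 - t) * x + t * y by ring.
    split.
      have := @mix_gt0 R t (rho - x) (rho - y); have := @mix_gt0 R t (rho + x) (rho + y).
      rewrite t0 t1 => h1 h2; have {}h1 := h1 isT; have {}h2 := h2 isT.
      by apply/andP; split; [have := h1|have := h2]; lra.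
    have [x0|x0] := ltP 0 x.
      have y0 : 0 < y by rewrite -(pmulr_rgt0 _ x0).
      by rewrite gt_eqF // mix_gt0 // t0.
    have {}x0 : x < 0 by rewrite lt_neqAle x0 andbT; apply: contraTneq xy => ->; rewrite mul0r ltxx.
    have y0 : y < 0 by rewrite -(nmulr_rgt0 _ x0).
    rewrite lt_eqF // -oppr_gt0 opprD -!mulrN mix_gt0 ?t0 // oppr_gt0 //.
  have f0 : f 0 = z by rewrite /f !mul0r !addr0; case: (z).
  have f1 : f 1 = w by rewrite /f !mul1r !subrKC; case: (w).
  rewrite -f0 -f1; apply: (inside_path ok lok (g := fun t => section (K (f t)))) => //.
    apply: cSK; first by rewrite /f; cts_tac.
    move=> t; rewrite /= in_itv => t01.
    by have [? _] := mid _ _ t t01 z1 w1 zw1; have [? _] := mid _ _ t t01 z2 w2 zw2.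
  move=> t t01; have [m1 m10] := mid _ _ t t01 z1 w1 zw1.
  have [m2 m20] := mid _ _ t t01 z2 w2 zw2.
  have Sf : square (f t) by apply/sqP; rewrite (lt_le_trans m1) // (lt_le_trans m2).
  rewrite cov_section; [exact: offK|exact: circK|exact: dotK].
exists rho => // z z1 z2.
(* A point of the half-axis so near the crossing that it is on the first edge. *)
pose s : R := Num.min (rho / 2) (52 * eps * 2)^-1.
have e52 : 0 < 52 * eps * 2 by rewrite !mulr_gt0.
have s0 : 0 < s by rewrite lt_min divr_gt0 //= invr_gt0.
have srho : s < rho by rewrite gt_min; apply/orP; left; lra.
have seps : 52 * eps * s < 1.
  have : s <= (52 * eps * 2)^-1 by rewrite ge_min lexx orbT.
  rewrite -(ler_pM2r e52) mulVf ?gt_eqF // => h; lra.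
pose sg := Num.sg z.1; have z10 : z.1 != 0 by rewrite -normr_gt0; case/andP: z1.
have sg1 : `|sg| = 1 by rewrite normr_sg z10.
have sgz : 0 < sg * z.1 by rewrite -normrEsg normr_gt0.
pose u := 52 * eps * (sg * s); have u1 : `|u| = 52 * eps * s.
  by rewrite /u !normrM sg1 mul1r (gtr0_norm eps0) (gtr0_norm s0) ger0_norm.
have u01 : 0 < `|u| < 1 by rewrite u1 seps !mulr_gt0.
have us : side u = side z.1.
  have e0 : 0 < 52 * eps * s by rewrite !mulr_gt0.
  rewrite /side /u; have [p|n|e] := ltgtP 0 z.1; last by rewrite -e eqxx in z10.
    by rewrite /sg gtr0_sg // mul1r e0 ltNge (ltW e0).
  by rewrite /sg ltr0_sg // mulN1r mulrN oppr_gt0 oppr_lt0 e0 ltNge (ltW e0).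
have ax1 : -1 < sg * s < 1.
  by rewrite -ltr_norml normrM sg1 mul1r gtr0_norm // (lt_le_trans srho).
have Kx : K (sg * s, 0) = cov (px (j%:R + u), py (j%:R + u)).
  rewrite axK // /gcurve /cov.
  by have -> : 52 * (j%:R / 52 + eps * (sg * s)) = j%:R + u by rewrite /u; field.
have su1 : -1 <= u <= 1 by rewrite -ler_norml ltW //; case/andP: u01.
have [pxu _] := passage ok j52 straight_j su1.
have Sx : section (K (sg * s, 0)) = (px (j%:R + u), py (j%:R + u)).
  rewrite Kx section_cov //= pxu addrC addKr normrM.
  have [[-> | ->] _ _ _] := grid_stepP ok j52; rewrite /r ?intrN ?normrN normr1 mulr1;
    by case/andP: u01 => _ ?; lra.
have nb := near_branch u01; rewrite -Sx in nb.
pose B : set (R * R) := [set w | `|w.1| < rho /\ `|w.2| < rho].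
have B0 : B (sg * s, 0) by rewrite /B /= normrM sg1 mul1r gtr0_norm // normr0.
have cB : cts B (fun w => section (K w)) by apply: cSK => //; exact: cts_id.
have n2 : \forall w \near ((sg * s, 0) : R * R), B w -> inside (section (K w)) = side u.
  exact: cB B0 _ nb.
have /nbhs_ballP[e /= e0 he] := n2.
pose tau := Num.min (rho / 2) (e / 2); have tau0 : 0 < tau by rewrite lt_min !divr_gt0.
have taue : tau < e by rewrite gt_min; apply/orP; right; lra.
have taur : tau < rho by rewrite gt_min; apply/orP; left; lra.
pose sh := Num.sg z.2; have z20 : z.2 != 0 by rewrite -normr_gt0; case/andP: z2.
have sh1 : `|sh| = 1 by rewrite normr_sg z20.
have shz : 0 < sh * z.2 by rewrite -normrEsg normr_gt0.
have n3 : `|sh * tau| = tau by rewrite normrM sh1 mul1r gtr0_norm.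
have n4 : `|sg * s| = s by rewrite normrM sg1 mul1r gtr0_norm.
rewrite (const z (sg * s, sh * tau)) //= ?n3 ?n4 ?s0 ?tau0 //.
- rewrite he ?us //; first by split; rewrite /ball /= ?subrr ?normr0 // sub0r normrN n3.
  by rewrite /B /= n3 n4.
- by rewrite mulrA [z.1 * sg]mulrC mulr_gt0.
- by rewrite mulrA [z.2 * sh]mulrC mulr_gt0.
Qed.

End Axis.

(** The two passages in a crossing chart are those at the vertices [j] and [j'],
    in one order or the other. *)
Lemma chart_axis K : crossing_chart gcurve (gpt j) K ->
  exists (sw : bool) (eps : R), 0 < eps /\ forall s : R, -1 < s < 1 ->
    K (if sw then (0, s) else (s, 0)) = gcurve ord0 (j%:R / 52 + eps * s).
Proof.
move=> [_ _ K0 _ [p [q [eps [Pp Pq pq eps0 hK]]]]].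
have z01 : -1 < (0 : R) < 1 by rewrite oppr_lt0 ltr01.
have [] := hK 0 z01; rewrite !mulr0 !addr0 K0 => pj qj.
have [j1 [k1 [j152 k152 pj1 qk1 jk1]]] := gcurve_double ok Pp Pq pq (etrans (esym pj) qj).
have pE : p.2 = j1%:R / 52 by rewrite -pj1 mulrC mulKf.
have qE : q.2 = k1%:R / 52 by rewrite -qk1 mulrC mulKf.
have [jj1|jj1] := eqVneq j1 j.
  exists false, eps; split=> // s s1; have [-> _] := hK s s1.
  by rewrite (ord1 p.1) pE jj1.
exists true, eps; split=> // s s1; have [_ ->] := hK s s1.
have m : meet ys j1 j.
  by apply: (@meetP R _ _ _ ok _ _ j152 j52 jj1); rewrite pj -(gptE ys pj1) (ord1 p.1).
have [_ uni] := grid_meetP ok j152 k152 jk1.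
by rewrite (ord1 q.1) qE (uni j j52 m).
Qed.

(** In any chart, the two corners along one half of the separated branch are
    labelled true and those along its other half false, and opposite corners lie
    along different halves. *)
Lemma opposite_corners K (a b : R) : crossing_chart gcurve (gpt j) K ->
  a = 1 \/ a = -1 -> b = 1 \/ b = -1 -> exists2 rho : R, 0 < rho &
  forall z w : R * R, 0 < a * z.1 < rho -> 0 < b * z.2 < rho ->
    0 < - a * w.1 < rho -> 0 < - b * w.2 < rho ->
    inside (section (K z)) != inside (section (K w)).
Proof.
move=> cc; have [sw [eps [eps0 hax]]] := chart_axis cc.
have [[g [cK cg KP gP]] [W oW KO] K0 Kax _] := cc.
have circK z : square z -> circle (K z).1.
  move=> Sz; have : (K @` (@square R)) (K z) by exists z.
  by rewrite KO => -[_ []].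
have offK z : square z -> z.1 != 0 -> z.2 != 0 -> ~ curves_set gcurve (K z).
  move=> Sz z1 z2 cz; have : (curves_set gcurve `&` K @` @square R) (K z) by split=> //; exists z.
  rewrite Kax => -[w [Sw w0] wz].
  have wE : w = z by have [_ <-] := KP w Sw; rewrite wz; have [_ ->] := KP z Sz.
  by move: w0; rewrite wE => -[] /eqP; [rewrite (negbTE z1)|rewrite (negbTE z2)].
pose K' z := K (if sw then (z.2, z.1) else z).
have sqs (z : R * R) : square z -> square (if sw then (z.2, z.1) else z).
  by case: sw {hax K'} => // -[].
have [rho rho0 hr] : exists2 rho : R, 0 < rho & forall z : R * R,
    0 < `|z.1| < rho -> 0 < `|z.2| < rho -> inside (section (K' z)) = side z.1.
  apply: (@quadrant_side K' eps).
  - apply: (@cts_comp _ _ _ _ (@square R) K) => //; first exact/ctsP.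
    by case: (sw); cts_tac.
  - by move=> z Sz; apply: circK; exact: sqs.
  - by rewrite /K'; case: (sw).
  - by move=> z Sz z1 z2; apply: offK; [exact: sqs|case: (sw)|case: (sw)].
  - exact: eps0.
  - by move=> s s1; rewrite -hax // /K'; case: (sw).
move=> ea eb; exists rho => // z w z1 z2 w1 w2.
have nrm (c x : R) : c = 1 \/ c = -1 -> 0 < c * x < rho -> 0 < `|x| < rho.
  move=> ec /andP[h1 h2]; have -> : `|x| = c * x; last by rewrite h1.
  by case: ec h1 => -> h1; rewrite ?mulN1r ?mul1r in h1 *;
    [rewrite gtr0_norm|rewrite ltr0_norm // -oppr_gt0].
have eNa : - a = 1 \/ - a = -1 by case: ea => ->; rewrite ?opprK; auto.
have eNb : - b = 1 \/ - b = -1 by case: eb => ->; rewrite ?opprK; auto.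
have sid (c x y : R) : c = 1 \/ c = -1 -> 0 < c * x < rho -> 0 < - c * y < rho ->
    side x != side y.
  move=> ec /andP[x0 _] /andP[y0 _]; rewrite /side.
  have xy (u v : R) : 0 < u -> v < 0 ->
      (if fwd then 0 < u else u < 0) != (if fwd then 0 < v else v < 0).
    by move=> u0 v0; case: (fwd); [rewrite u0 (lt_gtF v0)|rewrite v0 (lt_gtF u0)].
  case: ec x0 y0 => ->; rewrite ?opprK ?mul1r ?mulN1r ?oppr_gt0 => x0 y0; first exact: xy.
  by rewrite eq_sym; exact: xy.
have e : K z = K' (if sw then (z.2, z.1) else z) by rewrite /K'; case: (sw) => //; case: (z).
have e' : K w = K' (if sw then (w.2, w.1) else w) by rewrite /K'; case: (sw) => //; case: (w).
rewrite e e' !hr; case: (sw) => /=; try exact: nrm ea _; try exact: nrm eb _;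
  try exact: nrm eNa _; try exact: nrm eNb _; [exact: sid eb _ _|exact: sid ea _ _].
Qed.

Variable D : diagram R.
Hypothesis DE : D = gdiagram R ok.

(** Near the crossing a lift of the path is its image under the local inverse of
    the covering, so its label is that of the corner where the path is. *)
Lemma passage_sides (alpha : R -> Apt R) (lift : R -> R * R) (t0 eta : R) :
  0 < eta -> cts (`[t0 - eta, t0 + eta] : set R) alpha ->
  cts (`[t0 - eta, t0 + eta] : set R) lift ->
  (forall t, t0 - eta <= t <= t0 + eta -> cov (lift t) = alpha t) ->
  lift t0 = (r (gx j), r (gy ys j)) ->
  passes_to_opposite_corner D (gpt j) alpha t0 ->
  exists2 u1 : R, 0 < u1 & forall u, 0 < u < u1 ->
    inside (lift (t0 + u)) != inside (lift (t0 - u)).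
Proof.
rewrite DE => eta0 ca cl cov_l l0 [at0 [K [a [b [d [cc ea eb d0 pc]]]]]].
have [rho rho0 hr] := opposite_corners cc ea eb.
have [[g [cK /ctsP cg KP gP]] _ K0 _ _] := cc.
pose d' := Num.min (eta / 2) (d / 2).
have d'0 : 0 < d' by rewrite lt_min !divr_gt0.
have d'e : d' < eta by rewrite gt_min; apply/orP; left; lra.
have d'd : d' < d by rewrite gt_min; apply/orP; right; lra.
have S0 : square ((0, 0) : R * R) by split; rewrite /= in_itv /= oppr_lt0 ltr01.
pose I : set R := [set t | `|t - t0| <= d'].
have inI t : I t -> t0 - eta <= t <= t0 + eta.
  by rewrite /I /= ler_norml => /andP[? ?]; apply/andP; split; lra.
have subI : I `<=` `[t0 - eta, t0 + eta]%classic by move=> t /inI; rewrite /= in_itv.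
have aK t : I t -> (K @` @square R) (alpha t).
  rewrite /I /= ler_norml => /andP[t1 t2]; have [tt|tt|tt] := ltgtP t t0.
  - have [] := pc (t0 - t); first by apply/andP; split; lra.
    by rewrite subKr => _ [z [Sz _] zE]; exists z.
  - have [] := pc (t - t0); first by apply/andP; split; lra.
    by rewrite addrC subrK => -[z [Sz _] zE] _; exists z.
  - by exists (0, 0) => //; rewrite tt at0 K0.
have cga : cts I (fun t => g (alpha t)).
  by apply: (cts_comp cg) => //; exact: cts_subset ca.
have I0 : I t0 by rewrite /I /= subrr normr0 ltW.
have ga0 : g (alpha t0) = (0, 0) by rewrite at0 -K0; have [_] := KP _ S0.
have n1 : \forall t \near t0, I t -> ball (g (alpha t0)) rho (g (alpha t)).
  exact: cga t0 I0 _ (nbhsx_ballx _ _ rho0).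
have b0 : 0 < 17 / 4 :> R by lra.
have n2 : \forall t \near t0, `[t0 - eta, t0 + eta]%classic t ->
    ball (lift t0) (17 / 4) (lift t).
  exact: cl t0 (subI _ I0) _ (nbhsx_ballx _ _ b0).
have [e /= e0 he] := (nbhs_ballP (t0 : R) _).1 (filterI n1 n2).
exists (Num.min e d') => [|u]; first by rewrite lt_min e0.
rewrite lt_min => /andP[u0 /andP[ue ud]].
have bp : ball t0 e (t0 + u) by rewrite /ball /= opprD addrA subrr sub0r normrN gtr0_norm.
have bm : ball t0 e (t0 - u) by rewrite /ball /= subKr gtr0_norm.
have Ip : I (t0 + u) by rewrite /I /= addrC addKr gtr0_norm // ltW.
have Im : I (t0 - u) by rewrite /I /= addrC addKr normrN gtr0_norm // ltW.
rewrite ga0 in he; have [h1 h2] := he _ bp; have [h3 h4] := he _ bm.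
have sl t : I t -> ball (lift t0) (17 / 4) (lift t) -> lift t = section (alpha t).
  move=> It [bl _]; rewrite -cov_l; last exact: inI.
  by rewrite section_cov //; move: bl; rewrite /ball /= l0 /= distrC.
rewrite (sl _ Ip (h2 (subI _ Ip))) (sl _ Im (h4 (subI _ Im))).
have ud0 : 0 < u < d by rewrite u0 (lt_trans ud).
have [[z [Sz /= [z1 z2]] zE] [w [Sw /= [w1 w2]] wE]] := pc u ud0.
have gz : g (alpha (t0 + u)) = z by rewrite -zE; have [_] := KP z Sz.
have gw : g (alpha (t0 - u)) = w by rewrite -wE; have [_] := KP w Sw.
have [bz1 bz2] := h1 Ip; have [bw1 bw2] := h3 Im.
rewrite -zE -wE; rewrite gz in bz1 bz2; rewrite gw in bw1 bw2.
have small (c x : R) : c = 1 \/ c = -1 -> ball (0 : R) rho x -> 0 < c * x -> 0 < c * x < rho.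
  rewrite /ball /= sub0r normrN ltr_norml => ec /andP[x1 x2] ->.
  by case: ec => ->; rewrite ?mul1r ?mulN1r //; lra.
have eNa : - a = 1 \/ - a = -1 by case: ea => ->; rewrite ?opprK; auto.
have eNb : - b = 1 \/ - b = -1 by case: eb => ->; rewrite ?opprK; auto.
by apply: hr; apply: small.
Qed.

End Corners.

Lemma compact_disk (R : realType) : compact (@disk R).
Proof.
apply: (@subclosed_compact _ _ ((`[-1, 1] : set R) `*` (`[-1, 1] : set R))).
- rewrite /disk; apply: closed_le_fun; apply: ctsT; cts_tac.
- by apply: compact_setX; exact: segment_compact.
- by move=> [a b]; rewrite /disk /= !in_itv /= => h; split; apply/andP; split; nra.
Qed.

Section CrossingTypes.
Variable R : realType.
Variables ys os zs : seq int.
Hypothesis ok : grid_ok ys os zs.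
Variables (cells : seq (int * nat)) (top : bool).
Hypothesis lok : lab_ok ys cells top.
Variables (j j' : nat) (fwd : bool).
Hypothesis (j52 : (j < 52)%N) (j'52 : (j' < 52)%N) (jj' : meet ys j j').
Hypothesis sep : separated ys cells top j fwd.

Local Notation r := (@rint R).
Local Notation inside := (@inside R ys cells top).
Local Notation D := (gdiagram R ok).

(** The lift of a map to the circle is unique up to an integer, which is chosen so
    that the lift of [x] is the lifted vertex [j]. *)
Lemma lift_at (T : topologicalType) (K : set T) (phi : T -> R) (f : T -> Apt R) x :
  K x -> (forall y, K y -> circle_pt (phi y) = (f y).1) -> f x = gpt R ys j ->
  exists n : int, (forall y, K y -> cov (17 * (phi y + n%:~R), 6 * (f y).2) = f y) /\
    (17 * (phi x + n%:~R), 6 * (f x).2) = (r (gx j), r (gy ys j)).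
Proof.
move=> Kx hphi; rewrite (@gpt_cov R _ _ _ ok _ j52) => fx.
have := hphi x Kx; rewrite fx /cov [in RHS]/= => /circle_pt_eq[n pn].
exists n; split=> [y Ky|]; last by rewrite -pn /=; congr (_, _); field.
rewrite /cov [(_, _).1]/= (_ : _ / 17 = phi y + n%:~R); last by field.
by rewrite circle_ptDz hphi //; case: (f y) => a b /=; congr (_, _); field.
Qed.

(** Lifted to the universal cover, the boundary of a disk is still a closed
    curve; but it leaves a separated crossing on another side than it came from. *)
Theorem not_type_I : ~ type_I D (gpt R ys j).
Proof.
move=> [_ [delta [[dsub [g [/ctsP cd _ dK _]]] dcap [t0 pass]]]].
have cdisk (t : R) : disk (circle_pt t) by rewrite /disk /= (circle_pt_circle t).
have [phi cphi hphi] : exists2 phi : R * R -> R, cts disk phi &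
    forall x, disk x -> circle_pt (phi x) = (delta x).1.
  apply: (circle_lift (K := disk) (sc := fun t x => (t * x.1, t * x.2)) (x0 := (0, 0))).
  - exact: compact_disk.
  - by cts_tac.
  - move=> t x /andP[t0' t1]; rewrite /disk /= !exprMn -mulrDr => x1.
    by rewrite mulr_ile1 ?addr_ge0 ?sqr_ge0 // expr_le1.
  - by move=> [a b] _ /=; rewrite !mul1r.
  - by move=> [a b] _ /=; rewrite !mul0r.
  - exact: cts_fst.
  - by move=> x xd; have [] : annulus (delta x) by apply: dsub; exists x.
have [at0 _] := pass.
have [n [covl l0]] := lift_at (cdisk t0) hphi at0.
pose lift (t : R) : R * R := (17 * (phi (circle_pt t) + n%:~R), 6 * (delta (circle_pt t)).2).
have cl (A : set R) : cts A lift.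
  have cc : cts A (@circle_pt R) by apply: cts_cont; exact: circle_pt_continuous.
  have c1 : cts A (fun t => phi (circle_pt t)) by apply: (cts_comp cphi cc).
  have c2 : cts A (fun t => delta (circle_pt t)) by apply: (cts_comp cd cc).
  by rewrite /lift; cts_tac.
have cal (A : set R) : cts A (delta \o @circle_pt R).
  by apply: (cts_comp cd) => //; apply: cts_cont; exact: circle_pt_continuous.
have [|u1 u10 hu] := @passage_sides R ys os zs ok cells top lok j j' fwd j52 j'52 jj' sep
  D erefl _ lift t0 1 ltr01 (cal _) (cl _) _ l0 pass; first by move=> t _; exact: covl.
pose u := Num.min (u1 / 2) (1 / 4 : R).
have u0 : 0 < u by rewrite lt_min !divr_gt0.
have uu : u < u1 by rewrite gt_min; apply/orP; left; lra.
have u4 : u <= 1 / 4 by rewrite ge_min lexx orbT.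
have /negP[] : inside (lift (t0 + u)) != inside (lift (t0 - u)) by apply: hu; rewrite u0.
have lE : lift (t0 - u) = lift (t0 + 1 - u) by rewrite /lift addrAC circle_ptD1.
rewrite lE; apply/eqP; apply: (inside_path ok lok _ (cl _)); first by lra.
move=> t /andP[t1 t2]; rewrite covl // => tD.
have : [set gpt R ys j] (delta (circle_pt t)).
  by rewrite -dcap; split=> //; exists (circle_pt t) => //; exact: circle_pt_circle.
rewrite /= -at0 => e; have [_ e1] := dK _ (cdisk t); have [_ e2] := dK _ (cdisk t0).
have /circle_pt_eq[m tm] : circle_pt t = circle_pt t0 by rewrite -e1 e /= e2.
have m0 : m = 0 by apply: (@int0_of_small R); rewrite /rint; apply/andP; split; lra.
by move: tm; rewrite m0 addr0; lra.
Qed.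

Hypothesis inn : inner cells top.

(** The boundary circles lie below and above all edges. *)
Lemma inner_out (X Y : R) : Y = -6 \/ Y = 6 -> inside (X, Y) = false.
Proof.
move=> hY; rewrite /inside /=; set i := Num.floor X; set f := X - _.
have f01 : 0 <= f <= 1.
  by have /andP[] := floor_itv X; rewrite intrD -/i /f => *; apply/andP; split; lra.
case/andP: inn => /negbTE tp /allP hc.
have eb k : k \in idx -> -5 <= @edgeY R ys k f <= 5.
  move=> /idx_lt k52; have /andP[/andP[a1 a2] /andP[b1 b2]] := gy_bounds ok k52.
  have R1 : -5 <= r (gyl ys k) by rewrite -(ler_int R) in a1.
  have R2 : r (gyl ys k) <= 5 by rewrite -(ler_int R) in a2.
  have R3 : -5 <= r (gyr ys k) by rewrite -(ler_int R) in b1.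
  have R4 : r (gyr ys k) <= 5 by rewrite -(ler_int R) in b2.
  by case/andP: f01 => f0 f1; rewrite /edgeY; apply/andP; split; nra.
rewrite labE tp andFb orbF; apply/negP => /hc /andP[/= c0 ct].
case: hY c0 ct => -> c0 ct.
  case/eqP: c0; apply/eqP; rewrite -leqn0 leqNgt -has_count; apply/hasP => -[k kI].
  by have /andP[? _] := eb k kI; case/andP => _; lra.
case/eqP: ct; apply: eq_in_count => k kI.
by have /andP[_ ?] := eb k kI; rewrite (_ : _ < 6) ?andbT //; lra.
Qed.

(** An arc through the crossing which joins the two boundary circles starts and
    ends at label false, so it would have this label on both sides. *)
Theorem not_type_II : ~ type_II D (gpt R ys j).
Proof.
move=> [_ [alpha [[dsub [g [/ctsP cd _ dK _]]] [am ap] _ dcap [t0 /andP[t0m t0p] pass]]]].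
pose I : set R := `[-1, 1]%classic.
have II t : I t <-> -1 <= t <= 1 by rewrite /I /= in_itv.
have [phi cphi hphi] : exists2 phi : R -> R, cts I phi &
    forall x, I x -> circle_pt (phi x) = (alpha x).1.
  apply: (circle_lift (K := I) (sc := fun t x => t * x) (x0 := 0)).
  - exact: segment_compact.
  - by cts_tac.
  - by move=> t x /andP[h1 h2] /II/andP[h3 h4]; apply/II/andP; split; nra.
  - by move=> x _; rewrite mul1r.
  - by move=> x _; rewrite mul0r.
  - exact: cts_fst.
  - by move=> x xd; have [] : annulus (alpha x) by apply: dsub; exists x.
have [at0 _] := pass.
have It0 : I t0 by apply/II; rewrite !ltW.
have [n [covl l0]] := lift_at It0 hphi at0.
pose lift (t : R) : R * R := (17 * (phi t + n%:~R), 6 * (alpha t).2).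
have cl : cts I lift by rewrite /lift; cts_tac.
pose eta := Num.min (1 - t0) (t0 + 1).
have eta0 : 0 < eta by rewrite lt_min; apply/andP; split; lra.
have eta1 : eta <= 1 - t0 by rewrite ge_min lexx.
have eta2 : eta <= t0 + 1 by rewrite ge_min lexx orbT.
have sub (a b : R) : -1 <= a -> b <= 1 -> (`[a, b] : set R) `<=` I.
  by move=> ha hb t; rewrite /= in_itv /= => /andP[? ?]; apply/II/andP; split; lra.
have subE : (`[t0 - eta, t0 + eta] : set R) `<=` I by apply: sub; lra.
have [|u1 u10 hu] := @passage_sides R ys os zs ok cells top lok j j' fwd j52 j'52 jj' sep
    D erefl _ lift t0 eta eta0 (cts_subset subE cd) (cts_subset subE cl) _ l0 pass.
  by move=> t tI; apply: covl; apply: subE; rewrite /= in_itv.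
pose u := Num.min (u1 / 2) (eta / 2 : R).
have u0 : 0 < u by rewrite lt_min !divr_gt0.
have uu : u < u1 by rewrite gt_min; apply/orP; left; lra.
have u4 : u <= eta / 2 by rewrite ge_min lexx orbT.
have : inside (lift (t0 + u)) != inside (lift (t0 - u)) by apply: hu; rewrite u0.
have off t : I t -> t != t0 -> ~ curves_set (@gcurve R ys) (cov (lift t)).
  move=> It tt; rewrite covl // => tD.
  have : [set gpt R ys j] (alpha t) by rewrite -dcap; split=> //; exists t.
  rewrite /= -at0 => e; have [_ e1] := dK _ It; have [_ e2] := dK _ It0.
  by case/eqP: tt; rewrite -e1 e e2.
have -> : inside (lift (t0 - u)) = false.
  have <- : inside (lift (-1)) = false by apply: inner_out; rewrite am; left; ring.
  apply/esym/(inside_path ok lok); [lra|apply: cts_subset cl; apply: sub; lra|].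
  move=> t /andP[t1 t2]; apply: off; first by apply/II/andP; split; lra.
  by rewrite lt_eqF //; lra.
have -> : inside (lift (t0 + u)) = false; last by [].
have <- : inside (lift 1) = false by apply: inner_out; rewrite ap; right; ring.
apply: (inside_path ok lok); [lra|apply: cts_subset cl; apply: sub; lra|].
move=> t /andP[t1 t2]; apply: off; first by apply/II/andP; split; lra.
by rewrite gt_eqF //; lra.
Qed.

End CrossingTypes.

Section Examples.
Variable R : realType.

(** The diagrams with three and with four crossings. *)
Definition diagram3 : diagram R := gdiagram R grid_ok1.
Definition diagram4 : diagram R := gdiagram R grid_ok2.

Lemma crossings3 : crossings diagram3 = 3%N.
Proof. by rewrite /crossings [dcross _]/(gcross _ _ _) size_map; vm_compute. Qed.
Lemma crossings4 : crossings diagram4 = 4%N.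
Proof. by rewrite /crossings [dcross _]/(gcross _ _ _) size_map; vm_compute. Qed.

Lemma crossing3 c : c \in gcross R ys1 os1 -> [\/ c = gpt R ys1 9, c = gpt R ys1 11 | c = gpt R ys1 23].
Proof.
move=> /gcrossE[j [j52 gj ->]].
have : all (fun j => (go os1 j == 1) ==> has (fun k => (j == k) || meet ys1 j k) [:: 9; 11; 23]%N) idx.
  by vm_compute.
move=> /allP/(_ j (idxP j52)); rewrite gj eqxx implyTb => /hasP[k].
have E (l : nat) : (l < 52)%N -> (j == l) || meet ys1 j l -> gpt R ys1 j = gpt R ys1 l.
  by move=> l52 /orP[/eqP -> //|]; exact: (meet_gpt R grid_ok1).
by rewrite !inE => /or3P[] /eqP -> /E e; [constructor 1|constructor 2|constructor 3]; exact: e.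
Qed.

Lemma crossing4 c : c \in gcross R ys2 os2 ->
  [\/ c = gpt R ys2 7, c = gpt R ys2 44, c = gpt R ys2 42 | c = gpt R ys2 29].
Proof.
move=> /gcrossE[j [j52 gj ->]].
have : all (fun j => (go os2 j == 1) ==> has (fun k => (j == k) || meet ys2 j k) [:: 7; 44; 42; 29]%N) idx.
  by vm_compute.
move=> /allP/(_ j (idxP j52)); rewrite gj eqxx implyTb => /hasP[k].
have E (l : nat) : (l < 52)%N -> (j == l) || meet ys2 j l -> gpt R ys2 j = gpt R ys2 l.
  by move=> l52 /orP[/eqP -> //|]; exact: (meet_gpt R grid_ok2).
by rewrite !inE => /or4P[] /eqP -> /E e;
  [constructor 1|constructor 2|constructor 3|constructor 4]; exact: e.
Qed.

Lemma dcross3 : dcross diagram3 = gcross R ys1 os1. Proof. by []. Qed.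
Lemma dcross4 : dcross diagram4 = gcross R ys2 os2. Proof. by []. Qed.

Lemma quasi_simple3 : quasi_simple_diagram diagram3.
Proof.
have [/and3P[s1 s2 s3] /and4P[i1 i2 _ _]] := (separated1, inner_cells).
have m1 : meet ys1 9 44 by vm_compute. have m2 : meet ys1 11 42 by vm_compute.
have m3 : meet ys1 23 40 by vm_compute.
split=> [c tI|c c' tII _].
  have := tI.1; rewrite dcross3 => /crossing3[] e; rewrite e in tI; move: tI.
  - exact (not_type_I lab_ok1a (isT : 9 < 52)%N (isT : 44 < 52)%N m1 s1).
  - exact (not_type_I lab_ok1a (isT : 11 < 52)%N (isT : 42 < 52)%N m2 s2).
  - exact (not_type_I lab_ok1b (isT : 23 < 52)%N (isT : 40 < 52)%N m3 s3).
exfalso; have := tII.1; rewrite dcross3 => /crossing3[] e; rewrite e in tII; move: tII.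
- exact (not_type_II lab_ok1a (isT : 9 < 52)%N (isT : 44 < 52)%N m1 s1 i1).
- exact (not_type_II lab_ok1a (isT : 11 < 52)%N (isT : 42 < 52)%N m2 s2 i1).
- exact (not_type_II lab_ok1b (isT : 23 < 52)%N (isT : 40 < 52)%N m3 s3 i2).
Qed.

(** The union of regions which separates the crossing at the vertex 29 contains
    the upper outer region, so it does not exclude type II. *)
Lemma quasi_simple4 : quasi_simple_diagram diagram4.
Proof.
have [/and4P[s1 s2 s3 s4] /and4P[_ _ i1 i2]] := (separated2, inner_cells).
have m1 : meet ys2 7 21 by vm_compute. have m2 : meet ys2 44 9 by vm_compute.
have m3 : meet ys2 42 11 by vm_compute. have m4 : meet ys2 29 50 by vm_compute.
have II c : type_II diagram4 c -> c = gpt R ys2 29.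
  move=> tII; have := tII.1; rewrite dcross4 => /crossing4[] e; last exact e;
    exfalso; rewrite e in tII; move: tII.
  - exact (not_type_II lab_ok2a (isT : 7 < 52)%N (isT : 21 < 52)%N m1 s1 i1).
  - exact (not_type_II lab_ok2b (isT : 44 < 52)%N (isT : 9 < 52)%N m2 s2 i2).
  - exact (not_type_II lab_ok2b (isT : 42 < 52)%N (isT : 11 < 52)%N m3 s3 i2).
split=> [c tI|c c' tc tc']; last exact (etrans (II c tc) (esym (II c' tc'))).
have := tI.1; rewrite dcross4 => /crossing4[] e; rewrite e in tI; move: tI.
- exact (not_type_I lab_ok2a (isT : 7 < 52)%N (isT : 21 < 52)%N m1 s1).
- exact (not_type_I lab_ok2b (isT : 44 < 52)%N (isT : 9 < 52)%N m2 s2).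
- exact (not_type_I lab_ok2b (isT : 42 < 52)%N (isT : 11 < 52)%N m3 s3).
- exact (not_type_I lab_ok2c (isT : 29 < 52)%N (isT : 50 < 52)%N m4 s4).
Qed.

End Examples.

(** * Isotopies *)

Section Isotopies.
Variable R : realType.
Implicit Types (H G : R -> Mpt R -> Mpt R).

Definition time_space : set (R * Mpt R) := (`[0, 1] : set R) `*` S1S2.

(** Isotopies with the family of inverses, continuous in time as well, so that
    they can be composed and conjugated. *)
Definition isotopy_pair H G : Prop :=
  [/\ cts time_space (fun p => H p.1 p.2), cts time_space (fun p => G p.1 p.2),
      (forall t x, 0 <= t <= 1 -> S1S2 x -> S1S2 (H t x) /\ G t (H t x) = x),
      (forall t x, 0 <= t <= 1 -> S1S2 x -> S1S2 (G t x) /\ H t (G t x) = x)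
    & (forall x, S1S2 x -> H 0 x = x)].

Lemma time_spaceE t x : time_space (t, x) <-> 0 <= t <= 1 /\ S1S2 x.
Proof. by rewrite /time_space /setX /= in_itv. Qed.

Lemma isotopy_pair_ambient H G : isotopy_pair H G -> ambient_isotopy H.
Proof.
move=> [cH cG HP GP H0]; split; [exact ((ctsP _ _).1 cH)|exact H0|].
move=> t t01; apply/homeo_mutual; exists (G t).
have slice (K : R -> Mpt R -> Mpt R) : cts time_space (fun p => K p.1 p.2) -> cts S1S2 (K t).
  move=> cK; apply: (cts_comp cK (f := fun x => (t, x))); first by cts_tac.
  by move=> x Sx; apply/time_spaceE.
by split; [exact: slice|exact: slice|move=> x; exact: HP|move=> x; exact: GP].
Qed.

Lemma isotopy_pair_comp H G H' G' : isotopy_pair H G -> isotopy_pair H' G' ->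
  isotopy_pair (fun t => H' t \o H t) (fun t => G t \o G' t).
Proof.
move=> [cH cG HP GP H0] [cH' cG' HP' GP' H'0].
have comp (K L : R -> Mpt R -> Mpt R) : cts time_space (fun p => K p.1 p.2) -> cts time_space (fun p => L p.1 p.2) ->
    (forall t x, 0 <= t <= 1 -> S1S2 x -> S1S2 (L t x)) ->
    cts time_space (fun p => K p.1 (L p.1 p.2)).
  move=> cK cL LP; apply: (cts_comp cK (f := fun p => (p.1, L p.1 p.2))).
    by apply: cts_pair => //; cts_tac.
  by move=> [t x] /time_spaceE[t01 Sx]; apply/time_spaceE; split=> //; exact: LP.
split.
- apply: (comp H' H) => // t x t01 Sx; by have [] := HP t x t01 Sx.
- apply: (comp G G') => // t x t01 Sx; by have [] := GP' t x t01 Sx.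
- move=> t x t01 Sx /=; have [S1 e1] := HP t x t01 Sx.
  by have [S2 ->] := HP' t _ t01 S1.
- move=> t x t01 Sx /=; have [S1 e1] := GP' t x t01 Sx.
  by have [S2 ->] := GP t _ t01 S1.
- by move=> x Sx /=; rewrite H0 // H'0.
Qed.

Lemma isotopy_pair_conj E E' H G : mutual S1S2 S1S2 E E' -> isotopy_pair H G ->
  isotopy_pair (fun t => E \o H t \o E') (fun t => E \o G t \o E').
Proof.
move=> [cE cE' EP E'P] [cH cG HP GP H0].
have comp (K : R -> Mpt R -> Mpt R) : cts time_space (fun p => K p.1 p.2) ->
    (forall t x, 0 <= t <= 1 -> S1S2 x -> S1S2 (K t x)) ->
    cts time_space (fun p => (E \o K p.1 \o E') p.2).
  move=> cK KP.
  have c1 : cts time_space (fun p : R * Mpt R => E' p.2).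
    by apply: (cts_comp cE'); [cts_tac|move=> [t x] /time_spaceE[]].
  have c2 : cts time_space (fun p => K p.1 (E' p.2)).
    apply: (cts_comp cK (f := fun p => (p.1, E' p.2))); first by cts_tac.
    by move=> [t x] /time_spaceE[t01 Sx]; apply/time_spaceE; split=> //; case: (E'P x Sx).
  apply: (cts_comp cE c2) => -[t x] /time_spaceE[t01 Sx]; apply: KP => //.
  by case: (E'P x Sx).
split.
- by apply: (comp H) => // t x t01 Sx; case: (HP t x t01 Sx).
- by apply: (comp G) => // t x t01 Sx; case: (GP t x t01 Sx).
- move=> t x t01 Sx /=; have [S1 e1] := E'P x Sx; have [S2 e2] := HP t _ t01 S1.
  by have [S3 e3] := EP _ S2; rewrite e3 e2 e1.
- move=> t x t01 Sx /=; have [S1 e1] := E'P x Sx; have [S2 e2] := GP t _ t01 S1.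
  by have [S3 e3] := EP _ S2; rewrite e3 e2 e1.
- by move=> x Sx /=; have [S1 e1] := E'P x Sx; rewrite H0.
Qed.

End Isotopies.

Section Wheel.
Variable R : realType.
Local Notation r := (@rint R).
Implicit Types (s : seq int) (c : R * R).

(** A section of [circle_pt], which need not be continuous. *)
Definition turn c : R := xget 0 [set x | circle_pt x = c].

Lemma turnK c : circle c -> circle_pt (turn c) = c.
Proof.
by move=> /circle_pt_surj[x xc]; rewrite /turn; case: xgetP => [y -> //|/(_ x)].
Qed.

(** Functions on the circle which interpolate a list of 17 integers. *)
Definition wheel_at s (u : R) : R := interp (fun n => r (ext 17 0 s n)) u.
Definition wheel s c : R := wheel_at s (17 * turn c).

Lemma wheel_at_period s u (n : int) : wheel_at s (u + 17 * n%:~R) = wheel_at s u.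
Proof.
have -> : 17 * n%:~R = (n * 17)%:~R :> R by rewrite intrM mulrC.
rewrite /wheel_at (@interp_period _ _ _ 0) ?addr0 // => m.
by rewrite addr0 addrC extM // mul0r addr0.
Qed.

(** By periodicity, the choice of the section is irrelevant. *)
Lemma wheelE s (t : R) : wheel s (circle_pt (t / 17)) = wheel_at s t.
Proof.
have /circle_pt_eq[n e] := turnK (circle_pt_circle (t / 17)).
rewrite /wheel -(wheel_at_period _ _ n); congr wheel_at.
by rewrite -mulrDr -e; field.
Qed.

(** Locally, a continuous section is given by the angle. *)
Lemma cts_wheel s (T : topologicalType) (A : set T) (f : T -> R * R) :
  cts A f -> (forall x, A x -> circle (f x)) -> cts A (fun x => wheel s (f x)).
Proof.
move=> cf fA; suff cw : cts circle (wheel s) by exact: (cts_comp cw cf).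
apply: cts_local => c Cc; pose O : set (R * R) := [set d | 0 < dot c d].
exists O; split.
- apply: open_lt_fun; apply: ctsT; first exact: cts_cst.
  by apply: cts_dot; [exact: cts_cst|exact: cts_id].
- by rewrite /O /= dot_circle // ltr01.
have ca : cts (circle `&` O) (fun d => angle c d).
  by apply: cts_angle; [exact: cts_cst|exact: cts_id|move=> d []].
have cg : cts (circle `&` O) (fun d => wheel_at s (17 * (turn c + angle c d))).
  by apply: cts_comp_cont; [exact: interp_continuous|cts_tac].
apply: (cts_eq _ cg) => d [Cd Od] /=; rewrite -wheelE.
rewrite (_ : _ / 17 = turn c + angle c d); last by field.
have := @angleP R (turn c) d Cd; rewrite turnK // => /(_ Od)[_ e].
by rewrite e.
Qed.

Lemma wheel_edge s (i : int) (f : R) : 0 <= f <= 1 ->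
  wheel s (circle_pt ((r i + f) / 17)) =
  r (ext 17 0 s i) + f * (r (ext 17 0 s (i + 1)) - r (ext 17 0 s i)).
Proof. by move=> f01; rewrite wheelE /wheel_at interpE. Qed.

Lemma wheel_ge s (a : int) c : all (fun x => a <= x) (take 17 s) -> (17 <= size s)%N ->
  r a <= wheel s c.
Proof.
move=> h hs; apply: interp_ge => n; rewrite ler_int /ext mul0r addr0.
set k := absz _; have k17 : (k < 17)%N.
  by rewrite /k -ltz_nat gez0_abs ?modz_ge0 // ltz_pmod.
rewrite -(nth_take 0 k17); apply: (allP h); rewrite mem_nth // size_take.
by case: ifP => // _; exact: leq_trans k17 hs.
Qed.

Lemma wheel_le s (a : int) c : all (fun x => x <= a) (take 17 s) -> (17 <= size s)%N ->
  wheel s c <= r a.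
Proof.
move=> h hs; apply: interp_le => n; rewrite ler_int /ext mul0r addr0.
set k := absz _; have k17 : (k < 17)%N.
  by rewrite /k -ltz_nat gez0_abs ?modz_ge0 // ltz_pmod.
rewrite -(nth_take 0 k17); apply: (allP h); rewrite mem_nth // size_take.
by case: ifP => // _; exact: leq_trans k17 hs.
Qed.

End Wheel.

(** * The rotation of the fibres *)

Section Rotation.
Variable R : realType.
Local Notation r := (@rint R).
Implicit Types (v : R * R * R) (w c : R * R) (x : Mpt R).

Definition rotz w v : R * R * R :=
  (w.1 * v.1.1 - w.2 * v.1.2, w.2 * v.1.1 + w.1 * v.1.2, v.2).
Definition rotx w v : R * R * R :=
  (v.1.1, w.1 * v.1.2 - w.2 * v.2, w.2 * v.1.2 + w.1 * v.2).
Definition conj2 w : R * R := (w.1, - w.2).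

Lemma conj2_circle w : circle w -> circle (conj2 w).
Proof. by rewrite /circle /conj2 /= sqrrN. Qed.

Lemma rotz_sphere w v : circle w -> sphere v -> sphere (rotz w v).
Proof.
rewrite /circle /sphere /rotz /= => w1 <-.
by rewrite -[v.1.1 ^+ 2]mul1r -[v.1.2 ^+ 2]mul1r -w1; ring.
Qed.

Lemma rotx_sphere w v : circle w -> sphere v -> sphere (rotx w v).
Proof.
rewrite /circle /sphere /rotx /= => w1 <-.
by rewrite -[v.1.2 ^+ 2]mul1r -[v.2 ^+ 2]mul1r -w1; ring.
Qed.

Lemma rotzK w v : circle w -> rotz (conj2 w) (rotz w v) = v.
Proof.
rewrite /circle /rotz /conj2 /= => w1; case: v => [[a b] c] /=.
congr (_, _, _); first by rewrite -[RHS]mul1r -w1; ring.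
by rewrite -[RHS]mul1r -w1; ring.
Qed.

Lemma rotxK w v : circle w -> rotx (conj2 w) (rotx w v) = v.
Proof.
rewrite /circle /rotx /conj2 /= => w1; case: v => [[a b] c] /=.
congr (_, _, _); first by rewrite -[RHS]mul1r -w1; ring.
by rewrite -[RHS]mul1r -w1; ring.
Qed.

Lemma conj2K w : conj2 (conj2 w) = w.
Proof. by case: w => a b; rewrite /conj2 /= opprK. Qed.

Lemma rotzVK w v : circle w -> rotz w (rotz (conj2 w) v) = v.
Proof. by move=> /conj2_circle/(rotzK v); rewrite conj2K. Qed.

Lemma rotxVK w v : circle w -> rotx w (rotx (conj2 w) v) = v.
Proof. by move=> /conj2_circle/(rotxK v); rewrite conj2K. Qed.

Lemma cts_rotz (T : topologicalType) (A : set T) (f : T -> R * R) (g : T -> R * R * R) :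
  cts A f -> cts A g -> cts A (fun t => rotz (f t) (g t)).
Proof. by move=> cf cg; rewrite /rotz; cts_tac. Qed.

Lemma cts_rotx (T : topologicalType) (A : set T) (f : T -> R * R) (g : T -> R * R * R) :
  cts A f -> cts A g -> cts A (fun t => rotx (f t) (g t)).
Proof. by move=> cf cg; rewrite /rotx; cts_tac. Qed.

Lemma cts_conj2 (T : topologicalType) (A : set T) (f : T -> R * R) :
  cts A f -> cts A (fun t => conj2 (f t)).
Proof. by move=> cf; rewrite /conj2; cts_tac. Qed.

Definition commutator (u w : R * R) v := rotx u (rotz w (rotx (conj2 u) (rotz (conj2 w) v))).
Definition commutator_inv (u w : R * R) v :=
  rotz w (rotx u (rotz (conj2 w) (rotx (conj2 u) v))).

(** At time s, the fibre over X is turned by the commutator of the rotation about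
    the first axis by the angle [pi s f(X)] and of the rotation about the third
    axis that takes the first axis to [w(X)]. On the columns from 0 to 4, where
    there are only two strands, f is 1 and w runs along the upper half circle, from
    (1, 0) to (-1, 0); f returns to 0 from 4 to 5, then w to (1, 0) from 5 to 6,
    and f to 1 from 16 to 17. Both lists are read modulo 17, and [axis_x] holds
    twice the first coordinate of w before normalisation. *)
Definition amount : seq int := [:: 1; 1; 1; 1; 1; 0; 0; 0; 0; 0; 0; 0; 0; 0; 0; 0; 0].
Definition axis_x : seq int := [:: 2; 1; 0; -1; -2; -2; 2; 2; 2; 2; 2; 2; 2; 2; 2; 2; 2].

(** The point of the upper half plane with abscissa [a] on the square
    [|a| + |b| = 2], brought to the circle. *)
Definition normal2 (a : R) : R * R :=
  let b := 2 - `|a| in let n := Num.sqrt (a ^+ 2 + b ^+ 2) in (a / n, b / n).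

Lemma normal2_gt0 (a : R) : 0 < a ^+ 2 + (2 - `|a|) ^+ 2.
Proof.
rewrite lt_neqAle addr_ge0 ?sqr_ge0 // andbT eq_sym paddr_eq0 ?sqr_ge0 //.
apply/negP => /andP[]; rewrite !sqrf_eq0 => /eqP -> /eqP; rewrite normr0; lra.
Qed.

Lemma normal2_circle (a : R) : circle (normal2 a).
Proof.
rewrite /circle /normal2 /= !exprMn exprVn sqr_sqrtr ?ltW ?normal2_gt0 //.
by rewrite -mulrDl divff // gt_eqF // normal2_gt0.
Qed.

Lemma normal2_continuous : continuous normal2.
Proof.
have cn : cts setT (fun a : R => `|a|) by apply: cts_norm; exact: cts_id.
apply: ctsT; have nz (a : R) : Num.sqrt (a ^+ 2 + (2 - `|a|) ^+ 2) != 0.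
  by rewrite gt_eqF // sqrtr_gt0; exact: normal2_gt0.
have ci : cts setT (fun a : R => (Num.sqrt (a ^+ 2 + (2 - `|a|) ^+ 2))^-1).
  by apply: cts_inv => //; cts_tac; exact: cn.
rewrite /normal2 /=; apply: cts_pair; apply: cts_mul => //; cts_tac; exact: cn.
Qed.

Definition tilt_angle (s : R) c : R * R := circle_pt (s * @wheel R amount c / 2).
Definition axis c : R * R := normal2 (@wheel R axis_x c).

Definition turning (s : R) x : Mpt R := (x.1, commutator (tilt_angle s x.1) (axis x.1) x.2).
Definition turning_inv (s : R) x : Mpt R :=
  (x.1, commutator_inv (tilt_angle s x.1) (axis x.1) x.2).

Lemma turning_isotopy : isotopy_pair turning turning_inv.
Proof.
have cu : cts (@time_space R) (fun p => tilt_angle p.1 p.2.1).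
  apply: cts_comp_cont; first exact: circle_pt_continuous.
  have : cts (@time_space R) (fun p => @wheel R amount p.2.1).
    by apply: cts_wheel; [cts_tac|move=> [t x] /time_spaceE[_ []]].
  by move=> cw; cts_tac.
have cw : cts (@time_space R) (fun p => axis p.2.1).
  have cw : cts (@time_space R) (fun p => @wheel R axis_x p.2.1).
    by apply: cts_wheel; [cts_tac|move=> [t x] /time_spaceE[_ []]].
  by apply: (cts_comp_cont normal2_continuous).
have cv : cts (@time_space R) (fun p => p.2.2) by cts_tac.
have Cu (s : R) c : circle (tilt_angle s c) by exact: circle_pt_circle.
have Cw c : circle (axis c) by exact: normal2_circle.
split.
- apply: cts_pair; first by cts_tac.
  by apply: cts_rotx => //; apply: cts_rotz => //; apply: cts_rotx; [exact: cts_conj2|];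
    apply: cts_rotz; [exact: cts_conj2|].
- apply: cts_pair; first by cts_tac.
  by apply: cts_rotz => //; apply: cts_rotx => //; apply: cts_rotz; [exact: cts_conj2|];
    apply: cts_rotx; [exact: cts_conj2|].
- move=> t [c v] _ [Cc Sv]; rewrite /turning /turning_inv /commutator /commutator_inv /=; split.
    by split=> //=; apply: rotx_sphere => //; apply: rotz_sphere => //; apply: rotx_sphere;
      [exact: conj2_circle|apply: rotz_sphere => //; exact: conj2_circle].
  by rewrite rotxK // rotzK // rotxVK // rotzVK.
- move=> t [c v] _ [Cc Sv]; rewrite /turning /turning_inv /commutator /commutator_inv /=; split.
    by split=> //=; apply: rotz_sphere => //; apply: rotx_sphere => //; apply: rotz_sphere;
      [exact: conj2_circle|apply: rotx_sphere => //; exact: conj2_circle].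
  by rewrite rotzK // rotxK // rotzVK // rotxVK.
- move=> [c v] _; rewrite /turning /tilt_angle !mul0r /commutator /=; congr (_, _).
  have e : circle_pt 0 = (1, 0) :> R * R by rewrite /circle_pt mulr0 cos0 sin0.
  have rx0 u : rotx (1, 0) u = u.
    by case: u => [[a b] d]; rewrite /rotx /= !mul1r !mul0r subr0 add0r.
  have -> : conj2 (circle_pt 0) = (1, 0) :> R * R by rewrite e /conj2 /= oppr0.
  by rewrite e !rx0 rotzVK.
Qed.

Lemma turning_untilted x : @wheel R amount x.1 = 0 -> turning 1 x = x.
Proof.
case: x => c v /= w0; rewrite /turning /tilt_angle w0 /= mulr0 mul0r; congr (_, _).
have e : circle_pt 0 = (1, 0) :> R * R by rewrite /circle_pt mulr0 cos0 sin0.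
have rx0 u : rotx (1, 0) u = u.
  by case: u => [[a b] d]; rewrite /rotx /= !mul1r !mul0r subr0 add0r.
rewrite /commutator; have -> : conj2 (circle_pt 0) = (1, 0) :> R * R by rewrite e /conj2 /= oppr0.
by rewrite e !rx0 rotzVK //; exact: normal2_circle.
Qed.

Lemma normal2_2 : normal2 2 = (1, 0) :> R * R.
Proof.
rewrite /normal2 ger0_norm ?ler0n // subrr expr0n /= addr0 mul0r.
by rewrite sqrtr_sqr ger0_norm ?ler0n // divff.
Qed.

Lemma turning_untwisted x : @wheel R axis_x x.1 = 2 -> turning 1 x = x.
Proof.
case: x => c v /= w2; rewrite /turning /axis w2 normal2_2 /=; congr (_, _).
have rz0 u : rotz (1, 0) u = u.
  by case: u => [[a b] d]; rewrite /rotz /= !mul1r !mul0r subr0 add0r.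
have -> : commutator (tilt_angle 1 c) (1, 0) v = rotx (tilt_angle 1 c) (rotx (conj2 (tilt_angle 1 c)) v).
  by rewrite /commutator rz0 (_ : conj2 (1, 0) = (1, 0)) ?rz0 // /conj2 /= oppr0.
by rewrite rotxVK //; exact: circle_pt_circle.
Qed.

Lemma normal2_N2 : normal2 (-2) = (-1, 0) :> R * R.
Proof.
rewrite /normal2 normrN ger0_norm ?ler0n // subrr expr0n /= addr0 mul0r sqrrN.
by rewrite sqrtr_sqr ger0_norm ?ler0n // mulNr divff.
Qed.

(** From 4 to 5, w is (-1, 0), and the commutator is a rotation about the first
    axis, which makes a full turn. *)
Lemma turning_fixed c (e : R) : @wheel R axis_x c = -2 -> turning 1 (c, (e, 0, 0)) = (c, (e, 0, 0)).
Proof.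
move=> w2; rewrite /turning /axis /= w2 normal2_N2 /commutator /rotz /rotx /conj2 /=.
by congr (_, (_, _, _)); ring.
Qed.

(** When f is 1, the commutator is the rotation about the third axis by twice the
    opposite of the angle of w, and w goes to its conjugate. *)
Lemma commutator_reflects (a b e : R) : circle (a, b) ->
  commutator (-1, 0) (a, b) (e * a, e * b, 0) = (e * a, - (e * b), 0).
Proof.
rewrite /circle /commutator /rotz /rotx /conj2 /= => ab; congr (_, _, _); last by ring.
  by transitivity (e * a * (a ^+ 2 + b ^+ 2)); [ring|rewrite ab mulr1].
by transitivity (- (e * b) * (a ^+ 2 + b ^+ 2)); [ring|rewrite ab mulr1].
Qed.

Lemma turning_reflects c (e : R) : @wheel R amount c = 1 ->
  turning 1 (c, (e * (axis c).1, e * (axis c).2, 0)) =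
  (c, (e * (axis c).1, - (e * (axis c).2), 0)).
Proof.
move=> w1; have Cw : circle (axis c) by exact: normal2_circle.
have hp : tilt_angle 1 c = (-1, 0).
  rewrite /tilt_angle w1 mulr1 /circle_pt.
  by rewrite (_ : 2 * pi * (1 / 2) = pi) ?cospi ?sinpi //; field.
rewrite /turning; case: (axis c) Cw => a b Cw; congr (_, _).
by rewrite hp; exact: commutator_reflects.
Qed.

(** These rows and heights run along the square of equation [max(|Y|, |Z|) = 1],
    which [fib] takes to the equator. *)
Lemma fib_axis (e a : R) : e = 1 \/ e = -1 -> `|a| <= 2 ->
  fib (e * (a + (2 - `|a|)) / 2) (e * (a - (2 - `|a|)) / 2) =
  (e * (normal2 a).1, e * (normal2 a).2, 0).
Proof.
move=> ee a2; rewrite /fib.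
have -> : (e * (a + (2 - `|a|)) / 2 + e * (a - (2 - `|a|)) / 2) / 2 = 2^-1 * (e * a) by field.
have -> : (e * (a + (2 - `|a|)) / 2 - e * (a - (2 - `|a|)) / 2) / 2 = 2^-1 * (e * (2 - `|a|)) by field.
have e1 : `|e| = 1 by case: ee => ->; rewrite ?normrN normr1.
have -> : 1 - l1 (2^-1 * (e * a)) (2^-1 * (e * (2 - `|a|))) = 2^-1 * 0 :> R.
  rewrite /l1 !normrM e1 (gtr0_norm (_ : 0 < 2^-1)) ?invr_gt0 ?ltr0n //.
  by rewrite (ger0_norm (_ : 0 <= 2 - `|a|)) ?subr_ge0 //; field.
rewrite (unit3_scale (e * a, e * (2 - `|a|), 0)) ?invr_gt0 ?ltr0n //.
have e2 : e ^+ 2 = 1 by case: ee => ->; rewrite ?sqrrN expr1n.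
by rewrite /unit3 /normal2 /sqn /= !exprMn e2 !mul1r expr0n /= addr0 mul0r !mulrA.
Qed.

End Rotation.

(** * Isotopies supported in the thickened annulus *)

Section Supported.
Variable R : realType.
Implicit Types (p : Apt R * R) (x : Mpt R) (phi psi : R -> Apt R * R -> Apt R * R).

Definition time_annulus : set (R * (Apt R * R)) := (`[0, 1] : set R) `*` thick_annulus.

Lemma time_annulusE t p : time_annulus (t, p) <-> 0 <= t <= 1 /\ thick_annulus p.
Proof. by rewrite /time_annulus /setX /= in_itv. Qed.

Definition frontier p : Prop := [\/ p.1.2 = -1, p.1.2 = 1, p.2 = -1 | p.2 = 1].

(** Transported to the standard embedding, and extended by the identity. *)
Definition supported phi t x : Mpt R :=
  if `[< cap x >] then std (phi t (std_inv x)) else x.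

(** Where the two closed pieces used in [supported_cts] overlap. *)
Lemma cap_frontier x : cap x -> 6 * cone x.2 <= l1 x.2.1.1 x.2.1.2 -> frontier (std_inv x).
Proof.
move=> [Sx c0 Y6 Z6] h; apply: contrapT => nf.
have {nf}[Y6' Z6'] : -6 < fibY x.2 < 6 /\ -6 < fibZ x.2 < 6.
  move: nf; rewrite /frontier /std_inv /= => nf.
  have ne (y : R) : y / 6 <> -1 -> y / 6 <> 1 -> -6 <= y <= 6 -> -6 < y < 6.
    move=> n1 n2; rewrite !le_eqVlt => /andP[/orP[/eqP e|->] /orP[/eqP e'|->]] //.
    - by case: n1; rewrite -e; field.
    - by case: n1; rewrite -e; field.
    - by case: n2; rewrite e'; field.
  by split; apply: ne => // e; apply: nf; [constructor 1|constructor 2|constructor 3|constructor 4].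
pose m := Num.max `|fibY x.2| `|fibZ x.2|.
have m6 : m < 6 by rewrite gt_max !ltr_norml Y6' Z6'.
have mY : - m <= fibY x.2 <= m by rewrite -ler_norml le_max lexx.
have mZ : - m <= fibZ x.2 <= m by rewrite -ler_norml le_max lexx orbT.
have : l1 x.2.1.1 x.2.1.2 <= m * cone x.2.
  have e1 : x.2.1.1 + x.2.1.2 = fibY x.2 * cone x.2.
    by rewrite /fibY mulrDl !divfK // gt_eqF.
  have e2 : x.2.1.1 - x.2.1.2 = fibZ x.2 * cone x.2.
    by rewrite /fibZ mulrBl !divfK // gt_eqF.
  by rewrite l1_le e1 e2 -!mulNr !ler_pM2r // mY.
have : m * cone x.2 < 6 * cone x.2 by rewrite ltr_pM2r.
by move=> h1 h2; have := lt_le_trans (le_lt_trans h2 h1) h; rewrite ltxx.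
Qed.

Lemma supported_cts phi : cts time_annulus (fun q => phi q.1 q.2) ->
  (forall t p, 0 <= t <= 1 -> thick_annulus p -> thick_annulus (phi t p)) ->
  (forall t p, 0 <= t <= 1 -> frontier p -> phi t p = p) ->
  cts (@time_space R) (fun q => supported phi q.1 q.2).
Proof.
move=> cphi phiP fixf; have [cstd cinv stdP invP] := @std_mutual R.
pose L (q : R * Mpt R) : R := l1 q.2.2.1.1 q.2.2.1.2.
pose C (q : R * Mpt R) : R := 6 * cone q.2.2.
have cl1 (A : set (R * Mpt R)) : cts A L by rewrite /L /l1; cts_tac.
have cl2 (A : set (R * Mpt R)) : cts A C by rewrite /C /cone /l1; cts_tac.
apply: (@cts_setU _ _ _ [set q | L q <= C q] [set q | C q <= L q]).
- by apply: closed_le_fun; apply: ctsT.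
- by apply: closed_le_fun; apply: ctsT.
- by move=> q _; have [h|/ltW h] := leP (L q) (C q); [left|right].
- have capP q : (@time_space R `&` [set q | L q <= C q]) q -> cap q.2.
    by case: q => t x [/time_spaceE[_ Sx] h]; apply/capE.
  have c1 : cts (@time_space R `&` [set q | L q <= C q]) (fun q => std_inv q.2).
    by apply: (cts_comp cinv) => //; cts_tac.
  have c2 : cts (@time_space R `&` [set q | L q <= C q]) (fun q => phi q.1 (std_inv q.2)).
    apply: (cts_comp cphi (f := fun q => (q.1, std_inv q.2))); first by apply: cts_pair => //; cts_tac.
    move=> q hq; apply/time_annulusE; split; last by have [] := invP _ (capP q hq).
    by case: q hq => t x [/time_spaceE[]].
  apply: (@cts_eq _ _ _ (fun q => std (phi q.1 (std_inv q.2)))).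
    by move=> q /capP cq; rewrite /supported; case: asboolP.
  apply: (cts_comp cstd c2) => q hq; apply: phiP; last by have [] := invP _ (capP q hq).
  by case: q hq => t x [/time_spaceE[]].
- apply: (@cts_eq _ _ _ (fun q => q.2)); last by cts_tac.
  move=> [t x] [/time_spaceE[t01 Sx] h]; rewrite /supported; case: asboolP => //= cx.
  rewrite fixf //; first by have [_ ->] := invP x cx.
  exact: (cap_frontier cx h).
Qed.

Lemma supported_isotopy phi psi :
  cts time_annulus (fun q => phi q.1 q.2) -> cts time_annulus (fun q => psi q.1 q.2) ->
  (forall t p, 0 <= t <= 1 -> thick_annulus p -> thick_annulus (phi t p) /\ psi t (phi t p) = p) ->
  (forall t p, 0 <= t <= 1 -> thick_annulus p -> thick_annulus (psi t p) /\ phi t (psi t p) = p) ->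
  (forall t p, 0 <= t <= 1 -> frontier p -> phi t p = p) -> (forall t p, 0 <= t <= 1 -> frontier p -> psi t p = p) ->
  (forall p, thick_annulus p -> phi 0 p = p) ->
  isotopy_pair (supported phi) (supported psi).
Proof.
move=> cphi cpsi phiP psiP fphi fpsi phi0; have [_ _ stdP invP] := @std_mutual R.
have inv (f g : R -> Apt R * R -> Apt R * R) :
    (forall t p, 0 <= t <= 1 -> thick_annulus p -> thick_annulus (f t p) /\ g t (f t p) = p) ->
    forall t x, 0 <= t <= 1 -> S1S2 x -> S1S2 (supported f t x) /\ supported g t (supported f t x) = x.
  move=> fP t x t01 Sx; have [cx|cx] := pselect (cap x); last first.
    have e h : supported h t x = x by rewrite /supported; case: asboolP.
    by rewrite !e.
  have -> : supported f t x = std (f t (std_inv x)) by rewrite /supported; case: asboolP.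
  have [Ax ex] := invP x cx; have [Af gf] := fP t _ t01 Ax; have [cf sf] := stdP _ Af.
  rewrite /supported; case: asboolP => [_|/(_ cf)] //.
  by split; [case: cf|rewrite sf gf].
split.
- by apply: supported_cts => // t p t01 Ap; case: (phiP t p t01 Ap).
- by apply: supported_cts => // t p t01 Ap; case: (psiP t p t01 Ap).
- exact: inv.
- exact: inv.
- move=> x Sx; rewrite /supported; case: asboolP => // cx.
  by have [Ax ex] := invP x cx; rewrite phi0.
Qed.

Lemma supported_std phi t p : thick_annulus p -> supported phi t (std p) = std (phi t p).
Proof.
have [_ _ stdP _] := @std_mutual R; move=> Ap; have [cp ep] := stdP p Ap.
by rewrite /supported; case: asboolP => // _; rewrite ep.
Qed.

End Supported.

Section Shear.
Variable R : realType.
Implicit Types (p y m Z s : R) (c : R * R) (q : Apt R * R).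

(** The tent function on [-6, 6] with peak 1 at [p]. *)
Definition tent p y : R := Num.min ((6 + y) / (6 + p)) ((6 - y) / (6 - p)).
(** The piecewise linear homeomorphism of [-6, 6] which moves [p] to [p - m]. *)
Definition slide m p y : R := y - m * tent p y.

Lemma tent_left p y : -6 < p < 6 -> y <= p -> tent p y = (6 + y) / (6 + p).
Proof.
move=> /andP[p1 p2] yp; rewrite /tent min_l // ler_pdivrMr; last lra.
rewrite mulrAC ler_pdivlMr; last lra.
by rewrite -subr_ge0 (_ : _ - _ = 12 * (p - y)); [apply: mulr_ge0; lra|ring].
Qed.

Lemma tent_right p y : -6 < p < 6 -> p <= y -> tent p y = (6 - y) / (6 - p).
Proof.
move=> /andP[p1 p2] yp; rewrite /tent min_r // ler_pdivrMr; last lra.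
rewrite mulrAC ler_pdivlMr; last lra.
by rewrite -subr_ge0 (_ : _ - _ = 12 * (y - p)); [apply: mulr_ge0; lra|ring].
Qed.

Lemma slideK m p y : -6 < p < 6 -> -6 < p - m < 6 -> -6 <= y <= 6 ->
  -6 <= slide m p y <= 6 /\ slide (- m) (p - m) (slide m p y) = y.
Proof.
move=> p6 pm6 /andP[y1 y2]; have [p1 p2] := andP p6; have [m1 m2] := andP pm6.
have [yp|/ltW yp] := leP y p.
  have k0 : 0 < 6 + p by lra.
  have e : slide m p y = (6 + y) * ((6 + p - m) / (6 + p)) - 6.
    by rewrite /slide tent_left //; field; lra.
  have ym : slide m p y - (p - m) = (y - p) * ((6 + p - m) / (6 + p)).
    by rewrite e; field; lra.
  have r0 : 0 <= (6 + p - m) / (6 + p) by apply: divr_ge0; lra.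
  have le : slide m p y <= p - m.
    by rewrite -subr_le0 ym mulr_le0_ge0 //; lra.
  split; first by apply/andP; split; [rewrite e; nra|lra].
  by rewrite /slide -/(slide m p y) tent_left // e; field; apply/andP; split; lra.
have k0 : 0 < 6 - p by lra.
have e : slide m p y = 6 - (6 - y) * ((6 - p + m) / (6 - p)).
  by rewrite /slide tent_right //; field; lra.
have ym : slide m p y - (p - m) = (y - p) * ((6 - p + m) / (6 - p)).
  by rewrite e; field; lra.
have r0 : 0 <= (6 - p + m) / (6 - p) by apply: divr_ge0; lra.
have le : p - m <= slide m p y.
  by rewrite -subr_ge0 ym mulr_ge0 //; lra.
split; first by apply/andP; split; [lra|rewrite e; nra].
by rewrite /slide -/(slide m p y) tent_right // e; field; apply/andP; split; lra.
Qed.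

Lemma slide_peak m p : -6 < p < 6 -> slide m p p = p - m.
Proof. by move=> p6; rewrite /slide tent_left // divff ?mulr1 // gt_eqF //; lra. Qed.

Lemma slide_end m p y : -6 < p < 6 -> y = -6 \/ y = 6 -> slide m p y = y.
Proof.
move=> p6 [] ->; have [p1 p2] := andP p6; rewrite /slide.
  by rewrite tent_left ?subrr ?mul0r ?mulr0 ?subr0 // ltW.
by rewrite tent_right ?subrr ?mul0r ?mulr0 ?subr0 // ltW.
Qed.

Lemma slide0 p y : slide 0 p y = y. Proof. by rewrite /slide mul0r subr0. Qed.

(** The row of the arc which is moved, over each column, and the row to which
    it is moved. *)
Definition crest : seq int := [:: 1; 0; -1; -1; -1; -2; -2; -2; -3; -2; -1; 0; 1; 2; 2; 2; 2].
Definition trough : seq int :=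
  [:: -3; -2; -1; -1; -1; -2; -2; -2; -3; -4; -4; -4; -4; -4; -4; -4; -4].

(** Zero for [Z <= 1/2], where the other strands are while this one moves. *)
Definition bump Z : R := Num.max 0 (Num.min (12 * (Z - 1 / 2)) (2 * (6 - Z))).
Definition amplitude c Z : R := Num.max 0 (Num.min (@wheel R crest c - @wheel R trough c) (bump Z)).

(** Over each column the row [crest] is moved down to [trough], except near the
    frontier and for low heights. *)
Definition shear s q : Apt R * R :=
  ((q.1.1, slide (s * amplitude q.1.1 (6 * q.2)) (@wheel R crest q.1.1) (6 * q.1.2) / 6), q.2).
Definition shear_inv s q : Apt R * R :=
  let m := s * amplitude q.1.1 (6 * q.2) in
  ((q.1.1, slide (- m) (@wheel R crest q.1.1 - m) (6 * q.1.2) / 6), q.2).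

Lemma crest_bounds c : -3 <= @wheel R crest c <= 2.
Proof. by rewrite (@wheel_ge R crest (-3)) // (@wheel_le R crest 2). Qed.

Lemma trough_ge c : -4 <= @wheel R trough c.
Proof. exact: (@wheel_ge R trough (-4)). Qed.

Lemma amplitude_ge0 c Z : 0 <= amplitude c Z.
Proof. by rewrite /amplitude le_max lexx. Qed.

Lemma shear_bounds s c Z : 0 <= s <= 1 ->
  -6 < @wheel R crest c < 6 /\ -6 < @wheel R crest c - s * amplitude c Z < 6.
Proof.
move=> /andP[s0 s1]; have /andP[p1 p2] := crest_bounds c; have q1 := trough_ge c.
have a0 := amplitude_ge0 c Z.
have a1 : amplitude c Z <= @wheel R crest c + 4.
  rewrite /amplitude ge_max; apply/andP; split; first by lra.
  by rewrite ge_min; apply/orP; left; lra.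
have sa : s * amplitude c Z <= amplitude c Z by rewrite ler_piMl.
have sa0 : 0 <= s * amplitude c Z by rewrite mulr_ge0.
by split; apply/andP; split; lra.
Qed.

Lemma bump_end Z : Z = -6 \/ Z = 6 -> bump Z = 0.
Proof.
case=> ->; rewrite /bump; apply/max_idPl; rewrite ge_min; apply/orP; [left|right]; lra.
Qed.

Lemma cts_amplitude (A : set (R * (Apt R * R))) :
  (forall q : R * (Apt R * R), A q -> circle q.2.1.1) -> cts A (fun q : R * (Apt R * R) => amplitude q.2.1.1 (6 * q.2.2)).
Proof.
move=> hA; have cw (l : seq int) : cts A (fun q : R * (Apt R * R) => @wheel R l q.2.1.1) by apply: cts_wheel => //; cts_tac.
by rewrite /amplitude /bump; apply: cts_max; [cts_tac|apply: cts_min];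
  [apply: cts_add => //; apply: cts_opp|cts_tac].
Qed.

Lemma cts_slide (T : topologicalType) (A : set T) (m p y : T -> R) :
  cts A m -> cts A p -> cts A y -> (forall t, A t -> -6 < p t < 6) ->
  cts A (fun t => slide (m t) (p t) (y t)).
Proof.
move=> cm cp cy hp.
have c1 : cts A (fun t => (6 + p t)^-1).
  by apply: cts_inv; [cts_tac|move=> t /hp/andP[? ?]; rewrite gt_eqF //; lra].
have c2 : cts A (fun t => (6 - p t)^-1).
  by apply: cts_inv; [cts_tac|move=> t /hp/andP[? ?]; rewrite gt_eqF //; lra].
rewrite /slide /tent; apply: cts_add => //; apply: cts_opp; apply: cts_mul => //.
by apply: cts_min; apply: cts_mul => //; cts_tac.
Qed.

Lemma shear_isotopy : isotopy_pair (supported shear) (supported shear_inv).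
Proof.
have i6 (a : R) : a \in `[-1, 1] -> -6 <= 6 * a <= 6.
  by rewrite in_itv /= => /andP[? ?]; apply/andP; split; lra.
have i6' (a : R) : -6 <= a <= 6 -> a / 6 \in `[-1, 1].
  by move=> /andP[? ?]; rewrite in_itv /=; apply/andP; split; lra.
have k1 (a : R) : 6 * (a / 6) = a by field.
have k2 (a : R) : 6 * a / 6 = a by field.
have circ (q : R * (Apt R * R)) : @time_annulus R q -> circle q.2.1.1 by case=> _ [[]].
have ca := cts_amplitude circ.
have cw (l : seq int) : cts (@time_annulus R) (fun q : R * (Apt R * R) => @wheel R l q.2.1.1).
  by apply: cts_wheel => //; cts_tac.
have cm : cts (@time_annulus R) (fun q : R * (Apt R * R) => q.1 * amplitude q.2.1.1 (6 * q.2.2)).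
  by apply: cts_mul => //; cts_tac.
have tE t q : @time_annulus R (t, q) -> 0 <= t <= 1 by move=> /time_annulusE[].
have fr q : frontier q -> [\/ 6 * q.1.2 = -6, 6 * q.1.2 = 6, 6 * q.2 = -6 | 6 * q.2 = 6].
  by case=> ->; rewrite ?mulrN ?mulr1; [constructor 1|constructor 2|constructor 3|constructor 4].
have amp0 c Z : bump Z = 0 -> amplitude c Z = 0.
  by move=> b0; rewrite /amplitude b0; apply/max_idPl; rewrite ge_min lexx orbT.
apply: supported_isotopy.
- apply: cts_pair; last by cts_tac.
  apply: cts_pair; first by cts_tac.
  apply: cts_mul; last exact: cts_cst.
  apply: cts_slide => //; first by cts_tac.
  by move=> [t q] /tE/(shear_bounds q.1.1 0)[].
- apply: cts_pair; last by cts_tac.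
  apply: cts_pair; first by cts_tac.
  apply: cts_mul; last exact: cts_cst.
  apply: cts_slide; [exact: cts_opp|by apply: cts_add => //; exact: cts_opp|by cts_tac|].
  by move=> [t q] /tE/(shear_bounds q.1.1 (6 * q.2))[].
- move=> t [[c y] z] t01 [[/= Cc y1] z1].
  have [p6 pm6] := shear_bounds c (6 * z) t01; have [s6 sK] := slideK p6 pm6 (i6 y y1).
  split; first by split; [split=> //=; exact: i6'|].
  by rewrite /shear_inv /shear /= k1 sK k2.
- move=> t [[c y] z] t01 [[/= Cc y1] z1].
  have [p6 pm6] := shear_bounds c (6 * z) t01.
  have pK : @wheel R crest c - t * amplitude c (6 * z) - - (t * amplitude c (6 * z)) =
    @wheel R crest c by ring.
  have [|s6 sK] := @slideK (- (t * amplitude c (6 * z))) _ _ pm6 _ (i6 y y1); first by rewrite pK.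
  split; first by split; [split=> //=; exact: i6'|].
  rewrite /shear_inv /shear /= k1.
  by move: sK; rewrite pK opprK => ->; rewrite k2.
- move=> t [[c y] z] t01 /fr /=; rewrite /shear /= => h; congr (_, _, _).
  have [p6 pm6] := shear_bounds c (6 * z) t01.
  have [e|e] : (6 * y = -6 \/ 6 * y = 6) \/ (6 * z = -6 \/ 6 * z = 6) by case: h => h; auto.
    by rewrite slide_end // k2.
  by rewrite amp0 ?bump_end // mulr0 slide0 k2.
- move=> t [[c y] z] t01 /fr /=; rewrite /shear_inv /= => h; congr (_, _, _).
  have [p6 pm6] := shear_bounds c (6 * z) t01.
  have [e|e] : (6 * y = -6 \/ 6 * y = 6) \/ (6 * z = -6 \/ 6 * z = 6) by case: h => h; auto.
    by rewrite slide_end // k2.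
  by rewrite amp0 ?bump_end // mulr0 oppr0 slide0 k2.
- by move=> [[c y] z] _; rewrite /shear /= mul0r slide0 k2.
Qed.

End Shear.

(** * The two diagrams represent isotopic curves *)

Section MatchChecks.

(** The intermediate curve: the second curve, with rows and heights exchanged
    on the columns from 0 to 4 modulo 17. *)
Definition ysC : seq int :=
  take 26 ys2 ++ [:: 1; 0; -1; -1; -1] ++ take 16 (drop 31 ys2) ++ [:: -1; 0; 1; 1; 1] ++ drop 52 ys2.

Definition wh (a : seq int) (i : int) : int := ext 17 0 a i.
(** The conditions below relate affine functions on an edge, so it is enough to
    check them at both ends; [v] reads the lists indexed by vertices, and [w] those
    indexed by columns. *)
Definition ends (P : (seq int -> int) -> (seq int -> int) -> bool) j : bool :=
  P (fun a => gyl a j) (wh^~ (gcol j)) && P (fun a => gyr a j) (wh^~ (gcol j + 1)).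

Definition same_point (v w : seq int -> int) : bool := (v ysC == v ys2) && (v zs1 == v zs2).

(** The four cases are: no tilt; no rotation about the third axis; a strand along
    the first axis; and a strand along the axis w or its opposite, according to
    the sign [e], with [s] the sign of the first coordinate of w. *)
Definition turned j : bool :=
  [|| ends (fun v w => (w amount == 0) && same_point v w) j,
      ends (fun v w => (w axis_x == 2) && same_point v w) j,
      has (fun e : int => ends (fun v w => [&& w axis_x == -2, same_point v w, v ys2 == e
        & v zs2 == 2 * e]) j) [:: 1; -1]
    | has (fun e : int => has (fun s : int => ends (fun v w => [&& w amount == 1,
        0 <= s * w axis_x <= 2, 2 * v ys2 + v zs2 == 2 * e * w axis_x,
        2 * v ys2 - v zs2 == 2 * e * (2 - s * w axis_x) & (v zs2 == 2 * v ysC) && (v zs1 == 2 * v ys2)]) j)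
        [:: 1; -1]) [:: 1; -1]].

(** Either the edge belongs to the strand which is moved, and is high enough to be
    moved by the full amount, or nothing has to move in its columns, or it is too
    low to be moved. *)
Definition sheared j : bool :=
  ends (fun v w => (-6 <= v ysC <= 6) && (-6 <= v zs1 <= 6)) j &&
  [|| ends (fun v w => [&& w crest == v ysC, w trough == v ys1, w trough <= w crest,
        w crest - w trough <= 6 * v zs1 - 6 & w crest - w trough <= 12 - v zs1]) j,
      ends (fun v w => (v ysC == v ys1) && (w crest == w trough)) j
    | ends (fun v w => (v ysC == v ys1) && (v zs1 <= 1)) j].

Lemma turned_ok : all turned idx. Proof. by vm_compute. Qed.
Lemma sheared_ok : all sheared idx. Proof. by vm_compute. Qed.

End MatchChecks.

Section Matching.
Variable R : realType.
Local Notation r := (@rint R).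
Implicit Types (j : nat) (i : int) (t f : R).

(** A point of the knot in the thickened annulus. *)
Definition strand ys zs t : Apt R * R := (gcurve ys ord0 t, gheight zs ord0 t).

Lemma std_strand ys zs t : std (strand ys zs t) =
  (circle_pt (px (52 * t) / 17), fib (py ys (52 * t)) (py zs (52 * t) / 2)).
Proof.
rewrite /std /strand /gcurve /gheight /=; congr (_, fib _ _); first by field.
by rewrite -/(py zs _) -[pz _ _]/(py zs _); field.
Qed.

(** The comparisons of curves below are made edge by edge. *)
Lemma strand_edge t : exists j f, [/\ (j < 52)%N, 0 <= f <= 1,
    circle_pt (px (52 * t) / 17) = circle_pt ((r (gcol j) + f) / 17)
  & forall a, nth 0 a 52 = nth 0 a 0 -> py a (52 * t) = edgeY a j f].
Proof.
set m := Num.floor t; have /andP[m1 m2] := floor_itv t.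
rewrite intrD -/m in m1 m2.
have [l [s [l52 s0 s1 uE]]] : exists l (s : R), [/\ (l < 52)%N, 0 <= s, s < 1 & 52 * (t - r m) = l%:R + s].
  by apply: grid_decomp; apply/andP; split; rewrite /r /rint; lra.
have s01 : 0 <= s <= 1 by rewrite s0 ltW.
have tE : 52 * t = (l%:R + s) + (m * 52)%:~R by rewrite -uE /r /rint intrM; ring.
have per c a : interp (fun n => r (ext 52 c a n)) (52 * t) =
    interp (fun n => r (ext 52 c a n)) (l%:R + s) + r (c * m).
  rewrite tE (@interp_period R _ (m * 52) (r (c * m))) // => n.
  by rewrite addrC extM // /r /rint intrD addrC.
exists l, (frac l s); split=> //.
- by rewrite /frac; case: gup => //; move/andP: s01 => [? ?]; apply/andP; split; lra.
- rewrite /px per -/(px (l%:R + s)) (px_frac grid_ok1) //.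
  rewrite (_ : (_ + r (34 * m)) / 17 = (r (gcol l) + frac l s) / 17 + (2 * m)%:~R).
    by rewrite circle_ptDz.
  by rewrite /r /rint !intrM; field.
- move=> a a52; rewrite /py per mul0r addr0 (interp_nat (c := 0)) ?addr0 //.
  rewrite /edgeY /gyl /gyr /frac /gy /r /rint intrB.
  by case: (gup l); ring.
Qed.

Definition mix f (a b : int) : R := r a + f * (r b - r a).

Lemma mix_comb f (k l m a b c a' b' c' : int) :
  k * a + l * b = m * c -> k * a' + l * b' = m * c' ->
  r k * mix f a a' + r l * mix f b b' = r m * mix f c c'.
Proof.
move=> /(congr1 r) h1 /(congr1 r) h2; move: h1 h2; rewrite /mix /r /rint !intrD !intrM => h1 h2.
transitivity ((1 - f) * (k%:~R * a%:~R + l%:~R * b%:~R) +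
  f * (k%:~R * a'%:~R + l%:~R * b'%:~R)); first by ring.
by rewrite h1 h2; ring.
Qed.

Lemma mix_le f (a b c d : int) : 0 <= f <= 1 -> a <= c -> b <= d -> mix f a b <= mix f c d.
Proof.
move=> /andP[f0 f1]; rewrite -(ler_int R) -[b <= d](ler_int R) => h1 h2.
rewrite /mix /r /rint -subr_ge0.
have -> : c%:~R + f * (d%:~R - c%:~R) - (a%:~R + f * (b%:~R - a%:~R)) =
   (1 - f) * (c%:~R - a%:~R) + f * (d%:~R - b%:~R) :> R by ring.
by apply: addr_ge0; apply: mulr_ge0; lra.
Qed.

Lemma mix_cst f (a : int) : mix f a a = r a.
Proof. by rewrite /mix subrr mulr0 addr0. Qed.

Lemma fib_swap (Y Z : R) : fib Z Y = ((fib Y Z).1.1, - (fib Y Z).1.2, (fib Y Z).2).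
Proof.
have e (a b c : R) : unit3 (a, - b, c) = ((unit3 (a, b, c)).1.1, - (unit3 (a, b, c)).1.2, (unit3 (a, b, c)).2).
  by rewrite /unit3 /sqn /= sqrrN mulNr.
rewrite /fib -e (_ : (Z - Y) / 2 = - ((Y - Z) / 2)); last by field.
by rewrite (addrC Z) /l1 normrN.
Qed.

Lemma fib_diag (e : R) : e = 1 \/ e = -1 -> fib e e = (e, 0, 0).
Proof.
move=> he; rewrite /fib subrr mul0r (_ : (e + e) / 2 = e); last by field.
have -> : 1 - l1 e 0 = 0.
  by rewrite /l1 normr0 addr0; case: he => ->; rewrite ?normrN normr1 subrr.
apply: unit3_id; rewrite /sphere /= expr0n !addr0.
by case: he => ->; rewrite ?sqrrN expr1n.
Qed.

Lemma turning_strand t : turning 1 (std (strand ys2 zs2 t)) = std (strand ysC zs1 t).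
Proof.
have [j [f [j52 f01 cE yE]]] := strand_edge t.
rewrite !std_strand cE !yE //; set c := circle_pt _.
have wE a : wheel a c = mix f (wh a (gcol j)) (wh a (gcol j + 1)) by exact: wheel_edge.
have vE a : edgeY a j f = mix f (gyl a j) (gyr a j) by [].
have same : (gyl ysC j == gyl ys2 j) && (gyl zs1 j == gyl zs2 j) ->
    (gyr ysC j == gyr ys2 j) && (gyr zs1 j == gyr zs2 j) ->
    edgeY ysC j f = edgeY ys2 j f :> R /\ edgeY zs1 j f = edgeY zs2 j f :> R.
  by rewrite !vE => /andP[/eqP -> /eqP ->] /andP[/eqP -> /eqP ->].
have e1P e : e \in [:: 1; -1 : int] -> r e = 1 \/ r e = -1.
  by rewrite !inE => /orP[] /eqP ->; [left|right; rewrite /r /rint intrN].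
have := allP turned_ok j (idxP j52); rewrite /turned => /or4P[].
- case/andP=> /andP[/eqP a0 sl] /andP[/eqP a1 sr]; have [-> ->] := same sl sr.
  by apply: turning_untilted; rewrite wE a0 a1 mix_cst.
- case/andP=> /andP[/eqP a0 sl] /andP[/eqP a1 sr]; have [-> ->] := same sl sr.
  by apply: turning_untwisted; rewrite wE a0 a1 mix_cst.
- case/hasP=> e /e1P he /andP[/and4P[/eqP a0 sl /eqP y0 /eqP z0] /and4P[/eqP a1 sr /eqP y1 /eqP z1]].
  have [-> ->] := same sl sr; rewrite !vE y0 y1 z0 z1 !mix_cst.
  have -> : r (2 * e) / 2 = r e by rewrite /r /rint intrM; field.
  by rewrite fib_diag // turning_fixed // wE a0 a1 mix_cst /r /rint intrN.
case/hasP=> e /e1P he /hasP[s /e1P hs] /andP[].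
case/and5P=> /eqP a0 /andP[p0 q0] /eqP u0 /eqP v0 /andP[/eqP y0 /eqP z0].
case/and5P=> /eqP a1 /andP[p1 q1] /eqP u1 /eqP v1 /andP[/eqP y1 /eqP z1].
set A := wheel axis_x c; set Y := edgeY ys2 j f; set Z := edgeY zs2 j f.
have AE : A = mix f (wh axis_x (gcol j)) (wh axis_x (gcol j + 1)) by exact: wE.
have sA : 0 <= r s * A <= 2.
  have -> : r s * A = mix f (s * wh axis_x (gcol j)) (s * wh axis_x (gcol j + 1)).
    by rewrite AE /mix /r /rint !intrM; ring.
  rewrite -[0 in X in X && _](mix_cst f 0) -[2 in X in _ && X](mix_cst f 2).
  by rewrite !mix_le.
have absA : `|A| = r s * A.
  case/andP: sA; case: hs => ->; rewrite ?mul1r ?mulN1r => h _; first by rewrite ger0_norm.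
  by rewrite ler0_norm // -oppr_ge0.
have e2 : 2 * Y + Z = 2 * r e * A.
  have := @mix_comb f 2 1 (2 * e) _ _ _ _ _ _ (etrans (congr1 _ (mul1r _)) u0)
    (etrans (congr1 _ (mul1r _)) u1).
  by rewrite -!vE -/Y -/Z -AE mul1r /r /rint intrM.
have e3 : 2 * Y - Z = 2 * r e * (2 - `|A|).
  have := @mix_comb f 2 (-1) (2 * e) _ _ _ _ _ _ (etrans (congr1 _ (mulN1r _)) v0)
    (etrans (congr1 _ (mulN1r _)) v1).
  have -> : mix f (2 - s * wh axis_x (gcol j)) (2 - s * wh axis_x (gcol j + 1)) = 2 - `|A|.
    move: (wh axis_x (gcol j)) (wh axis_x (gcol j + 1)) AE absA => a b -> ->.
    by rewrite /mix /r /rint !(intrB, intrM); ring.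
  by rewrite -!vE -/Y -/Z /r /rint intrM intrN mulN1r.
have YE : Y = r e * (A + (2 - `|A|)) / 2.
  by apply: (mulfI (_ : 4 != 0)); [rewrite pnatr_eq0|lra].
have ZE : Z / 2 = r e * (A - (2 - `|A|)) / 2.
  by apply: (mulfI (_ : 4 != 0)); [rewrite pnatr_eq0|lra].
have yC : edgeY ysC j f = Z / 2.
  by rewrite /Z !vE y0 y1 /mix /r /rint !intrM; field.
have zC : edgeY zs1 j f / 2 = Y.
  by rewrite /Y !vE z0 z1 /mix /r /rint !intrM; field.
have a2 : `|A| <= 2 by rewrite absA; case/andP: sA.
rewrite yC zC [fib (Z / 2) Y]fib_swap YE ZE fib_axis //.
by apply: turning_reflects; rewrite wE a0 a1 mix_cst.
Qed.

Lemma shearing_strand t : supported (@shear R) 1 (std (strand ysC zs1 t)) = std (strand ys1 zs1 t).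
Proof.
have [j [f [j52 f01 cE yE]]] := strand_edge t.
set c := circle_pt ((r (gcol j) + f) / 17).
set Y := edgeY ysC j f; set Z := edgeY zs1 j f / 2.
have CE : strand ysC zs1 t = ((c, Y / 6), Z / 6).
  rewrite /strand /gcurve /gheight cE yE // -[pz _ _]/(py zs1 _) yE //.
  by congr (_, _, _); rewrite /Z; field.
have wE a : wheel a c = mix f (wh a (gcol j)) (wh a (gcol j + 1)) by exact: wheel_edge.
have vE a : edgeY a j f = mix f (gyl a j) (gyr a j) by [].
have k1 (a : R) : 6 * (a / 6) = a by field.
have := allP sheared_ok j (idxP j52); rewrite /sheared.
case/andP=> /andP[/andP[/andP[b1 b2] /andP[b3 b4]] /andP[/andP[b5 b6] /andP[b7 b8]]] hc.
have six (a b : int) : -6 <= a -> a <= 6 -> -6 <= b -> b <= 6 -> -6 <= mix f a b <= 6.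
  by move=> h1 h2 h3 h4; rewrite -{1}[-6](mix_cst f (-6)) -[6 in X in _ && X](mix_cst f 6) !mix_le.
have Y6 : -6 <= Y <= 6 by rewrite /Y vE six.
have Z6 : -6 <= Z <= 6.
  by have : -6 <= edgeY zs1 j f <= 6 by [rewrite vE six]; rewrite /Z => /andP[? ?]; apply/andP; split; lra.
have At : thick_annulus (strand ysC zs1 t).
  rewrite CE; move/andP: Y6 => [? ?]; move/andP: Z6 => [? ?].
  by split; [split; [exact: circle_pt_circle|]|]; rewrite /= in_itv /=; apply/andP; split; lra.
rewrite supported_std // CE /shear [in LHS]/= !k1 mul1r.
rewrite std_strand cE !yE // -/c /std /= !k1; congr (_, fib _ _).
have p6 : -6 < wheel crest c < 6 by have /andP[? ?] := crest_bounds c; apply/andP; split; lra.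
have amp0 (d : R) : Num.max 0 (Num.min 0 d) = 0 by apply/max_idPl; rewrite ge_min lexx.
case/or3P: hc.
- case/andP=> /and5P[/eqP c0 /eqP t0 d0 u0 v0] /and5P[/eqP c1 /eqP t1 d1 u1 v1].
  have cY : wheel crest c = Y by rewrite wE c0 c1 /Y vE.
  rewrite cY slide_peak -?cY //.
  suff -> : amplitude c Z = wheel crest c - wheel trough c.
    by rewrite subKr wE t0 t1 vE.
  have D0 : wheel trough c <= wheel crest c by rewrite !wE mix_le.
  have DE : wheel crest c - wheel trough c =
      mix f (wh crest (gcol j) - wh trough (gcol j)) (wh crest (gcol j + 1) - wh trough (gcol j + 1)).
    by rewrite !wE /mix /r /rint !intrB; ring.
  have D1 : wheel crest c - wheel trough c <= 12 * (Z - 1 / 2).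
    have -> : 12 * (Z - 1 / 2) = mix f (6 * gyl zs1 j - 6) (6 * gyr zs1 j - 6).
      by rewrite /Z vE /mix /r /rint !(intrB, intrM); field.
    by rewrite DE mix_le.
  have D2 : wheel crest c - wheel trough c <= 2 * (6 - Z).
    have -> : 2 * (6 - Z) = mix f (12 - gyl zs1 j) (12 - gyr zs1 j).
      by rewrite /Z vE /mix /r /rint !(intrB, intrM); field.
    by rewrite DE mix_le.
  have B : wheel crest c - wheel trough c <= bump Z by rewrite /bump le_max le_min D1 D2 orbT.
  by rewrite /amplitude min_l // max_r ?subr_ge0.
- case/andP=> /andP[/eqP c0 /eqP t0] /andP[/eqP c1 /eqP t1].
  have -> : amplitude c Z = 0 by rewrite /amplitude !wE t0 t1 subrr amp0.
  by rewrite slide0 /Y !vE c0 c1.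
case/andP=> /andP[/eqP c0 t0] /andP[/eqP c1 t1].
have Zh : Z <= 1 / 2.
  have : edgeY zs1 j f <= 1 by rewrite -[1 in leRHS](mix_cst f 1) vE mix_le.
  by rewrite /Z; lra.
have -> : amplitude c Z = 0.
  have -> : amplitude c Z = Num.max 0 (Num.min 0 (wheel crest c - wheel trough c)).
    rewrite /amplitude minC; congr (Num.max _ (Num.min _ _)).
    by apply/max_idPl; rewrite ge_min; apply/orP; left; lra.
  exact: amp0.
by rewrite slide0 /Y !vE c0 c1.
Qed.

End Matching.

(** * The knot *)

Lemma compact_ball3 (R : realType) : compact (ball3 (1 : R)).
Proof.
apply: (@subclosed_compact _ _ (((`[-1, 1] : set R) `*` (`[-1, 1] : set R)) `*` (`[-1, 1] : set R))).
- by rewrite /ball3; apply: closed_le_fun; apply: ctsT; cts_tac.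
- by apply: compact_setX; [apply: compact_setX|]; exact: segment_compact.
- move=> [[a b] c]; rewrite /ball3 /= !in_itv /= expr1n => h.
  have [h1 h2 h3] : [/\ a ^+ 2 <= 1, b ^+ 2 <= 1 & c ^+ 2 <= 1].
    by have := sqr_ge0 a; have := sqr_ge0 b; have := sqr_ge0 c; split; lra.
  have sq (x : R) : x ^+ 2 <= 1 -> -1 <= x <= 1 by move=> ?; apply/andP; split; nra.
  by split; [split|]; apply: sq.
Qed.

Section Knot.
Variable R : realType.
Variables (E E' : Mpt R -> Mpt R) (EE : mutual S1S2 S1S2 E E').
Local Notation r := (@rint R).

Lemma strand_thick ys os zs t : grid_ok ys os zs -> thick_annulus (@strand R ys zs t).
Proof.
move=> ok; have [_ _ /(_ t)[Cc]] := gcurve_closed R ok ord0.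
have [_ _ /(_ t)] := gheight_closed R ok ord0.
rewrite /= !in_itv /= => /andP[? ?] /andP[? ?].
by split; [split|] => //=; rewrite in_itv /=; apply/andP; split; exact: ltW.
Qed.

(** The knot is embedded since the heights differ at the double points. *)
Lemma strand_inj ys os zs (ok : grid_ok ys os zs) (p q : 'I_1 * R) : param p -> param q ->
  strand ys zs p.2 = strand ys zs q.2 -> p = q.
Proof.
move=> Pp Pq [e1 e2 e3 e4]; apply/eqP; apply: contraT => pq.
have eg : gcurve ys p.1 p.2 = gcurve ys q.1 q.2.
  by rewrite (ord1 p.1) (ord1 q.1); congr (_, _, _).
have eh : gheight zs p.1 p.2 = gheight zs q.1 q.2 by rewrite (ord1 p.1) (ord1 q.1).
have oo := goverP ok Pp Pq pq eg.
have [po|no] := boolP (gover os p.1 p.2).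
  by have := gheight_over ok Pp Pq pq eg po; rewrite eh ltxx.
have {oo no} qo : gover os q.1 q.2 by move: no; rewrite oo negbK.
by rewrite eq_sym in pq; have := gheight_over ok Pq Pp pq (esym eg) qo; rewrite eh ltxx.
Qed.

Lemma strand_continuous ys zs : continuous (fun t => std (@strand R ys zs t)).
Proof.
have [cs _ _ _] := @std_mutual R.
apply: ctsT; rewrite /std /strand /gcurve /gheight /=.
have ci a : cts setT (fun t : R => interp (fun n => r (ext 52 0 a n)) (52 * t)).
  by apply: (cts_comp_cont (@interp_continuous R _)); cts_tac.
apply: cts_pair.
  apply: (cts_comp_cont (@circle_pt_continuous R)); apply: cts_mul; last exact: cts_cst.
  by apply: (cts_comp_cont (@interp_continuous R _)); cts_tac.
by apply: cts_fib; apply: cts_mul; try exact: cts_cst; apply: cts_mul; try exact: cts_cst; exact: ci.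
Qed.

Definition knot_curve (i : 'I_1) (t : R) : Mpt R := E (std (strand ys1 zs1 t)).

Let ES x : S1S2 x -> S1S2 (E x). Proof. by have [_ _ EP _] := EE; move=> /EP[]. Qed.
Let EK x : S1S2 x -> E' (E x) = x. Proof. by have [_ _ EP _] := EE; move=> /EP[]. Qed.
Let stdS (p : Apt R * R) : thick_annulus p -> S1S2 (std p).
Proof. by have [_ _ stdP _] := @std_mutual R; move=> /stdP[[]]. Qed.
Let std_inj (p q : Apt R * R) : thick_annulus p -> thick_annulus q -> std p = std q -> p = q.
Proof.
have [_ _ stdP _] := @std_mutual R; move=> /stdP[_ e1] /stdP[_ e2] e.
by rewrite -e1 e e2.
Qed.
Let strandT t := @strand_thick _ _ _ t grid_ok1.

Lemma knot_closed i : closed_curve S1S2 (knot_curve i).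
Proof.
have [cE _ _ _] := EE; split.
- apply: ctsT; rewrite /knot_curve; apply: (cts_comp cE).
    exact: cts_cont (@strand_continuous ys1 zs1).
  by move=> t _; apply: stdS; exact: strandT.
- move=> t; rewrite /knot_curve /strand.
  have [_ -> _] := gcurve_closed R grid_ok1 ord0.
  by have [_ -> _] := gheight_closed R grid_ok1 ord0.
- by move=> t; apply: ES; apply: stdS; exact: strandT.
Qed.

Lemma knot_inj (p q : 'I_1 * R) : param p -> param q ->
  knot_curve p.1 p.2 = knot_curve q.1 q.2 -> p = q.
Proof.
move=> Pp Pq; rewrite /knot_curve => /(congr1 E').
rewrite !EK; try by apply: stdS; exact: strandT.
move=> /std_inj; have S1 := strandT; move=> h; apply: (strand_inj grid_ok1 Pp Pq).
by apply: h; exact: strandT.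
Qed.

Definition knot : link R := @Link R 1 knot_curve isT knot_closed knot_inj.

Lemma knot_set : link_set knot = [set x | exists t, x = knot_curve ord0 t].
Proof.
apply/seteqP; split=> x; first by move=> [i [t [_ ->]]]; exists t; rewrite (ord1 i).
by move=> [t ->]; exists ord0, t; split=> //; rewrite inE.
Qed.

Lemma knot_not_split : ~ H_split knot.
Proof.
move=> [I [/set0Pn[i iI] /set0Pn[k]]]; rewrite inE => kI _.
by move: kI iI; rewrite (ord1 k) (ord1 i) => /negP.
Qed.

Section Represents.
Variable e : Apt R * R -> Mpt R.
Hypothesis eE : forall p, thick_annulus p -> e p = E (std p).

(** An isotopy of the standard curves is transported by the extension of the
    embedding. *)
Lemma represents_of ys os zs (ok : grid_ok ys os zs) (H G : R -> Mpt R -> Mpt R) :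
  isotopy_pair H G ->
  (forall t, H 1 (std (strand ys zs t)) = std (strand ys1 zs1 t)) ->
  represents e (gdiagram R ok) knot.
Proof.
move=> iso Hs; exists (gheight zs); split.
- exact (gheight_closed R ok).
- exact (gheight_over ok).
have iso' := isotopy_pair_conj EE iso.
exists (fun t => E \o H t \o E'); first exact: isotopy_pair_ambient iso'.
have key t : (E \o H 1 \o E') (e (strand ys zs t)) = knot_curve ord0 t.
  have T := strand_thick t ok.
  by rewrite /= eE // EK ?Hs //; exact: stdS.
rewrite knot_set; apply/seteqP; split=> x.
  by move=> [y [i [t ->]] <-]; exists t; rewrite (ord1 i) key.
move=> [t ->]; exists (e (strand ys zs t)); last exact: key.
by exists ord0, t.
Qed.

Lemma represents3 : represents e (diagram3 R) knot.
Proof.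
apply: (represents_of grid_ok1 (H := fun=> id) (G := fun=> id)) => //.
by split=> // *; cts_tac.
Qed.

Lemma represents4 : represents e (diagram4 R) knot.
Proof.
apply: (represents_of grid_ok2 (isotopy_pair_comp (@turning_isotopy R) (@shear_isotopy R))).
by move=> t /=; rewrite turning_strand shearing_strand.
Qed.

End Represents.

(** One triangle whose faces are the knot and twice the same path: over the
    point (x, y) it takes the midpoint of the points y and x + y of the knot,
    in the universal cover, where the knot is a path that winds twice. *)
Definition triangle (z : R * R) : Mpt R :=
  let x := 52 * z.2 in let y := 52 * (z.1 + z.2) in
  E (circle_pt ((px x / 17 + px y / 17) / 2),
     fib ((py ys1 x + py ys1 y) / 2) ((py zs1 x + py zs1 y) / 4)).

Lemma triangle_continuous (A : set (R * R)) : cts A triangle.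
Proof.
have [cE _ _ _] := EE; rewrite /triangle /=.
have ci (a : int -> R) (f : R * R -> R) : cts A f -> cts A (fun z => interp a (52 * f z)).
  by move=> cf; apply: (cts_comp_cont (@interp_continuous R _)); cts_tac.
apply: (cts_comp cE); last by move=> z _; split; [exact: circle_pt_circle|exact: fib_sphere].
have c1 : cts A (fun z : R * R => z.1 + z.2) by cts_tac.
have c2 : cts A (fun z : R * R => z.2) by cts_tac.
have p1 a := ci a _ c1; have p2 a := ci a _ c2.
apply: cts_pair.
  by apply: (cts_comp_cont (@circle_pt_continuous R)); rewrite /px; cts_tac.
by apply: cts_fib; rewrite /py; cts_tac.
Qed.

Lemma triangle_knot t : triangle (0, t) = knot_curve ord0 t.
Proof.
rewrite /triangle /knot_curve std_strand /= add0r; congr (E (circle_pt _, fib _ _)); by field.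
Qed.

(** In the universal cover these faces differ by half of the winding number 2, an
    integer. *)
Lemma triangle_faces t : triangle (1 - t, t) = triangle (t, 0).
Proof.
rewrite /triangle /= subrK addr0 mulr1 mulr0.
have e c a : interp (fun n => r (ext 52 c a n)) 52 = interp (fun n => r (ext 52 c a n)) 0 + r c.
  by rewrite -interp_period52 add0r.
rewrite /px /py !e; congr (E (_, fib _ _)).
- by rewrite -[RHS](circle_ptDz _ 1); congr circle_pt; rewrite /r /rint; field.
- by rewrite /r /rint addr0 addrC.
- by rewrite /r /rint addr0 addrC.
Qed.

Lemma enum1 : enum 'I_1 = [:: ord0].
Proof. by apply: (inj_map val_inj); rewrite val_enum_ord. Qed.

Lemma knot_trivial : Z2_trivial knot.
Proof.
exists 1%N, (fun=> triangle); split=> [_|g].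
  split; first exact/ctsP/triangle_continuous.
  move=> _ [z _ <-]; apply: ES; split; [exact: circle_pt_circle|exact: fib_sphere].
rewrite /link_cycle enum1 /= /multiplicity /= addn0.
have -> : `[< forall t, 0 <= t <= 1 -> triangle (0, t) = g t >] =
          `[< forall t, 0 <= t <= 1 -> knot_curve ord0 t = g t >].
  by apply/asboolP/asboolP => h t t01; rewrite -h // triangle_knot.
have -> : `[< forall t, 0 <= t <= 1 -> triangle (1 - t, t) = g t >] =
          `[< forall t, 0 <= t <= 1 -> triangle (t, 0) = g t >].
  by apply/asboolP/asboolP => h t t01; rewrite -h // triangle_faces.
by rewrite addn0 addnCA addnn oddD odd_double addbF.
Qed.

(** The projection of a ball to the circle lifts to the reals, so a closed curve
    in a ball cannot wind around the circle. *)
Lemma knot_not_in_ball : ~ in_3ball knot.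
Proof.
move=> [B [h [hS [g [/ctsP ch /ctsP cg hP gP]]] ->]].
rewrite knot_set => sub; have [_ cE' _ E'P] := EE.
have b12 : ball3 (1 : R) `<=` ball3 2.
  by move=> x; rewrite /ball3 /= expr1n => h1; apply: (le_trans h1); rewrite -[leLHS](expr1n _ 2); lra.
pose F x := (E' (h x)).1.
have cF : cts (ball3 1) F.
  apply: cts_fst; apply: (cts_comp cE'); first exact: cts_subset ch.
  by move=> x /b12 bx; apply: hS; exists x.
have CF x : ball3 1 x -> circle (F x).
  by move=> /b12 bx; have [[]] := E'P (h x) (hS _ (ex_intro2 _ _ x bx erefl)).
have [phi cphi phiE] : exists2 phi : R * R * R -> R, cts (ball3 1) phi &
    forall x, ball3 1 x -> circle_pt (phi x) = F x.
  apply: (circle_lift (K := ball3 1)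
    (sc := fun t x => (t * x.1.1, t * x.1.2, t * x.2)) (x0 := (0, 0, 0))) => //.
  - exact: compact_ball3.
  - by cts_tac.
  - move=> t x /andP[t0 t1]; rewrite /ball3 /= !exprMn -!mulrDr expr1n => x1.
    by rewrite mulr_ile1 ?addr_ge0 ?sqr_ge0 // expr_le1.
  - by move=> [[a b] c] _ /=; rewrite !mul1r.
  - by move=> [[a b] c] _ /=; rewrite !mul0r.
pose k t := g (knot_curve ord0 t).
have inB t : (h @` ball3 1) (knot_curve ord0 t) by apply: sub; exists t.
have kB t : ball3 1 (k t) /\ h (k t) = knot_curve ord0 t.
  by have [x bx xE] := inB t; rewrite /k -xE; have [_ ->] := hP x (b12 _ bx).
pose f t := phi (k t) - px (52 * t) / 17.
have [ck kper _] := knot_closed ord0.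
have cf : cts (`[0, 1] : set R) f.
  have c1 : cts (`[0, 1] : set R) k.
    apply: (cts_comp cg); first exact: cts_cont ck.
    by move=> t _; have [x bx <-] := inB t; exists x => //; exact: b12.
  apply: cts_add; first by apply: (cts_comp cphi c1) => t _; case: (kB t).
  apply: cts_opp; apply: cts_mul; last exact: cts_cst.
  by apply: (cts_comp_cont (@interp_continuous R _)); cts_tac.
have fint t : exists n : int, f t = n%:~R.
  have [kb hk] := kB t; have := phiE _ kb.
  rewrite /F hk /knot_curve EK; last by apply: stdS; exact: strandT.
  rewrite std_strand /= => /esym/circle_pt_eq[n e].
  by exists n; rewrite /f e addrC addKr.
have [n0 fn0] := fint 0.
(* The lift is closed and the curve in the universal cover is not. *)
have f1 : f 1 = n0%:~R - 2.
  have k1 : k 1 = k 0 by rewrite /k -(kper 0) add0r.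
  have p1 : px (0 + 52 : R) = px 0 + r 34 by rewrite /px interp_period52.
  by rewrite -fn0 /f k1 mulr1 mulr0 -(add0r (52 : R)) p1 /r /rint; field.
have /ctsP cf' := cf.
have [|c _ fc] := IVT ler01 cf' (v := n0%:~R - 1 / 2).
  rewrite fn0 f1 ge_min le_max; apply/andP; split; apply/orP; [right|left]; lra.
have [m fm] := fint c.
have m0 : m - n0 = 0.
  by apply: (@int0_of_small R); rewrite /rint intrB -fm fc; apply/andP; split; lra.
by move/(congr1 r): m0; rewrite /r /rint intrB -fm fc; lra.
Qed.

End Knot.

Lemma crossing_number_uniq (R : realType) (L : link R) (m n : nat) :
  is_crossing_number L m -> is_crossing_number L n -> m = n.
Proof.
move=> [[e [D [he hD <-]]] mmin] [[e' [D' [he' hD' <-]]] nmin].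
by apply/eqP; rewrite eqn_leq (mmin e' D') ?(nmin e D).
Qed.

Theorem mainTheorem4 (R : realType)
    (e : Apt R * R -> Mpt R) (he : proper_annulus_embedding e) :
  ~ (forall (D : diagram R) (L : link R),
       represents e D L -> Z2_trivial L ->
       alternating_diagram D -> quasi_simple_diagram D ->
       ~ H_split L -> ~ in_3ball L ->
       is_crossing_number L (crossings D))
  /\
  exists (D1 D2 : diagram R) (K : link R),
    (alternating_diagram D1 /\ quasi_simple_diagram D1) /\
    (alternating_diagram D2 /\ quasi_simple_diagram D2) /\
    crossings D1 <> crossings D2 /\
    represents e D1 K /\ represents e D2 K /\
    is_knot K /\ Z2_trivial K /\
    ~ H_split K /\ ~ in_3ball K /\
    (~ is_crossing_number K (crossings D1) \/
     ~ is_crossing_number K (crossings D2)).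
Proof.
have [E [E' [EE eE]]] := extend_embedding he; set K := knot EE.
have r3 : represents e (diagram3 R) K by exact: represents3.
have r4 : represents e (diagram4 R) K by exact: represents4.
have a3 : alternating_diagram (diagram3 R) by exact: gdiagram_alternating.
have a4 : alternating_diagram (diagram4 R) by exact: gdiagram_alternating.
have q3 := quasi_simple3 R; have q4 := quasi_simple4 R.
have z := knot_trivial EE; have s := @knot_not_split R E E' EE; have b := knot_not_in_ball (EE := EE).
have c34 : crossings (diagram3 R) <> crossings (diagram4 R).
  by rewrite crossings3 crossings4.
split=> [tait|].
  exact: c34 (crossing_number_uniq (tait _ K r3 z a3 q3 s b) (tait _ K r4 z a4 q4 s b)).
have k : is_knot K by [].
suff n34 : ~ is_crossing_number K (crossings (diagram3 R)) \/
    ~ is_crossing_number K (crossings (diagram4 R)).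
  by exists (diagram3 R), (diagram4 R), K; exact (conj (conj a3 q3) (conj (conj a4 q4)
    (conj c34 (conj r3 (conj r4 (conj k (conj z (conj s (conj b n34))))))))).
have [n3|n3] := pselect (is_crossing_number K (crossings (diagram3 R))); last by left.
by right=> n4; exact: c34 (crossing_number_uniq n3 n4).
Qed.
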